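(* Let $n\in\mathbb{N}$, let $\Omega$ be an infinite set, let $A\in\mathbb{R}$, and let $h:\Omega\to\mathbb{R}_{\geq 0}$, $m=(m_1,\ldots,m_n):\Omega\to\mathbb{N}^n$ and $\mathcal{F}:\mathbb{R}_{\geq 1}\to\mathbb{R}$ be functions such that the following hold. (1) $N(B):=\#\{a\in\Omega:h(a)\leq B\}$ is finite for all $B\geq 0$. (2) For all $\mathbf{d}\in\mathbb{N}^n$ such that every prime $p\mid d_1\cdots d_n$ satisfies $p>A$, the limit $$g(\mathbf{d}):=\lim_{B\to+\infty}\frac{\#\{a\in\Omega:h(a)\leq B,\ d_i\mid m_i(a)\ \forall 1\leq i\leq n\}}{N(B)}$$ exists, and $g$ is multiplicative, i.e. $g(a_1b_1,\ldots,a_nb_n)=g(\mathbf{a})g(\mathbf{b})$ whenever $\gcd(a_1\cdots a_n,b_1\cdots b_n)=1$. Extend $g$ to $\mathbb{N}^n$ by setting $g(\mathbf{d})=0$ if $d_1\cdots d_n$ has a prime factor $p\leq A$. (3) For every $1\leq i\leq n$ there are $c_i>0$ and $c_i'\in\mathbb{R}$ with $$\sum_{p>T}g_i(p)^2=O\left(\frac{1}{\log T}\right)\quad\text{and}\quad\sum_{p\leq T}g_i(p)=c_i\log\log T+c_i'+O\left(\frac{1}{\log T}\right).$$ (4) $\displaystyle\lim_{B\to\infty}\frac{1}{N(B)}\#\{a\in\Omega:h(a)\leq B,\ \max_{1\leq i\leq n}m_i(a)\leq\mathcal{F}(B)\}=1$. (5) With $\epsilon(B):=\dfrac{\log\log\log\mathcal{F}(B)}{\sqrt{\log\log\mathcal{F}(B)}}$,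 for all $\gamma>0$ one has $$\sum_{\substack{\mathbf{d}\in\mathbb{N}^n,\ |\mathbf{d}|\leq\mathcal{F}(B)^{\epsilon(B)}\\ p\mid d_1\cdots d_n\Rightarrow p>A}}\mu(d_1)^2\cdots\mu(d_n)^2\,|\mathcal{R}(\mathbf{d},B)|\ll_\gamma\frac{N(B)}{(\log\log\mathcal{F}(B))^\gamma}$$ with an implied constant independent of $B$, where $$\mathcal{R}(\mathbf{d},B):=\#\{a\in\Omega:h(a)\leq B,\ d_i\mid m_i(a)\ \forall 1\leq i\leq n\}-g(\mathbf{d})N(B).$$ (6) For every $1\leq i,j\leq n$ the following limit exists: $$\sigma_{i,j}:=\lim_{T\to+\infty}\frac{\sum_{p\leq T}g_{i,j}(p)}{\left(\sum_{p\leq T}g_i(p)\right)^{1/2}\left(\sum_{p\leq T}g_j(p)\right)^{1/2}}.$$ For $a\in\Omega$ let $$\mathbf{K}(a):=\left(\frac{\omega(m_1(a))-c_1\log\log\mathcal{F}(B)}{\sqrt{c_1\log\log\mathcal{F}(B)}},\ldots,\frac{\omega(m_n(a))-c_n\log\log\mathcal{F}(B)}{\sqrt{c_n\log\log\mathcal{F}(B)}}\right).$$ Then the random vectors $(\Omega,\mathbf{P}_B)\to\mathbb{R}^n$, $a\mapsto\mathbf{K}(a)$, converge in distribution as $B\to\infty$ to a central multivariate normal distribution with covariance matrix $\boldsymbol{\Sigma}$ whose $(i,j)$-entry is $\sigma_{i,j}$.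
   Context: $\mathbb{N}$ is the set of positive integers; $p$ always denotes a prime; $\mu$ is the Möbius function; $|\mathbf{d}|=\max_i d_i$; $\omega(m)$ is the number of distinct primes dividing $m$. Conditions involving iterated logarithms of $\mathcal{F}(B)$ are for $B$ sufficiently large. $g_i(d)$ denotes the value of $g$ at the vector with $d$ in position $i$ and $1$ in all other positions; $g_{i,j}(d)$ denotes the value of $g$ at the vector with $d$ in positions $i$ and $j$ and $1$ in all other positions (so $g_{i,i}=g_i$). $\mathbf{P}_B$ is the probability measure on $\Omega$ (with the discrete $\sigma$-algebra) given by $$\mathbf{P}_B[S]=\frac{\#\{a\in S:h(a)\leq B\}}{\#\{a\in\Omega:h(a)\leq B\}},\quad S\subseteq\Omega.$$ A central multivariate normal distribution has zero mean vector; its covariance matrix is allowed to be singular (a random vector is multivariate normal if every linear combination of its coordinates is univariate normal, a Dirac mass counting as normal of variance $0$). *)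

(* Defs.v *)
From HB Require Import structures.
From mathcomp Require Export all_boot all_order all_algebra.
From mathcomp Require Export finmap.
From mathcomp Require Export all_classical all_reals all_analysis.

Set Implicit Arguments.
Unset Strict Implicit.
Unset Printing Implicit Defensive.

Export Order.TTheory GRing.Theory Num.Theory.
Export numFieldNormedType.Exports.

Local Open Scope classical_set_scope.
Local Open Scope ring_scope.

Definition omega (k : nat) : nat := size (primes k).

(* Meaningful for positive [d] only. *)
Definition mobius (d : nat) : int :=
  if all (fun p => logn p d == 1%N) (primes d) then (-1) ^+ size (primes d)
  else 0.

Section vectors.
Context {n : nat}.
Implicit Types d e : {ffun 'I_n -> nat}.

(* Membership in N^n, where N is the set of positive integers. *)
Definition pos_vec d := forall i, (0 < d i)%N.

Definition rough {R : realType} (A : R) d :=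
  forall p, prime p -> (p %| \prod_i d i)%N -> A < p%:R.

Definition vec_mul d e : {ffun 'I_n -> nat} := [ffun k => (d k * e k)%N].

Definition vec1 (i : 'I_n) (x : nat) : {ffun 'I_n -> nat} :=
  [ffun k => if k == i then x else 1%N].

Definition vec2 (i j : 'I_n) (x : nat) : {ffun 'I_n -> nat} :=
  [ffun k => if (k == i) || (k == j) then x else 1%N].

Lemma vec2_diag (i : 'I_n) (x : nat) : vec2 i i x = vec1 i x.
Proof. by apply/ffunP => k; rewrite !ffunE orbb. Qed.

End vectors.

Definition primes_le_sum {R : realType} (T : R) (f : nat -> R) : R :=
  \sum_(p < (Num.truncn T).+1 | prime p) f p.

(* The number of elements of a finite set (and 0 for an infinite one). *)
Definition set_card {T : choiceType} (S : set T) : nat := #|` fset_set S|%fset.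

Section counting.
Context {R : realType} {n : nat} {Omega : pointedType}.
Variables (h : Omega -> R) (m : Omega -> {ffun 'I_n -> nat}).

Definition height_le (B : R) : set Omega := [set a | h a <= B].

Definition height_count (B : R) : nat := set_card (height_le B).

Definition div_count (d : {ffun 'I_n -> nat}) (B : R) : nat :=
  set_card [set a | h a <= B /\ forall i, (d i %| m a i)%N].

Definition remainder (g : {ffun 'I_n -> nat} -> R) (d : {ffun 'I_n -> nat})
    (B : R) : R :=
  (div_count d B)%:R - g d * (height_count B)%:R.

End counting.

Definition discrete_space (T : Type) : Type := T.

HB.instance Definition _ (T : pointedType) := Pointed.on (discrete_space T).
HB.instance Definition _ (T : pointedType) :=
  @isMeasurable.Build default_measure_display (discrete_space T)
    discrete_measurable discrete_measurable0 discrete_measurableC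
    discrete_measurableU.

(* The uniform probability on the elements of height at most [B]. As long as
   there is no such element, [mnormalize] returns the (irrelevant) Dirac mass
   given as its second argument; see [prob_heightE]. *)
Definition prob_height {R : realType} {Omega : pointedType} (h : Omega -> R)
    (B : R) : probability (discrete_space Omega) R :=
  mnormalize
    (mrestr (@counting (discrete_space Omega) R)
       (I : measurable (height_le h B : set (discrete_space Omega))))
    (dirac (point : discrete_space Omega)).

Lemma mnormalizeE (d : measure_display) (T : measurableType d) (R : realType)
    (mu : {measure set T -> \bar R}) (P : probability T R) (U : set T) (x : R) :
  mu setT = x%:E -> x != 0 -> mnormalize mu P U = (mu U * x^-1%:E)%E.
Proof. by move=> muT x0; rewrite /mnormalize muT eqe (negbTE x0). Qed.

Lemma prob_heightE (R : realType) (Omega : pointedType) (h : Omega -> R) (B : R)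
    (S : set Omega) :
  finite_set (height_le h B) -> height_le h B !=set0 ->
  prob_height h B S
  = ((set_card [set a | S a /\ h a <= B])%:R / (height_count h B)%:R)%:E.
Proof.
move=> fin ne0.
have E (D : set Omega) : finite_set D ->
    @counting (discrete_space Omega) R D = (set_card D)%:R%:E.
  by move=> finD; rewrite /counting asboolT.
have N0 : set_card (height_le h B) != 0%N.
  rewrite /set_card cardfs_eq0; apply/negP => /eqP /(fset_set_set0 fin) D0.
  by case: ne0 => a; rewrite D0.
set mu := mrestr (@counting (discrete_space Omega) R)
  (I : measurable (height_le h B : set (discrete_space Omega))).
have muE (U : set (discrete_space Omega)) :
    mu U = (set_card (U `&` height_le h B))%:R%:E.
  by apply: E; apply: sub_finite_set fin => a [].
have muT : mu setT = (height_count h B)%:R%:E by rewrite (muE setT) setTI.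
have N0R : (height_count h B)%:R != 0 :> R by rewrite pnatr_eq0.
apply: (eq_trans (mnormalizeE _ _ muT N0R)).
by apply: (eq_trans (congr1 ( *%E^~ _) (muE S))); rewrite -EFinM.
Qed.

Notation borel_rV R n := (g_sigma_algebraType (@open 'rV[R]_n)).

Definition cvg_in_distribution {R : realType} {n : nat} {I : Type}
    {d : measure_display} {Omega : measurableType d} (F : set_system I)
    (P : I -> probability Omega R) (X : I -> Omega -> 'rV[R]_n)
    (nu : probability (borel_rV R n) R) : Prop :=
  forall f : 'rV[R]_n -> R,
    continuous f -> (exists M, forall x, `|f x| <= M) ->
    ('E_(P t)[fun a => f (X t a)])%E @[t --> F] --> ('E_nu[f])%E.

Definition is_normal {R : realType} (mu : set R -> \bar R) : Prop :=
  (exists a : R, forall S, measurable S -> mu S = \d_a S) \/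
  (exists a s : R, 0 < s /\ forall S, measurable S -> mu S = normal_prob a s S).

Definition multivariate_normal {R : realType} {n : nat}
    (nu : probability (borel_rV R n) R) : Prop :=
  forall t : 'rV[R]_n,
    is_normal (pushforward nu (fun x : 'rV[R]_n => \sum_i t ord0 i * x ord0 i)).

Definition central_normal {R : realType} {n : nat}
    (nu : probability (borel_rV R n) R) (Sigma : 'M[R]_n) : Prop :=
  [/\ multivariate_normal nu,
      forall i, 'E_nu[fun x : 'rV[R]_n => x ord0 i]%E = 0%E &
      forall i j, covariance nu (fun x : 'rV[R]_n => x ord0 i)
                               (fun x : 'rV[R]_n => x ord0 j) = (Sigma i j)%:E].

(* Main.v *)
(* Put L = log log F(B), eta = sqrt (log L / L) and z = F(B)^eta. An integer up to
   F(B) has at most 1 / eta = o(sqrt L) prime factors beyond z, so omega(m_i) may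
   be replaced by its sum over the primes in (A, z]. As B grows, the average of a
   function of finitely many divisibilities converges to its [mean], for which
   distinct primes are independent: there the characteristic function and the
   exponential moments of the normalized sums factor over the primes. Since z^k
   is below the level of distribution for every fixed k, the power moments of the
   sums under the actual average and under [mean] agree up to o(1), and comparing
   Taylor polynomials of the cosine (the remainder is controlled by the exponential
   moments) yields the limit exp (- t Sigma t / 2) cos theta for the averages of
   cos (t . K + theta). Trigonometric polynomials, obtained from Bernstein
   polynomials in sines, approximate bounded continuous functions on bounded sets;
   together with tightness this replaces Levy's continuity theorem. *)

Require Import Defs.
From HB Require Import structures.
From mathcomp Require Import all_boot all_order all_algebra finmap.
From mathcomp Require Import all_classical all_reals all_analysis.
From mathcomp Require Import measurable_realfun ring lra.
Import Order.TTheory GRing.Theory Num.Theory.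
Import numFieldNormedType.Exports.
Set Implicit Arguments.
Unset Strict Implicit.
Unset Printing Implicit Defensive.
Local Open Scope classical_set_scope.
Local Open Scope ring_scope.

(** The exponent of the cutoff is caught between two demands: the primes beyond [z] must be
    [o(sqrt L)] in number, so [1 / eta = o(sqrt L)], while [k * eta <= log L / sqrt L] must
    eventually hold for every fixed [k]. The geometric mean of [1 / sqrt L] and [log L / sqrt L]
    meets both. The moments are those of centred sums. Expanding the centring, of size at most [L],
    costs a factor of order [L ^ k], which the saving of an arbitrary power of [L] in the level of
    distribution absorbs. No uniformity in the degree is needed: the degree [2 K] of the Taylor
    polynomial is fixed before [B] grows, and the error then left over is [O(4 ^ - K)]. That [F(B)]
    tends to infinity is derived: a prime of positive density beyond the values of [F] would divide
    too many of the [m_i]. The functional [mean] is a limit of averages and lives on no probability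
    space. Its positivity shows that [Sigma] is positive semidefinite; the limit law is then the
    image of independent normal variables under a factor of [Sigma], singular cases included. *)

Section continuous_real.
Context {R : realType} {T : topologicalType}.
Implicit Types (f g : T -> R).

Lemma continuous_addf f g : continuous f -> continuous g ->
  continuous (fun x => f x + g x).
Proof. by move=> fc gc x; apply: (continuousD (fc x) (gc x)). Qed.

Lemma continuous_mulf f g : continuous f -> continuous g ->
  continuous (fun x => f x * g x).
Proof. by move=> fc gc x; apply: (continuousM (fc x) (gc x)). Qed.

Lemma continuous_scalef a f : continuous f -> continuous (fun x => a * f x).
Proof. by apply: continuous_mulf => x; exact: cst_continuous. Qed.

Lemma continuous_compf f (g : R -> R) : continuous f -> continuous g ->
  continuous (fun x => g (f x)).
Proof. by move=> fc gc x; apply: (continuous_comp (fc x) (gc _)). Qed.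

End continuous_real.

Lemma is_derive_continuous {R : realType} (f df : R -> R) :
  (forall x : R, is_derive x 1 f (df x)) -> continuous f.
Proof.
move=> fd x; apply: differentiable_continuous; apply/derivable1_diffP.
by case: (fd x).
Qed.
(** * Taylor bounds for the cosine *)

Section taylor.
Context {R : realType}.
Implicit Types x y theta : R.

(** Integrates a bound on the derivative once, by the mean value theorem for [x ^+ k.+1 / (k.+1)!]
    minus [f]; iterating it yields the Taylor estimate without integrals. *)
Lemma le_exp_div_fact_derive k (f df : R -> R) :
  (forall x, is_derive x 1 f (df x)) -> f 0 = 0 ->
  (forall x, 0 <= x -> df x <= x ^+ k / k`!%:R) ->
  forall y, 0 <= y -> f y <= y ^+ k.+1 / (k.+1)`!%:R.
Proof.
move=> fd f0 dfle y; rewrite le_eqVlt => /predU1P[<-|y0].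
  by rewrite f0 expr0n mul0r.
pose u x := x ^+ k.+1 / (k.+1)`!%:R - f x.
have ud x : is_derive x 1 u (x ^+ k / k`!%:R - df x).
  have := is_deriveB (is_deriveZ (k.+1)`!%:R^-1
    (is_deriveX k.+1 (is_derive_id x 1))) (fd x).
  rewrite (_ : _ - f = u); last first.
    by apply/funext => t; rewrite /u !fctE /GRing.scale/= mulrC.
  move=> /is_derive_eq; apply; congr (_ - _).
  rewrite /GRing.scale/= factS natrM invfM mulr1.
  by rewrite mulrACA mulVf ?pnatr_eq0// mul1r mulrC.
have uc : {within `[0, y], continuous u}.
  apply: continuous_subspaceT => x.
  by apply: differentiable_continuous; apply/derivable1_diffP; case: (ud x).
have [c cy E] := MVT y0 (fun x _ => ud x) uc.
have : 0 <= u y - u 0.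
  rewrite E mulr_ge0 ?subr_ge0 ?(ltW y0)// dfle//.
  by move: cy; rewrite in_itv/= => /andP[/ltW].
by rewrite /u f0 expr0n mul0r subr0 subr0 subr_ge0.
Qed.

Lemma norm_le_exp_div_fact_derive k (f df : R -> R) :
  (forall x, is_derive x 1 f (df x)) -> f 0 = 0 ->
  (forall x, `|df x| <= `|x| ^+ k / k`!%:R) ->
  forall y, `|f y| <= `|y| ^+ k.+1 / (k.+1)`!%:R.
Proof.
move=> fd f0 dfle.
have pos (f1 df1 : R -> R) : (forall x, is_derive x 1 f1 (df1 x)) -> f1 0 = 0 ->
    (forall x, `|df1 x| <= `|x| ^+ k / k`!%:R) ->
    forall y, 0 <= y -> `|f1 y| <= y ^+ k.+1 / (k.+1)`!%:R.
  move=> fd1 f10 dfle1 y y0; rewrite ler_norml lerNl; apply/andP; split.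
    apply: (@le_exp_div_fact_derive k (\- f1) (\- df1)) => //=.
    - by rewrite f10 oppr0.
    - move=> x x0; apply: le_trans (ler_norm _) _; rewrite normrN.
      by apply: le_trans (dfle1 x) _; rewrite ger0_norm.
  apply: (@le_exp_div_fact_derive k f1 df1) => // x x0.
  by apply: le_trans (ler_norm _) _; apply: le_trans (dfle1 x) _; rewrite ger0_norm.
(* Negative arguments reduce to positive ones through the reflection [x |-> f (- x)]. *)
move=> y; have [y0|y0] := lerP 0 y.
  by have := pos f df fd f0 dfle y y0; rewrite (ger0_norm y0).
have := @pos (f \o -%R) (fun x => - df (- x)) _ _ _ (- y).
rewrite /= opprK (ltr0_norm y0); apply; last by rewrite oppr_ge0 ltW.
- move=> x; have := is_derive1_comp (fd (- x)) (is_deriveNid x 1).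
  by move=> /is_derive_eq; apply; rewrite mulrN1.
- by rewrite oppr0.
- by move=> x; rewrite normrN; apply: le_trans (dfle _) _; rewrite normrN.
Qed.

(** The [j]-th derivative of [cos (y + theta)] at 0 is [cos (theta + j pi / 2)]. With the phase as a
    parameter, differentiation lowers [k] and adds [pi / 2] to [theta], and the sine is covered as
    well. *)
Definition cos_taylor k theta y : R :=
  \sum_(j < k) cos (theta + j%:R * (pi / 2)) * (y ^+ j / j`!%:R).

Lemma is_derive_cos_taylor k theta y :
  is_derive y 1 (cos_taylor k.+1 theta) (cos_taylor k (theta + pi / 2) y).
Proof.
have hd (j : 'I_k.+1) := is_deriveZ (cos (theta + j%:R * (pi / 2)) / j`!%:R)
  (is_deriveX j (is_derive_id y 1)).
have := is_derive_sum hd.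
rewrite (_ : \sum_(i < k.+1) _ = cos_taylor k.+1 theta); last first.
  apply/funext => t; rewrite /cos_taylor fct_sumE; apply: eq_bigr => j _.
  transitivity (cos (theta + j%:R * (pi / 2)) / j`!%:R * t ^+ j).
    by rewrite exprfctE.
  by rewrite mulrAC -mulrA.
move=> /is_derive_eq; apply; rewrite big_ord_recl.
set h0 := (X in X + _); have -> : h0 = 0 by rewrite /h0 /GRing.scale/= !mul0r mulr0.
rewrite add0r.
apply: eq_bigr => j _; rewrite /GRing.scale/= /bump/= add1n mulr1.
rewrite factS natrM invfM.
rewrite -natr1 mulrDl mul1r [_ + pi / 2]addrC addrA natr1.
rewrite -[LHS]mulrA; congr (_ * _).
by rewrite mulrACA mulVf ?pnatr_eq0// mul1r mulrC.
Qed.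

(** The remainder of order [k + 1] vanishes at 0, and its derivative is the remainder of order [k]
    at the phase [theta + pi / 2]. *)
Lemma cos_taylor_bound k theta y :
  `|cos (y + theta) - cos_taylor k theta y| <= `|y| ^+ k / k`!%:R.
Proof.
elim: k theta y => [|k IH] theta y.
  by rewrite /cos_taylor big_ord0 subr0 divr1 expr0 cos_max.
pose f y := cos (y + theta) - cos_taylor k.+1 theta y.
pose df y := cos (y + (theta + pi / 2)) - cos_taylor k (theta + pi / 2) y.
apply: (@norm_le_exp_div_fact_derive k f df) => [x||x]; last exact: IH.
- apply: is_deriveB; last exact: is_derive_cos_taylor.
  have d1 : is_derive x 1 (fun x => x + theta) 1.
    by rewrite -[X in is_derive _ _ _ X]addr0; exact: is_deriveD.
  have := @is_derive1_comp _ cos (fun x => x + theta) x _ _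
    (is_derive_cos (x + theta)) d1.
  move=> /is_derive_eq; apply; rewrite addrA cosD cos_pihalf sin_pihalf.
  by rewrite /GRing.scale/= !mulr1 mulr0 sub0r.
- rewrite /f /cos_taylor big_ord_recl/= big1 => [|j _]; last first.
    by rewrite expr0n/= mul0r mulr0.
  by rewrite mul0r !addr0 add0r divr1 mulr1 subrr.
Qed.

Lemma cos_taylor3 theta y :
  cos_taylor 3 theta y = cos theta - sin theta * y - cos theta * (y ^+ 2 / 2).
Proof.
rewrite /cos_taylor !big_ord_recr big_ord0 /= fact0 expr0 mul0r addr0 mul1r.
rewrite (_ : 2 * (pi / 2) = pi); last by rewrite mulrC divfK.
have -> : cos (theta + 1 * (pi / 2)) = - sin theta.
  by rewrite mul1r cosD cos_pihalf sin_pihalf mulr0 mulr1 sub0r.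
have -> : cos (theta + pi) = - cos theta.
  by rewrite cosD cospi sinpi mulr0 subr0 mulrN1.
by rewrite !divr1 expr1 add0r !mulNr.
Qed.

Lemma cos_sub1_sqr y : `|cos y - (1 - y ^+ 2 / 2)| <= `|y| ^+ 3.
Proof.
have := cos_taylor_bound 3 0 y; rewrite addr0 cos_taylor3 cos0 sin0.
rewrite mul0r subr0 mul1r => H; apply: le_trans H _.
by rewrite ler_piMr ?exprn_ge0// invf_le1 ?ltr0n ?ler1n.
Qed.

(** The sine is the cosine at phase [- pi / 2]. *)
Lemma sin_sub_id y : `|sin y - y| <= `|y| ^+ 3.
Proof.
have := cos_taylor_bound 3 (- (pi / 2)) y; rewrite cos_taylor3 cosB.
rewrite cosN sinN cos_pihalf sin_pihalf.
rewrite mulr0 mulr1 add0r mul0r subr0 sub0r mulN1r opprK => H.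
by apply: le_trans H _; rewrite ler_piMr ?exprn_ge0// invf_le1 ?ltr0n ?ler1n.
Qed.

Lemma cos_lipschitz x y : `|cos x - cos y| <= `|x - y|.
Proof.
have := cos_taylor_bound 1 y (x - y).
by rewrite subrK /cos_taylor big_ord1 mul0r addr0 expr0 divr1 mulr1 expr1 divr1.
Qed.

End taylor.
(** * Approximation by trigonometric polynomials *)

Section heine.
Context {R : realType} {n : nat}.

(** Only [x] is confined to the compact box and [y] is free, because the comparison of walk means
    asks for a pointwise bound at every end point. *)
Lemma continuous_unif_box (f : 'rV[R]_n -> R) (L e : R) : continuous f -> 0 < e ->
  exists2 d : R, 0 < d & forall x, `|x| <= L -> forall y, `|y - x| < d ->
    `|f y - f x| <= e.
Proof.
move=> fc e0.
have cK : compact [set x : 'rV[R]_n | `|x| <= L].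
  apply: bounded_closed_compact.
    by exists L; split; [exact: num_real|move=> M LM x /= /le_trans; apply; exact: ltW].
  rewrite (_ : [set x | _] = (fun x : 'rV[R]_n => `|x|) @^-1` [set r | r <= L])//.
  apply: closed_comp => [x _|]; [exact: norm_continuous|exact: closed_le].
pose P (d : R) (x : 'rV[R]_n) := forall y, `|y - x| < d -> `|f y - f x| <= e.
have : \forall d \near 0^'+, forall x, `|x| <= L -> P d x.
  move/compact_near_coveringP : cK; apply => x xL.
  have e20 : 0 < e / 2 by rewrite divr_gt0.
  have /cvgrPdist_le /(_ _ e20) := fc x.
  move=> /nbhs_ballP[r /= r0 xr].
  have r20 : 0 < r / 2 by rewrite divr_gt0.
  exists (ball x (r / 2), [set d | d < r / 2]).
    split=> /=; first exact: nbhsx_ballx.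
    exact: nbhs_right_lt.
  move=> [x' d] /= [xx' dr] y yx'.
  have xx'r : ball x r x' by apply: le_ball xx'; rewrite ler_pdivrMr// ler_peMr ?ler1n// ltW.
  have xyr : ball x r y.
    rewrite (splitr r); apply: ball_triangle xx' _.
    by rewrite -ball_normE/= distrC; apply: lt_trans dr.
  have := xr _ xx'r; have := xr _ xyr => /= h1 h2.
  rewrite (_ : f y - f x' = (f x - f x') - (f x - f y)); last by ring.
  by rewrite (splitr e); apply: le_trans (ler_normB _ _) _; exact: lerD.
move=> H; near (0 : R)^'+ => d; exists d => //.
by near: d.
Unshelve. all: by end_near. Qed.

End heine.

Section bernstein.
Context {R : realType} {n : nat}.
Variables (s : 'I_n -> R) (N : R).
Implicit Types (l : seq 'I_n) (f g : 'rV[R]_n -> R) (v : 'rV[R]_n).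

(* The mean of [f] after the random walk started at [v] that, for each [i] in
   [l], moves by [1 / N] in direction [i] with probability [s i]. *)
Fixpoint walk_mean l f v : R :=
  if l is i :: l' then
    s i * walk_mean l' f (v + N^-1 *: delta_mx ord0 i)
      + (1 - s i) * walk_mean l' f v
  else f v.

Lemma walk_meanD l f g v :
  walk_mean l (fun x => f x + g x) v = walk_mean l f v + walk_mean l g v.
Proof. by elim: l v => //= i l IH v; rewrite !IH; ring. Qed.

Lemma walk_meanZ l a f v :
  walk_mean l (fun x => a * f x) v = a * walk_mean l f v.
Proof. by elim: l v => //= i l IH v; rewrite !IH; ring. Qed.

Lemma walk_mean_cst l a v : walk_mean l (fun=> a) v = a.
Proof. by elim: l v => //= i l IH v; rewrite !IH; ring. Qed.

Lemma walk_mean_sum l (F : 'I_n -> 'rV[R]_n -> R) v :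
  walk_mean l (fun x => \sum_k F k x) v = \sum_k walk_mean l (F k) v.
Proof.
elim: l v => //= i l IH v; rewrite !IH !mulr_sumr -big_split/=.
by apply: eq_bigr.
Qed.

(** Coordinate [k] of the end point is a shifted and scaled binomial variable, so its mean square
    deviation from [a] is a squared bias plus a variance. *)
Lemma walk_mean_sqr l k a v :
  walk_mean l (fun x => (x ord0 k - a) ^+ 2) v =
  (v ord0 k + (count_mem k l)%:R / N * s k - a) ^+ 2
    + (count_mem k l)%:R / N ^+ 2 * (s k * (1 - s k)).
Proof.
elim: l v => [|i l IH] v /=; first by rewrite !mul0r !addr0.
rewrite !IH !mxE eqxx/=; have [->|ik] := eqVneq i k.
  by rewrite /= natrD mulr1 -exprVn; ring.
by rewrite /= add0n mulr0 addr0; ring.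
Qed.

Hypothesis s01 : forall i, 0 <= s i <= 1.

Lemma ler_walk_mean l f g v : (forall x, f x <= g x) ->
  walk_mean l f v <= walk_mean l g v.
Proof.
move=> fg; elim: l v => //= i l IH v; have /andP[s0 s1] := s01 i.
by rewrite lerD// ler_wpM2l// subr_ge0.
Qed.

Lemma norm_walk_mean_le l f M v : (forall x, `|f x| <= M) ->
  `|walk_mean l f v| <= M.
Proof.
move=> fM; rewrite ler_norml -{1}(walk_mean_cst l (- M) v) -{2}(walk_mean_cst l M v).
by apply/andP; split; apply: ler_walk_mean => x; have := fM x; rewrite ler_norml => /andP[].
Qed.

End bernstein.

Section bernstein_approx.
Context {R : realType} {n : nat}.

Lemma norm_rV_le (v : 'rV[R]_n) (a : R) : 0 <= a ->
  (forall i, `|v ord0 i| <= a) -> `|v| <= a.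
Proof.
move=> a0 va; rewrite /Num.norm/= mx_normrE; apply: bigmax_le => // -[i j] _ /=.
by rewrite (ord1 i).
Qed.

Lemma norm_rV_lt (v : 'rV[R]_n) (a : R) : 0 < a ->
  (forall i, `|v ord0 i| < a) -> `|v| < a.
Proof.
move=> a0 va; rewrite /Num.norm/= mx_normrE; apply: bigmax_lt => // -[i j] _ /=.
by rewrite (ord1 i).
Qed.

Lemma coord_le_norm (v : 'rV[R]_n) i : `|v ord0 i| <= `|v|.
Proof.
by rewrite [leRHS]/Num.norm/= mx_normrE; apply: (le_bigmax _ _ (ord0, i)).
Qed.

(** Bernstein's proof of the Weierstrass theorem: the walk from 0 with [N] steps in each direction
    ends near [s], with total variance at most [n / N], and Chebyshev's inequality controls the
    large deviations. *)
Lemma bernstein_approx (f : 'rV[R]_n -> R) (M e : R) : continuous f ->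
  (forall x, `|f x| <= M) -> 0 < e ->
  exists l (N : R), forall s : 'rV[R]_n, (forall i, 0 <= s ord0 i <= 1) ->
    `|walk_mean (s ord0) N l f 0 - f s| <= e.
Proof.
move=> fc fM e0.
have M0 : 0 <= M by apply: le_trans (fM 0).
have e20 : 0 < e / 2 by rewrite divr_gt0.
have [d d0 H] := continuous_unif_box 1 fc e20.
(* Outside the [d]-ball some coordinate deviates by at least [d], so there the quadratic term with
   this [C] is at least the trivial bound [2 * M]. *)
pose C := 2 * M / d ^+ 2.
have C0 : 0 <= C by rewrite divr_ge0// ?mulr_ge0// ?exprn_ge0// ltW.
(* Chosen so that [C * n / N <= e / 2]. *)
pose N := (Num.truncn (C * n%:R / (e / 2))).+1.
pose l : seq 'I_n := flatten (nseq N (enum 'I_n)).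
have lN k : count_mem k l = N.
  rewrite /l count_flatten map_nseq sumn_nseq count_uniq_mem ?enum_uniq//.
  by rewrite mem_enum mul1n.
have N0 : 0 < N%:R :> R by rewrite ltr0n.
exists l, N%:R => s s01.
have sle : `|s| <= 1.
  apply: norm_rV_le => // i; have /andP[s0 s1] := s01 i.
  by rewrite ger0_norm.
have fd x : `|f x - f s| <= e / 2 + C * \sum_k (x ord0 k - s ord0 k) ^+ 2.
  have S0 : 0 <= \sum_k (x ord0 k - s ord0 k) ^+ 2.
    by apply: sumr_ge0 => k _; exact: sqr_ge0.
  have [xd|dx] := ltP `|x - s| d.
    by apply: le_trans (H _ sle _ xd) _; rewrite lerDl mulr_ge0.
  have [k dk] : exists k, d <= `|x ord0 k - s ord0 k|.
    apply/not_existsP => nk; move: dx; apply/negP; rewrite -ltNge.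
    apply: norm_rV_lt => // k; rewrite !mxE ltNge; apply/negP => dk.
    by apply: (nk k).
  have : `|f x - f s| <= 2 * M.
    by rewrite mulr2n mulrDl mul1r; apply: le_trans (ler_normB _ _) _; exact: lerD.
  move=> /le_trans; apply; apply: ler_wpDl; first exact: ltW.
  rewrite /C -mulrA ler_peMr ?mulr_ge0// -ler_pdivrMl ?invr_gt0 ?exprn_gt0// invrK mulr1.
  rewrite (bigD1 k)//= ler_wpDr ?sumr_ge0// => [? _|]; first exact: sqr_ge0.
  by rewrite -(real_normK (num_real (_ - _))) ler_sqr ?nnegrE// ltW.
have -> : walk_mean (s ord0) N%:R l f 0 - f s =
    walk_mean (s ord0) N%:R l (fun x => f x + - f s) 0.
  by rewrite walk_meanD walk_mean_cst.
apply: (@le_trans _ _ (walk_mean (s ord0) N%:R l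
    (fun x => e / 2 + C * \sum_k (x ord0 k - s ord0 k) ^+ 2) 0)).
  rewrite ler_norml -mulN1r -walk_meanZ; apply/andP; split; apply: ler_walk_mean => // x;
    by have := fd x; rewrite ler_norml => /andP[]; rewrite ?mulN1r.
rewrite walk_meanD walk_mean_cst walk_meanZ walk_mean_sum [leRHS](splitr e) lerD2l.
apply: (@le_trans _ _ (C * (n%:R / N%:R))).
  rewrite ler_wpM2l//.
  rewrite (_ : n%:R / N%:R = \sum_(k < n) N%:R^-1); last first.
    by rewrite sumr_const card_ord mulr_natl.
  apply: ler_sum => k _; rewrite walk_mean_sqr lN mxE add0r divff ?gt_eqF//.
  rewrite mul1r subrr expr0n add0r expr2 invfM [_ * (_ * _^-1)]mulrA divff ?gt_eqF// mul1r.
  have /andP[s0 s1] := s01 k.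
  rewrite ler_piMr ?invr_ge0 ?(ltW N0)//.
  by rewrite mulr_ile1 ?subr_ge0// lerBlDr lerDl.
rewrite mulrA ler_pdivrMr// [e / 2 * _]mulrC -ler_pdivrMr//.
exact/ltW/truncnS_gt.
Qed.

End bernstein_approx.

(** * Scalar products and trigonometric polynomials *)

Section dot.
Context {R : realType} {n : nat}.
Implicit Types t x y : 'rV[R]_n.

Definition dot t x : R := \sum_i t ord0 i * x ord0 i.

Lemma dotDl t u x : dot (t + u) x = dot t x + dot u x.
Proof. by rewrite /dot -big_split; apply: eq_bigr => i _; rewrite mxE mulrDl. Qed.

Lemma dotNl t x : dot (- t) x = - dot t x.
Proof. by rewrite /dot -sumrN; apply: eq_bigr => i _; rewrite mxE mulNr. Qed.

Lemma dot0l x : dot 0 x = 0.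
Proof. by rewrite /dot big1// => i _; rewrite mxE mul0r. Qed.

Lemma dotZl a t x : dot (a *: t) x = a * dot t x.
Proof. by rewrite /dot mulr_sumr; apply: eq_bigr => i _; rewrite mxE mulrA. Qed.

Lemma dot_delta i x : dot (delta_mx ord0 i) x = x ord0 i.
Proof.
rewrite /dot (bigD1 i)//= mxE !eqxx mul1r big1 ?addr0// => j ji.
by rewrite mxE (negbTE ji) andbF mul0r.
Qed.

Lemma continuous_dot t : continuous (dot t).
Proof.
rewrite /dot; elim: (index_enum _) => [|i s IH] x.
  rewrite (_ : (fun=> _) = fun=> 0); first exact: cst_continuous.
  by apply/funext => y; rewrite big_nil.
rewrite (_ : (fun=> _) = (fun y => t ord0 i * y ord0 i)
    + (fun y => \sum_(i <- s) t ord0 i * y ord0 i)); last first.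
  by apply/funext => y; rewrite big_cons.
apply: continuousD; last exact: IH.
by apply: continuousM; [exact: cst_continuous|exact: coord_continuous].
Qed.

Lemma continuous_rV (T : topologicalType) (f : T -> 'rV[R]_n) :
  (forall i, continuous (fun x : T => f x ord0 i)) -> continuous f.
Proof.
move=> fc x; apply/cvgrPdist_lt => e e0.
have : \forall y \near x, forall i, `|f x ord0 i - f y ord0 i| < e.
  apply: filter_forall => i.
  by have /cvgrPdist_lt /(_ _ e0) := fc i x.
apply: filterS => y H; apply: norm_rV_lt => // i.
by rewrite !mxE.
Qed.

End dot.

Section trigpoly.
Context {R : realType} {n : nat}.

(** Only single cosines, sums and multiples are primitive, so that convergence has to be checked on
    single cosines alone; constants, sines and products are derived, products by the product-to-sum
    formula. *)
Inductive trigpoly : ('rV[R]_n -> R) -> Prop :=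
| trigpoly_cos t theta : trigpoly (fun x => cos (dot t x + theta))
| trigpolyD f g : trigpoly f -> trigpoly g -> trigpoly (fun x => f x + g x)
| trigpolyZ a f : trigpoly f -> trigpoly (fun x => a * f x).

Lemma eq_trigpoly f g : f =1 g -> trigpoly f -> trigpoly g.
Proof. by move=> /funext ->. Qed.

Lemma trigpoly_cst a : trigpoly (fun=> a).
Proof.
apply: (eq_trigpoly _ (trigpolyZ a (trigpoly_cos 0 0))) => x.
by rewrite dot0l addr0 cos0 mulr1.
Qed.

Lemma trigpolyM f g : trigpoly f -> trigpoly g -> trigpoly (fun x => f x * g x).
Proof.
elim=> [t theta|f1 f2 _ IH1 _ IH2|a f1 _ IH1] tg; last 2 first.
- apply: (eq_trigpoly _ (trigpolyD (IH1 tg) (IH2 tg))) => x; by rewrite mulrDl.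
- apply: (eq_trigpoly _ (trigpolyZ a (IH1 tg))) => x; by rewrite mulrA.
elim: tg => [u eta|g1 g2 _ IH1 _ IH2|a g1 _ IH1].
- apply: (eq_trigpoly _ (trigpolyZ 2^-1 (trigpolyD
    (trigpoly_cos (t + u) (theta + eta)) (trigpoly_cos (t - u) (theta - eta))))) => x.
  have -> : dot (t + u) x + (theta + eta) = (dot t x + theta) + (dot u x + eta).
    by rewrite dotDl; ring.
  have -> : dot (t - u) x + (theta - eta) = (dot t x + theta) - (dot u x + eta).
    by rewrite dotDl dotNl; ring.
  by rewrite cosD cosB; field.
- apply: (eq_trigpoly _ (trigpolyD IH1 IH2)) => x; by rewrite mulrDr.
- apply: (eq_trigpoly _ (trigpolyZ a IH1)) => x; by rewrite mulrCA.
Qed.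

Lemma trigpoly_sin t theta : trigpoly (fun x => sin (dot t x + theta)).
Proof.
apply: (eq_trigpoly _ (trigpoly_cos t (theta - pi / 2))) => x.
by rewrite addrA cosB cos_pihalf sin_pihalf mulr0 add0r mulr1.
Qed.

Lemma trigpoly_walk_mean (s : 'I_n -> 'rV[R]_n -> R) N l f v :
  (forall i, trigpoly (s i)) -> trigpoly (fun x => walk_mean (s^~ x) N l f v).
Proof.
move=> ts; elim: l v => [|i l IH] v /=; first exact: trigpoly_cst.
apply: trigpolyD; apply: trigpolyM => //.
apply: trigpolyD; first exact: trigpoly_cst.
apply: (eq_trigpoly _ (trigpolyZ (-1) (ts i))) => x; by rewrite mulN1r.
Qed.

Lemma continuous_trigpoly f : trigpoly f -> continuous f.
Proof.
elim=> [t theta|f1 f2 _ IH1 _ IH2|a f1 _ IH1] x.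
- apply: (@continuous_comp _ _ _ (fun x => dot t x + theta) cos).
    by apply: continuousD; [exact: continuous_dot|exact: cst_continuous].
  exact: continuous_cos.
- by apply: continuousD; [exact: IH1|exact: IH2].
- by apply: continuousM; [exact: cst_continuous|exact: IH1].
Qed.

Lemma bounded_trigpoly f : trigpoly f -> exists M, forall x, `|f x| <= M.
Proof.
elim=> [t theta|f1 f2 _ [M1 IH1] _ [M2 IH2]|a f1 _ [M1 IH1]].
- by exists 1 => x; exact: cos_max.
- by exists (M1 + M2) => x; rewrite (le_trans (ler_normD _ _))// lerD.
- by exists (`|a| * M1) => x; rewrite normrM ler_wpM2l.
Qed.

(** A continuous function on the whole line that inverts [y |-> (1 + sin y) / 2] on [[-1, 1]].
    Clamping at [sin 1] keeps the argument of [asin] strictly between -1 and 1. *)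
Definition clamped_asin (u : R) : R :=
  asin (Num.max (- sin 1) (Num.min (2 * u - 1) (sin 1))).

Lemma one_lt_pihalf : 1 < pi / 2 :> R.
Proof.
rewrite ltr_pdivlMr// mul1r lt_neqAle pi_ge2 andbT; apply/eqP => p2.
by have := cos1_gt0 R; rewrite (_ : 1 = pi / 2) ?cos_pihalf ?ltxx// -p2 divff.
Qed.

Lemma sin1_itv : 0 < sin (1 : R) < 1.
Proof.
have p1 := one_lt_pihalf; rewrite sin_gt0_pihalf ?ltr01//=.
by rewrite -[ltRHS]sin_pihalf ltr_sin// in_itv/=; apply/andP; split; lra.
Qed.

Lemma continuous_clamped_asin : continuous clamped_asin.
Proof.
have /andP[s0 s1] := sin1_itv.
move=> u; apply: (@continuous_comp R R R
  (fun u => Num.max (- sin 1) (Num.min (2 * u - 1) (sin 1))) asin).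
  apply: continuous_max; first exact: cst_continuous.
  apply: continuous_min; last exact: cst_continuous.
  apply: continuousB; last exact: cst_continuous.
  by apply: continuousM; [exact: cst_continuous|exact: cvg_id].
apply: continuous_asin; rewrite lt_max gt_max ltrN2 s1/=.
by rewrite gt_min s1 orbT andbT; lra.
Qed.

Lemma clamped_asinK y : `|y| <= 1 -> clamped_asin ((1 + sin y) / 2) = y.
Proof.
have p1 := one_lt_pihalf.
rewrite ler_norml => /andP[y0 y1]; rewrite /clamped_asin.
rewrite (_ : 2 * _ - 1 = sin y); last by field.
have yp : y \in `[- (pi / 2), pi / 2]%R by rewrite in_itv/=; apply/andP; split; lra.
have op : 1 \in `[- (pi / 2), pi / 2 : R]%R.
  by rewrite in_itv/=; apply/andP; split; lra.
have nop : - 1 \in `[- (pi / 2), pi / 2 : R]%R.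
  by rewrite in_itv/=; apply/andP; split; lra.
rewrite min_l ?max_r ?sinK// leNgt; first by rewrite -sinN ltr_sin// -leNgt.
by rewrite ltr_sin// -leNgt.
Qed.

(** In the variables [s_i = (1 + sin (x_i / L)) / 2] of the unit cube, a Bernstein polynomial
    becomes a trigonometric polynomial. Being a mean of values of [f], it obeys the bound [M] on the
    whole space, so its values outside the box are harmless under tightness. *)
Lemma trigpoly_approx (f : 'rV[R]_n -> R) (M L e : R) : continuous f ->
  (forall x, `|f x| <= M) -> 0 < L -> 0 < e ->
  exists q, [/\ trigpoly q, forall x, `|q x| <= M &
    forall x, `|x| <= L -> `|q x - f x| <= e].
Proof.
move=> fc fM L0 e0.
(* [G] undoes the substitution [s] on the box of radius [L], so approximating [f \o G] at [s x]
   approximates [f] at [x]. *)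
pose G (s : 'rV[R]_n) : 'rV[R]_n := \row_i (L * clamped_asin (s ord0 i)).
pose s (x : 'rV[R]_n) : 'rV[R]_n := \row_i ((1 + sin (x ord0 i / L)) / 2).
have Gc : continuous G.
  have Gi i : continuous (fun x : 'rV[R]_n => L * clamped_asin (x ord0 i)).
    move=> x; apply: (@continuous_comp _ _ _ (fun x : 'rV[R]_n => x ord0 i)
      (fun u : R => L * clamped_asin u)); first exact: coord_continuous.
    apply: continuousM; first exact: cst_continuous.
    exact: continuous_clamped_asin.
  apply: continuous_rV => i; rewrite (_ : (fun x => _) = fun x : 'rV[R]_n =>
    L * clamped_asin (x ord0 i)); first exact: Gi.
  by apply/funext => x; rewrite mxE.
have s01 x i : 0 <= s x ord0 i <= 1.
  rewrite mxE; have := sin_geN1 (x ord0 i / L); have := sin_le1 (x ord0 i / L).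
  by move=> ? ?; apply/andP; split; lra.
have [|l [N H]] := @bernstein_approx R n (f \o G) M e _ (fun x => fM (G x)) e0.
  by move=> x; apply: continuous_comp; [exact: Gc|exact: fc].
exists (fun x => walk_mean (s x ord0) N l (f \o G) 0); split.
- apply: (@trigpoly_walk_mean (fun i x => s x ord0 i)) => i.
  apply: (eq_trigpoly _ (trigpolyZ 2^-1 (trigpolyD (trigpoly_cst 1)
    (trigpoly_sin (L^-1 *: delta_mx ord0 i) 0)))) => x.
  by rewrite addr0 dotZl dot_delta mxE mulrC [_ * L^-1]mulrC.
- by move=> x; apply: norm_walk_mean_le => // y; exact: fM.
- move=> x xL; rewrite [X in _ - f X](_ : x = G (s x)); first exact: H.
  apply/rowP => i; rewrite !mxE clamped_asinK; first by rewrite mulrC divfK ?gt_eqF.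
  rewrite normrM normfV (gtr0_norm L0) ler_pdivrMr// mul1r.
  exact: le_trans (coord_le_norm x i) xL.
Qed.

End trigpoly.
(** * Convergence of mean functionals *)

Section mean_functional.
Context {R : realType} {n : nat}.
Implicit Types (f g : 'rV[R]_n -> R) (E : ('rV[R]_n -> R) -> R).

Definition bounded_continuous f := continuous f /\ exists M : R, forall x, `|f x| <= M.

(** A normalized positive linear functional: the common feature of finite averages and of integrals,
    so that both can enter one convergence criterion. *)
Definition mean_functional E := [/\
  forall f g, bounded_continuous f -> bounded_continuous g ->
    E (fun x => f x + g x) = E f + E g,
  forall a f, bounded_continuous f -> E (fun x => a * f x) = a * E f,
  forall f g, bounded_continuous f -> bounded_continuous g ->
    (forall x, f x <= g x) -> E f <= E g &
  E (fun=> 1) = 1].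

(** A continuous substitute for the indicator of the complement of a ball, which allows tightness to
    be stated for functionals of bounded continuous functions. *)
Definition truncated_norm (L : R) (x : 'rV[R]_n) : R := Num.min 1 (`|x| / L).

Definition tight (I : Type) (F : set_system I) (E : I -> ('rV[R]_n -> R) -> R) :=
  forall e, 0 < e -> exists2 L, 0 < L & \forall t \near F, E t (truncated_norm L) <= e.

Lemma bounded_continuous_truncated_norm (L : R) : 0 < L ->
  bounded_continuous (truncated_norm L).
Proof.
move=> L0; split.
  move=> x; apply: (@continuous_min R 'rV[R]_n (fun=> 1) (fun x => `|x| / L)).
    exact: cst_continuous.
  by apply: continuous_mulf => y; [exact: norm_continuous|exact: cst_continuous].
exists 1 => x; rewrite ger0_norm; first by rewrite ge_min lexx.
by rewrite le_min ler01 divr_ge0// ltW.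
Qed.

Lemma truncated_norm_anti (L L' : R) x : 0 < L -> L <= L' ->
  truncated_norm L' x <= truncated_norm L x.
Proof.
move=> L0 LL'; have L'0 := lt_le_trans L0 LL'.
rewrite /truncated_norm le_min ge_min lexx/= ge_min orbC ler_wpM2l//.
by rewrite lef_pV2.
Qed.

Lemma bounded_continuous_cst a : bounded_continuous (fun=> a).
Proof. by split; [exact: cst_continuous|exists `|a|]. Qed.

Lemma bounded_continuous_trigpoly q : trigpoly q -> bounded_continuous q.
Proof. by split; [exact: continuous_trigpoly|exact: bounded_trigpoly]. Qed.

Lemma bounded_continuousD f g : bounded_continuous f -> bounded_continuous g ->
  bounded_continuous (fun x => f x + g x).
Proof.
move=> [fc [M fM]] [gc [M' gM']]; split.
  exact: continuous_addf.
by exists (M + M') => x; rewrite (le_trans (ler_normD _ _))// lerD.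
Qed.

Lemma bounded_continuousZ a f : bounded_continuous f ->
  bounded_continuous (fun x => a * f x).
Proof.
move=> [fc [M fM]]; split.
  exact: continuous_scalef.
by exists (`|a| * M) => x; rewrite normrM ler_wpM2l.
Qed.

Lemma mean_dist_le E f g (a b L : R) : mean_functional E ->
  bounded_continuous f -> bounded_continuous g -> 0 < L ->
  (forall x, `|f x - g x| <= a + b * truncated_norm L x) ->
  `|E f - E g| <= a + b * E (truncated_norm L).
Proof.
move=> [ED EZ Ele E1] bf bg L0 fg.
have bt := bounded_continuous_truncated_norm L0.
have bab := bounded_continuousD (bounded_continuous_cst a) (bounded_continuousZ b bt).
have ab : E (fun x => a + b * truncated_norm L x) = a + b * E (truncated_norm L).
  have := ED _ _ (bounded_continuous_cst a) (bounded_continuousZ b bt).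
  move=> ->; rewrite EZ//; congr (_ + _).
  transitivity (E (fun=> a * 1)); first by rewrite mulr1.
  by rewrite (EZ a (fun=> 1)) ?E1 ?mulr1//; exact: bounded_continuous_cst.
have le u v : bounded_continuous u -> bounded_continuous v ->
    (forall x, u x - v x <= a + b * truncated_norm L x) ->
    E u - E v <= a + b * E (truncated_norm L).
  move=> bu bv uv; rewrite lerBlDl -ab -ED//; apply: Ele => //.
    exact: bounded_continuousD.
  by move=> x; have := uv x; rewrite lerBlDl.
rewrite ler_norml lerNl opprB; apply/andP; split; apply: le => // x.
  by have := fg x; rewrite ler_norml lerNl opprB => /andP[].
by have := fg x; rewrite ler_norml => /andP[].
Qed.

(** A trigonometric polynomial close to [f] on a large box and bounded by the same [M] differs from
    [f] everywhere by at most [d + 2 M] times the truncated norm; tightness makes this small under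
    [E t] and [E0] alike. *)
Theorem cvg_mean_trig (I : Type) (F : set_system I) {FF : Filter F}
    (E : I -> ('rV[R]_n -> R) -> R) (E0 : ('rV[R]_n -> R) -> R) :
  (\forall t \near F, mean_functional (E t)) -> mean_functional E0 ->
  (forall u theta, E t (fun x => cos (dot u x + theta)) @[t --> F] -->
    E0 (fun x => cos (dot u x + theta))) ->
  tight F E -> tight \oo (fun=> E0) ->
  forall f, bounded_continuous f -> E t f @[t --> F] --> E0 f.
Proof.
move=> EM E0M Ecos Et E0t f [fc [M fM]].
have bf : bounded_continuous f by split=> //; exists M.
have M0 : 0 <= M by apply: le_trans (fM 0).
have trig q : trigpoly q -> E t q @[t --> F] --> E0 q.
  elim=> [t theta|f1 f2 t1 IH1 t2 IH2|a f1 t1 IH1]; first exact: Ecos.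
  - have [b1 b2] := (bounded_continuous_trigpoly t1, bounded_continuous_trigpoly t2).
    have [E0D _ _ _] := E0M; rewrite E0D//.
    apply: cvg_trans (cvgD IH1 IH2); apply: near_eq_cvg.
    by apply: filterS EM => t [-> //].
  - have b1 := bounded_continuous_trigpoly t1.
    have [_ E0Z _ _] := E0M; rewrite E0Z//.
    apply: cvg_trans (cvgM (cvg_cst a) IH1); apply: near_eq_cvg.
    by apply: filterS EM => t [_ -> //].
apply/cvgrPdist_le => e e0.
(* The three pieces of the final triangle inequality add up to [3 d + 4 M d <= 4 (1 + M) d = e]. *)
pose d := e / (4 * (1 + M)).
have M10 : 0 < 4 * (1 + M) by rewrite mulr_gt0// ltr_wpDr.
have d0 : 0 < d by rewrite divr_gt0.
have [L1 L10 tL1] := Et _ d0.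
have [L2 L20 [N _ tL2]] := E0t _ d0.
(* The truncated norm decreases with the radius, so the larger radius serves both families. *)
pose L := Num.max L1 L2.
have L0 : 0 < L by rewrite lt_max L10.
have [q [tq qM fq]] := trigpoly_approx fc fM L0 d0.
have bq := bounded_continuous_trigpoly tq.
have qf x : `|q x - f x| <= d + 2 * M * truncated_norm L x.
  have [xL|Lx] := leP `|x| L.
    apply: le_trans (fq _ xL) _; rewrite lerDl mulr_ge0// ?mulr_ge0//.
    by rewrite le_min ler01 divr_ge0// ltW.
  rewrite /truncated_norm min_l ?ler_pdivlMr ?mul1r ?(ltW Lx)// mulr1.
  apply: le_trans (ler_normB _ _) _; apply: le_trans (lerD (qM x) (fM x)) _.
  by rewrite mulr2n mulrDl mul1r lerDr ltW.
have small G (L' : R) : mean_functional G -> 0 < L' -> L' <= L ->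
    G (truncated_norm L') <= d -> `|G q - G f| <= d + 2 * M * d.
  move=> GM L'0 L'L GL'; apply: le_trans (mean_dist_le GM bq bf L0 qf) _.
  rewrite lerD2l ler_wpM2l ?mulr_ge0//; apply: le_trans GL'.
  case: GM => _ _ Gle _; apply: Gle => [||x].
  - exact: bounded_continuous_truncated_norm.
  - exact: bounded_continuous_truncated_norm.
  - exact: truncated_norm_anti.
have s0 : `|E0 q - E0 f| <= d + 2 * M * d.
  by apply: (small _ L2) => //; [rewrite le_max lexx orbT|exact: (tL2 N (leqnn N))].
have /cvgrPdist_le /(_ _ d0) := trig _ tq.
apply: filterS3 EM tL1 => t tM tL1 tq0.
have st : `|E t q - E t f| <= d + 2 * M * d.
  by apply: (small _ L1) => //; rewrite le_max lexx.
rewrite (_ : E0 f - E t f =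
  - (E0 q - E0 f) + (E0 q - E t q) + (E t q - E t f)); last by ring.
apply: le_trans (ler_normD _ _) _; apply: le_trans (lerD (ler_normD _ _) (lexx _)) _.
rewrite normrN; apply: le_trans (lerD (lerD s0 tq0) st) _.
have -> : e = d * (4 * (1 + M)) by rewrite /d divfK// gt_eqF.
nra.
Qed.

End mean_functional.
(** * Gaussian vectors *)

Section normal_moments.
Context {R : realType}.
Variables (s : R) (s0 : 0 < s).
Local Notation mu := (@lebesgue_measure R).
Local Notation N := (normal_prob 0 s).
Local Notation phi := (normal_pdf 0 s).

(** The measure is tied to its explicit density by the almost everywhere uniqueness of the
    Radon-Nikodym derivative. *)
Lemma ge0_integral_normal_prob (f : measurableTypeR R -> \bar R) : (forall x, (0 <= f x)%E) ->
  measurable_fun setT f ->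
  (\int[N]_x f x = \int[mu]_x (f x * (phi x)%:E))%E.
Proof.
move=> f0 mf.
have dom : N `<< mu by exact: normal_prob_dominates.
rewrite -(@Radon_Nikodym_SigmaFinite.change_of_variables _ _ _ N mu dom)//.
have mrn : measurable_fun setT (Radon_Nikodym_SigmaFinite.f N mu).
  by apply: measurable_int; exact: Radon_Nikodym_SigmaFinite.f_integrable.
have mphi : measurable_fun setT (EFin \o phi).
  by apply/measurable_EFinP; exact: measurable_normal_pdf.
apply: ae_eq_integral => //.
- exact: emeasurable_funM.
- exact: emeasurable_funM.
- apply: ae_eqe_mul2l => /=; apply: integral_ae_eq => //.
  + exact: Radon_Nikodym_SigmaFinite.f_integrable.
  + by move=> E _ mE; rewrite -Radon_Nikodym_SigmaFinite.f_integral.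
Qed.

Lemma integrable_mul_normal_pdf (f : R -> R) : N.-integrable setT (EFin \o f) ->
  mu.-integrable setT (fun x => (f x * phi x)%:E).
Proof.
move=> /integrableP[mf fi]; have mphi := @measurable_normal_pdf R 0 s.
apply/integrableP; split.
  by apply/measurable_EFinP; apply: measurable_funM => //; exact/measurable_EFinP.
move: fi; rewrite ge0_integral_normal_prob//; last exact: measurableT_comp.
apply: le_lt_trans; rewrite le_eqVlt; apply/orP; left; apply/eqP.
apply: eq_integral => x _.
by rewrite /= normrM EFinM (ger0_norm (normal_pdf_ge0 _ _ _)).
Qed.

Lemma integrable_normal_prob (f : R -> R) : measurable_fun setT f ->
  mu.-integrable setT (fun x => (f x * phi x)%:E) ->
  N.-integrable setT (EFin \o f).
Proof.
move=> mf /integrableP[_ fi]; apply/integrableP; split.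
  exact/measurable_EFinP.
rewrite ge0_integral_normal_prob//; last first.
  by apply: measurableT_comp => //; exact/measurable_EFinP.
apply: le_lt_trans fi; rewrite le_eqVlt; apply/orP; left; apply/eqP.
apply: eq_integral => x _.
by rewrite /= normrM EFinM (ger0_norm (normal_pdf_ge0 _ _ _)).
Qed.

Lemma integral_normal_prob (f : R -> R) : N.-integrable setT (EFin \o f) ->
  (\int[N]_x (f x)%:E = \int[mu]_x (f x * phi x)%:E)%E.
Proof.
move=> fi; have mf := measurable_int _ fi.
rewrite integralE ge0_integral_normal_prob//; last exact: measurable_funepos.
rewrite ge0_integral_normal_prob//; last exact: measurable_funeneg.
rewrite [RHS]integralE; congr (_ - _)%E; apply: eq_integral => x _.
  by rewrite !funeposE -!EFin_max -EFinM maxr_pMl ?mul0r// normal_pdf_ge0.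
by rewrite !funenegE -!EFinN -!EFin_max -EFinM maxr_pMl ?mul0r ?mulNr// normal_pdf_ge0.
Qed.

Lemma normal_pdf0E x : phi x = normal_peak s * expR (- (x ^+ 2 / (2 * s ^+ 2))).
Proof.
by rewrite normal_pdfE ?gt_eqF// /normal_fun subr0 mulNr -mulr_natl.
Qed.

Lemma is_derive_normal_pdf (x : R) : is_derive x 1 phi (- (x / s ^+ 2) * phi x).
Proof.
have d1 : is_derive x 1 (fun x => (- (2 * s ^+ 2)^-1) *: (id ^+ 2 : R -> R) x)
    (- (x / s ^+ 2)).
  have := is_deriveZ (- (2 * s ^+ 2)^-1) (is_deriveX 2 (is_derive_id x 1)).
  move=> /is_derive_eq; apply.
  by rewrite /GRing.scale/= mulr1 expr1; field; rewrite gt_eqF.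
have := is_deriveZ (normal_peak s) (is_derive1_comp (is_derive_expR _) d1).
rewrite (_ : _ \*: _ = phi); last first.
  apply/funext => y; rewrite normal_pdf0E.
  by rewrite /GRing.scale/= exprfctE mulNr mulrC.
move=> /is_derive_eq; apply; rewrite normal_pdf0E.
rewrite [LHS]/GRing.scale/= exprfctE mulrA mulrC; congr (_ * (_ * expR _)).
by rewrite /GRing.scale/= mulNr mulrC.
Qed.

(* [u * exp (- 3 u / (8 s^2))] is bounded by [8 s^2 / 3]. *)
Lemma sqr_normal_pdf_le x : x ^+ 2 * phi x <=
  normal_peak s * (8 * s ^+ 2) / normal_peak (2 * s) * normal_pdf 0 (2 * s) x.
Proof.
have s20 : 0 < 2 * s by rewrite mulr_gt0.
have pk := normal_peak_gt0 (lt0r_neq0 s0).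
have pk2 := normal_peak_gt0 (lt0r_neq0 s20).
rewrite normal_pdf0E normal_pdfE ?gt_eqF// /normal_fun subr0.
rewrite [leRHS]mulrA divfK ?gt_eqF// mulrCA -mulrA ler_pM2l//.
have ss : 0 < s ^+ 2 by rewrite exprn_gt0.
have -> : - (x ^+ 2 / (2 * s ^+ 2)) =
    - (3 * (x ^+ 2 / (8 * s ^+ 2))) + - x ^+ 2 / ((2 * s) ^+ 2 *+ 2).
  by rewrite -mulr_natl; field; rewrite gt_eqF.
rewrite expRD [leLHS]mulrA; apply: ler_wpM2r; first exact: expR_ge0.
set u := x ^+ 2 / _; have u0 : 0 <= u.
  by rewrite divr_ge0 ?sqr_ge0// mulr_ge0// ltW.
rewrite expRN ler_pdivrMr ?expR_gt0//.
have -> : x ^+ 2 = 8 * s ^+ 2 * u by rewrite /u; field; rewrite gt_eqF.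
rewrite ler_pM2l ?mulr_gt0//.
have := expR_ge1Dx (3 * u); lra.
Qed.

Lemma integrable_sqr_normal_pdf : mu.-integrable setT (fun x => (x ^+ 2 * phi x)%:E).
Proof.
have s20 : 0 < 2 * s by rewrite mulr_gt0.
have i2 := integrable_normal_pdf 0 (2 * s).
have := integrableZl measurableT (normal_peak s * (8 * s ^+ 2) / normal_peak (2 * s)) i2.
apply: le_integrable => //.
  apply/measurable_EFinP; apply: measurable_funM; last exact: measurable_normal_pdf.
  exact: exprn_measurable.
move=> x _ /=; rewrite lee_fin ger0_norm; last first.
  by rewrite mulr_ge0 ?sqr_ge0 ?normal_pdf_ge0.
by apply: le_trans (sqr_normal_pdf_le x) _; exact: ler_norm.
Qed.

Lemma integrable_normal_sqr_bound (f : R -> R) (C : R) : measurable_fun setT f ->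
  (forall x, `|f x| <= C * (1 + x ^+ 2)) -> N.-integrable setT (EFin \o f).
Proof.
move=> mf fC; apply: integrable_normal_prob => //.
have i1 := integrable_normal_pdf 0 s.
have := integrableZl measurableT C
  (integrableD measurableT i1 integrable_sqr_normal_pdf).
apply: le_integrable => //.
  apply/measurable_EFinP; apply: measurable_funM => //; exact: measurable_normal_pdf.
move=> x _ /=; rewrite lee_fin normrM (ger0_norm (normal_pdf_ge0 _ _ _)).
apply: le_trans (ler_norm _).
by rewrite -[X in X + _]mul1r -mulrDl mulrA ler_wpM2r// normal_pdf_ge0.
Qed.

(** The boundary terms of the integration by parts: [k * phi k] is at most a constant over [k],
    because [x ^+ 2 * phi x] is bounded. *)
Lemma cvg_lin_normal_pdf (f : R -> R) (C : R) :
  (forall x, `|f x| <= C * (1 + `|x|)) ->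
  f k%:R * phi k%:R - f (- k%:R) * phi (- k%:R) @[k --> \oo] --> (0 : R).
Proof.
move=> fC.
have C0 : 0 <= C by have := fC 0; rewrite normr0 addr0 mulr1; exact: le_trans.
pose c := normal_peak s * (8 * s ^+ 2) / normal_peak (2 * s) * normal_peak (2 * s).
have kphi (k : nat) : k.+1%:R * phi k.+1%:R <= c / k.+1%:R.
  rewrite ler_pdivlMr ?ltr0n// mulrAC -expr2.
  apply: le_trans (sqr_normal_pdf_le _) _.
  rewrite ler_wpM2l ?normal_pdf_ub ?gt_eqF ?mulr_gt0//.
  by rewrite divr_ge0 ?normal_peak_ge0// !mulr_ge0 ?normal_peak_ge0// ?exprn_ge0// ltW.
have H (k : nat) : `|f k.+1%:R * phi k.+1%:R - f (- k.+1%:R) * phi (- k.+1%:R)| <=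
    4 * C * c * k.+1%:R^-1.
  apply: le_trans (ler_normB _ _) _; rewrite !normrM.
  rewrite !(ger0_norm (normal_pdf_ge0 _ _ _)).
  have -> : phi (- k.+1%:R) = phi k.+1%:R by rewrite !normal_pdf0E sqrrN.
  rewrite -mulrDl; apply: le_trans (_ : 4 * C * k.+1%:R * phi k.+1%:R <= _).
    rewrite ler_wpM2r ?normal_pdf_ge0//.
    have := fC k.+1%:R; have := fC (- k.+1%:R); rewrite normrN normr_nat => h1 h2.
    apply: le_trans (lerD h2 h1) _.
    have : (1 : R) <= k.+1%:R by rewrite ler1n.
    nra.
  rewrite -mulrA -[leRHS]mulrA ler_wpM2l ?mulr_ge0//; exact: kphi.
rewrite -(cvg_shiftS (fun k : nat => f k%:R * phi k%:R - f (- k%:R) * phi (- k%:R))).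
apply: norm_cvg0; apply: (@squeeze_cvgr _ _ _ _ (cst 0)
  (fun k : nat => 4 * C * c * k.+1%:R^-1)).
- by apply: nearW => k; rewrite normr_ge0 H.
- exact: cvg_cst.
- rewrite -[X in _ --> X](mulr0 (4 * C * c)); apply: cvgM; first exact: cvg_cst.
  exact: cvg_harmonic.
Qed.

(* Integration by parts, as [phi' x = - x / s^2 * phi x]. *)
Lemma normal_integration_by_parts (f df : R -> R) (C : R) :
  (forall x : R, is_derive x 1 f (df x)) -> continuous df ->
  (forall x, `|f x| <= C * (1 + `|x|)) -> (forall x, `|df x| <= C) ->
  (\int[N]_x (s ^+ 2 * df x - x * f x)%:E = 0)%E.
Proof.
move=> fd dfc fC dfC.
have fc := is_derive_continuous fd.
pose g x := s ^+ 2 * df x - x * f x.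
have gc : continuous g.
  apply: continuous_addf; first exact: continuous_scalef.
  rewrite (_ : (fun _ => _) = fun x => -1 * (x * f x)); last first.
    by apply/funext => x; rewrite mulN1r.
  apply/continuous_scalef/continuous_mulf => // x; exact: cvg_id.
have C0 : 0 <= C by apply: le_trans (dfC 0).
have gi : N.-integrable setT (EFin \o g).
  apply: (@integrable_normal_sqr_bound _ (C * (s ^+ 2 + 2))).
    exact: continuous_measurable_fun.
  move=> x; rewrite /g; apply: le_trans (ler_normB _ _) _.
  rewrite normrM [X in _ + X]normrM (ger0_norm (sqr_ge0 s)).
  apply: (@le_trans _ _ (s ^+ 2 * C + `|x| * (C * (1 + `|x|)))).
    by rewrite lerD// ler_wpM2l// sqr_ge0.
  rewrite (_ : _ + _ = C * (s ^+ 2 + (`|x| + `|x| ^+ 2))); last by ring.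
  rewrite -mulrA ler_wpM2l// -(real_normK (num_real x)).
  have := sqr_ge0 (`|x| - 1); have := sqr_ge0 s; have := sqr_ge0 (s * `|x|).
  nra.
have giphi : mu.-integrable setT (fun x => (g x * phi x)%:E).
  exact: integrable_mul_normal_pdf.
rewrite integral_normal_prob//.
have Fd (x : R) : is_derive x 1 (fun x => s ^+ 2 * (f x * phi x)) (g x * phi x).
  have := is_deriveZ (s ^+ 2) (is_deriveM (fd x) (is_derive_normal_pdf x)).
  move=> /is_derive_eq; apply.
  by rewrite /GRing.scale/= /g; field; rewrite gt_eqF.
have Fc := is_derive_continuous Fd.
pose I (k : nat) : set R := `[- k%:R, k%:R]%classic.
(* The fundamental theorem of calculus for [s ^+ 2 * (f * phi)], whose derivative is [g * phi]; the
   shifted index keeps the interval nondegenerate. *)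
have E1 k : (\int[mu]_(x in I k.+1) (g x * phi x)%:E =
    (s ^+ 2 * (f k.+1%:R * phi k.+1%:R - f (- k.+1%:R) * phi (- k.+1%:R)))%:E)%E.
  rewrite (@continuous_FTC2 _ (fun x => g x * phi x) (fun x => s ^+ 2 * (f x * phi x)))//.
  - by rewrite -EFinB mulrBr.
  - by rewrite -subr_gt0 opprK -natrD ltr0n.
  - apply: continuous_subspaceT => x; apply: cvgM; [exact: gc|].
    by apply: continuous_normal_pdf; rewrite gt_eqF.
  - split.
    + by move=> x _; case: (Fd x).
    + by apply: cvg_at_right_filter; exact: Fc.
    + by apply: cvg_at_left_filter; exact: Fc.
  - by move=> x _; rewrite derive1E; case: (Fd x).
have cv : (\int[mu]_(x in I k.+1) (g x * phi x)%:E @[k --> \oo] -->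
    \int[mu]_x (g x * phi x)%:E)%E.
  have mgphi : measurable_fun setT (fun x => (g x * phi x)%:E).
    exact: measurable_int giphi.
  under eq_fun do rewrite integral_mkcond.
  apply: (@dominated_cvg _ _ _ mu _ measurableT _ _ (fun x => `|(g x * phi x)%:E|%E)).
  - move=> k; have mI : measurable (I k.+1) by exact: measurable_itv.
    apply/(measurable_restrictT _ mI); exact: measurable_funS mgphi.
  - move=> x _; apply: cvg_near_cst; near=> k.
    rewrite patchE mem_set// /I/= in_itv/= -ler_norml.
    by apply: le_trans (_ : k%:R <= _); [near: k; exact: nbhs_infty_ger|rewrite ler_nat].
  - by [].
  - exact: integrable_abse.
  - by move=> k x _; rewrite patchE; case: ifP => //; rewrite abse0.
have : (\int[mu]_(x in I k.+1) (g x * phi x)%:E @[k --> \oo] --> 0)%E; last first.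
  by move=> /(cvg_unique _ cv); apply.
rewrite (_ : (fun k => _) = fun k => (s ^+ 2 * (f k.+1%:R * phi k.+1%:R
  - f (- k.+1%:R) * phi (- k.+1%:R)))%:E); last by apply/funext => k; exact: E1.
rewrite (cvg_shiftS (fun k => (s ^+ 2 * (f k%:R * phi k%:R - f (- k%:R) * phi (- k%:R)))%:E)).
apply: cvg_EFin; first exact: nearW.
rewrite -[X in _ --> X](mulr0 (s ^+ 2)); apply: cvgM; first exact: cvg_cst.
exact: cvg_lin_normal_pdf fC.
Unshelve. all: by end_near. Qed.

End normal_moments.

(** * Characteristic function of a normal variable *)

Section normal_charfun.
Context {R : realType}.
Variables (s : R) (s0 : 0 < s).
Local Notation N := (normal_prob 0 s).

Lemma continuous_cos_lin (t theta : R) : continuous (fun x : R => cos (t * x + theta)).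
Proof.
apply: continuous_compf; last exact: continuous_cos.
apply: continuous_addf; last by move=> x; exact: cst_continuous.
by apply: continuous_scalef => x; exact: cvg_id.
Qed.

Lemma continuous_sin_lin (t theta : R) : continuous (fun x : R => sin (t * x + theta)).
Proof.
apply: continuous_compf; last exact: continuous_sin.
apply: continuous_addf; last by move=> x; exact: cst_continuous.
by apply: continuous_scalef => x; exact: cvg_id.
Qed.

Lemma is_derive_lin (a b x : R) : is_derive x 1 (fun y => a * y + b) a.
Proof.
have := is_deriveD (is_deriveZ a (is_derive_id x 1)) (is_derive_cst b x 1).
by move=> /is_derive_eq; apply; rewrite addr0 /GRing.scale/= mulr1.
Qed.

Lemma integral_normal_id : (\int[N]_x x%:E = 0)%E.
Proof.
have : (\int[N]_x (s ^+ 2 * 0 - x * -1)%:E = 0)%E; last first.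
  by under eq_integral do rewrite mulr0 mulrN1 sub0r opprK.
apply: (@normal_integration_by_parts R s s0 (fun=> -1) (fun=> 0) 1) => [|x|x].
- by move=> x; exact: cst_continuous.
- by rewrite normrN1 mul1r lerDl.
- by rewrite normr0.
Qed.

Lemma integral_normal_sqr : (\int[N]_x (x ^+ 2)%:E = (s ^+ 2)%:E)%E.
Proof.
have i1 : N.-integrable setT (fun=> (s ^+ 2)%:E).
  apply: (@integrable_normal_sqr_bound R s s0 (fun=> s ^+ 2) (s ^+ 2)) => // x.
  by rewrite ger0_norm ?sqr_ge0// ler_peMr ?sqr_ge0// lerDl sqr_ge0.
have i2 : N.-integrable setT (fun x => (x ^+ 2)%:E).
  apply: (@integrable_normal_sqr_bound R s s0 (fun x => x ^+ 2) 1).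
    exact: exprn_measurable.
  by move=> x; rewrite ger0_norm ?sqr_ge0// mul1r lerDr.
have : (\int[N]_x (s ^+ 2 * 1 - x * x)%:E = 0)%E.
  apply: (@normal_integration_by_parts R s s0 id (fun=> 1) 1) => [|x|x].
  - by move=> x; exact: cst_continuous.
  - by rewrite mul1r lerDr.
  - by rewrite normr1.
under eq_integral do rewrite mulr1 -expr2 EFinB.
rewrite integralB// integral_cst// (_ : (_ * _ = (s ^+ 2)%:E)%E); last first.
  by rewrite -[RHS]mule1; congr (_ * _)%E; exact: probability_setT.
have := integrable_fin_num measurableT i2.
move=> /fineK <-; rewrite -EFinB => -[/eqP]; rewrite subr_eq0 => /eqP <- //.
Qed.

(** Differentiating under the integral and integrating by parts gives the equation
    [C' = - s ^+ 2 * u * C] for the integral [C u]; hence [C u * exp (s ^+ 2 * u ^+ 2 / 2)] is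
    constant. *)
Lemma normal_charfun t theta :
  (\int[N]_x (cos (t * x + theta))%:E
   = (expR (- (s ^+ 2 * t ^+ 2 / 2)) * cos theta)%:E)%E.
Proof.
pose C u := \int[N]_x (cos (u * x + theta)).
have ic u : N.-integrable setT (EFin \o (fun x => cos (u * x + theta))).
  apply: (@integrable_normal_sqr_bound R s s0 _ 1).
    by apply: continuous_measurable_fun; exact: continuous_cos_lin.
  by move=> x; rewrite mul1r; apply: le_trans (cos_max _) _; rewrite lerDl sqr_ge0.
have ixs u : N.-integrable setT (EFin \o (fun x => x * sin (u * x + theta))).
  apply: (@integrable_normal_sqr_bound R s s0 _ 1).
    apply: continuous_measurable_fun; apply: continuous_mulf.
      by move=> x; exact: cvg_id.
    exact: continuous_sin_lin.
  move=> x; rewrite mul1r normrM -(real_normK (num_real x)).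
  apply: (@le_trans _ _ `|x|); first by rewrite ler_piMr// sin_max.
  by have := sqr_ge0 (`|x| - 1); have := normr_ge0 x; nra.
have dcos (u x : R) : is_derive u 1 (fun v => cos (v * x + theta))
    (- (x * sin (u * x + theta))).
  have := @is_derive1_comp _ cos (fun v => x * v + theta) u _ _
    (is_derive_cos _) (is_derive_lin x theta u).
  rewrite (_ : cos \o _ = fun v => cos (v * x + theta)); last first.
    by apply/funext => v /=; rewrite mulrC.
  by move=> /is_derive_eq; apply; rewrite mulNr mulrC [x * u]mulrC.
have dC (u : R) : is_derive u 1 C (- (s ^+ 2 * u) * C u).
  have G0 (x : R) : 0 <= `|x| by [].
  have iG : N.-integrable setT (EFin \o (fun x : R => `|x|)).
    apply: (@integrable_normal_sqr_bound R s s0 _ 1).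
      exact: continuous_measurable_fun norm_continuous.
    move=> x; rewrite mul1r normr_id -(real_normK (num_real x)).
    by have := sqr_ge0 (`|x| - 1); have := normr_ge0 x; nra.
  have d1E v x : partial1of2 (fun v x => cos (v * x + theta)) v x = - (x * sin (v * x + theta)).
    by rewrite partial1of2E; case: (dcos v x).
  have Iu : (`]u - 1, u + 1[%classic : set R) u by rewrite /= in_itv/=; apply/andP; split; lra.
  have G_ub v (x : R) : (`]u - 1, u + 1[%classic : set R) v -> setT x ->
      `|partial1of2 (fun v x => cos (v * x + theta)) v x| <= `|x|.
    by move=> _ _; rewrite d1E normrN normrM ler_piMr// sin_max.
  have df v (x : R) : (`]u - 1, u + 1[%classic : set R) v -> setT x ->
     derivable (fun v : R => cos (v * x + theta)) v 1.
    by move=> _ _; case: (dcos v x).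
  have dv := @derivable_under_integral R _ _ N
    (fun v x => cos (v * x + theta)) setT measurableT u (u - 1) (u + 1) Iu
    (fun v _ => ic v) df (fun x => `|x|) G0 iG G_ub.
  have dE := @differentiation_under_integral R _ _ N
    (fun v x => cos (v * x + theta)) setT measurableT u (u - 1) (u + 1) Iu
    (fun v _ => ic v) df (fun x => `|x|) G0 iG G_ub.
  apply: DeriveDef; first exact: dv.
  rewrite -derive1E dE.
  have ibp : (\int[N]_x (s ^+ 2 * (u * cos (u * x + theta))
      - x * sin (u * x + theta))%:E = 0)%E.
    have ds (x : R) : is_derive x 1 (fun x => sin (u * x + theta))
        (u * cos (u * x + theta)).
      have := @is_derive1_comp _ sin (fun x => u * x + theta) x _ _
        (is_derive_sin _) (is_derive_lin u theta x).
      by move=> /is_derive_eq; apply; rewrite mulrC.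
    apply: (@normal_integration_by_parts R s s0 _ _ (1 + `|u|) ds) => [|x|x].
    - by apply: continuous_scalef; exact: continuous_cos_lin.
    - apply: le_trans (sin_max _) _.
      by have := normr_ge0 u; have := normr_ge0 x; nra.
    - rewrite normrM; apply: (@le_trans _ _ `|u|); last by rewrite lerDr.
      by rewrite ler_piMr// cos_max.
  have isc : N.-integrable setT (EFin \o (fun x => s ^+ 2 * (u * cos (u * x + theta)))).
    have -> : EFin \o (fun x => s ^+ 2 * (u * cos (u * x + theta))) =
        (fun x => (s ^+ 2 * u)%:E * (cos (u * x + theta))%:E)%E.
      by apply/funext => x /=; rewrite -EFinM mulrA.
    exact: integrableZl (ic u).
  have : \int[N]_x (s ^+ 2 * (u * cos (u * x + theta))
      - x * sin (u * x + theta)) = 0 by rewrite /Rintegral ibp.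
  rewrite RintegralB//.
  have -> : \int[N]_x (s ^+ 2 * (u * cos (u * x + theta))) =
      \int[N]_x (s ^+ 2 * u * cos (u * x + theta)).
    by apply: eq_Rintegral => x _; rewrite mulrA.
  rewrite RintegralZl// => /eqP; rewrite subr_eq0 => /eqP E.
  transitivity (\int[N]_x (- 1 * (x * sin (u * x + theta)))).
    by apply: eq_Rintegral => x _; rewrite d1E mulN1r.
  by rewrite RintegralZl// mulN1r -E mulNr.
pose D u := C u * expR (s ^+ 2 / 2 * u ^+ 2).
have dD (u : R) : is_derive u 1 D 0.
  have d2 := is_deriveZ (s ^+ 2 / 2) (is_deriveX 2 (is_derive_id u 1)).
  have := is_deriveM (dC u) (is_derive1_comp (is_derive_expR _) d2).
  rewrite (_ : C * _ = D); last first.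
    by apply/funext => v; rewrite /D !fctE /GRing.scale/=.
  move=> /is_derive_eq; apply.
  by rewrite /GRing.scale/= !fctE /=; field.
have := is_derive_0_is_cst t 0 dD.
have -> : D 0 = cos theta.
  rewrite /D expr0n mulr0 expR0 mulr1 /C.
  transitivity (\int[N]_x (cst (cos theta) x)).
    by apply: eq_Rintegral => x _; rewrite mul0r add0r.
  rewrite Rintegral_cst// -[RHS]mulr1; congr (_ * _).
  by rewrite [X in fine X](_ : _ = 1%E)//; exact: probability_setT.
move=> E; have := integrable_fin_num measurableT (ic t).
move=> /fineK <-; congr EFin; rewrite -E /D -[fine _]/(C t).
rewrite mulrCA -expRD (_ : _ + _ = 0) ?expR0 ?mulr1//.
by field.
Qed.

End normal_charfun.

(** * Independent standard normal variables *)

Section iid_normal.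
Context {R : realType}.

Lemma integrable_bounded d (T : measurableType d) (P : probability T R) (f : T -> R) (M : R) :
  measurable_fun setT f -> (forall x, `|f x| <= M) -> P.-integrable setT (EFin \o f).
Proof.
move=> mf fM; apply: measurable_bounded_integrable => //.
  by apply: le_lt_trans (ltry 1); exact: probability_le1.
exists M; split; first exact: num_real.
by move=> K MK x _; exact: le_trans (fM x) (ltW MK).
Qed.

Lemma integrable_cos d (T : measurableType d) (P : probability T R) (f : T -> R) :
  measurable_fun setT f -> P.-integrable setT (EFin \o (fun x => cos (f x))).
Proof.
move=> mf; apply: (@integrable_bounded _ _ _ _ 1) => [|x]; last exact: cos_max.
apply: measurableT_comp mf; apply: continuous_measurable_fun.
exact: continuous_cos.
Qed.

(** Independence and normality are recorded only through the joint characteristic function, which is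
    all that linear images of the vector require. Each induction step adds a coordinate by a product
    measure. *)
Lemma iid_normal N : exists d (T : measurableType d) (P : probability T R)
    (X : 'I_N -> T -> R), (forall k, measurable_fun setT (X k)) /\
  forall (t : 'I_N -> R) theta, (\int[P]_w (cos (\sum_k t k * X k w + theta))%:E
    = (expR (- ((\sum_k t k ^+ 2) / 2)) * cos theta)%:E)%E.
Proof.
pose G : probability (measurableTypeR R) R := normal_prob 0 1.
elim: N => [|N [d [T [P [X [mX XE]]]]]].
  exists _, _, G, (fun _ _ => 0); split=> [[//]|t theta].
  under eq_integral do rewrite big_ord0 add0r.
  rewrite integral_cst// big_ord0 mul0r oppr0 expR0 mul1r -[RHS]mule1.
  by congr (_ * _)%E; exact: probability_setT.
pose Y (k : 'I_N.+1) (w : T * measurableTypeR R) : R :=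
  if unlift ord0 k is Some j then X j w.1 else w.2.
exists _, _, (P \x G)%E, Y.
have mY k : measurable_fun setT (Y k).
  rewrite /Y; case: unliftP => [j _|_]; last exact: measurable_snd.
  exact: measurableT_comp (mX j) measurable_fst.
split=> // t theta.
pose W (x : T) : R := \sum_k t (lift ord0 k) * X k x.
have YE w : \sum_k t k * Y k w = t ord0 * w.2 + W w.1.
  rewrite big_ord_recl /Y unlift_none; congr (_ + _).
  by apply: eq_bigr => k _; rewrite liftK.
have mW : measurable_fun setT W.
  by apply: measurable_sum => k; apply: measurable_funM.
have mf : measurable_fun setT (fun w => \sum_k t k * Y k w + theta).
  apply: measurable_funD => //.
  by apply: measurable_sum => k; apply: measurable_funM.
(* By Fubini the new coordinate is integrated first; the others merely shift its phase by [W x]. *)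
rewrite -(integral12_prod_meas1 (integrable_cos (P \x G)%E mf)).
transitivity (\int[P]_x (expR (- (t ord0 ^+ 2 / 2)) * cos (W x + theta))%:E)%E.
  apply: eq_integral => x _.
  transitivity (\int[G]_y (cos (t ord0 * y + (W x + theta)))%:E)%E.
    by apply: eq_integral => y _; rewrite /= YE/= -addrA.
  by rewrite (@normal_charfun R 1 ltr01) expr1n mul1r.
under eq_integral do rewrite EFinM.
rewrite integralZl//; last first.
  by apply: integrable_cos; apply: measurable_funD.
rewrite XE -EFinM mulrA -expRD big_ord_recl; congr (expR _ * _)%:E.
by rewrite mulrDl opprD.
Qed.

End iid_normal.

(** * Factorization of positive semidefinite matrices *)

Section psd_factor.
Context {R : realType}.

(** Cholesky elimination of the first row and column, the smaller matrix being the Schur complement.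
    A zero corner is treated apart: there positivity forces the whole row to vanish. *)
Lemma psd_factor n (S : 'M[R]_n) : S^T = S ->
  (forall t : 'rV[R]_n, 0 <= (t *m S *m t^T) ord0 ord0) ->
  exists L : 'M[R]_n, S = L *m L^T.
Proof.
elim: n S => [|n IH] S ST Spos.
  by exists 0; rewrite !flatmx0.
pose a := S ord0 ord0.
pose S1 : 'M[R]_(1 + n) := S.
pose b : 'rV[R]_n := ursubmx S1.
pose D : 'M[R]_n := drsubmx S1.
have Spos1 (t : 'rV[R]_(1 + n)) : 0 <= (t *m S1 *m t^T) ord0 ord0 by exact: Spos.
have S1T : S1^T = S1 := ST.
have SE : S1 = block_mx a%:M b b^T D.
  rewrite -[LHS]submxK; congr block_mx.
    apply/matrixP => i j; rewrite !ord1 !mxE eqxx mulr1n /a.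
    by congr (S _ _); apply/val_inj.
  by rewrite /b trmx_ursub S1T.
have DT : D^T = D by rewrite /D trmx_drsub S1T.
have tb (t : 'rV[R]_n) : t *m b^T = b *m t^T.
  apply/matrixP => i j; rewrite !ord1 !mxE; apply: eq_bigr => k _.
  by rewrite !mxE mulrC.
have quad (x : R) (t : 'rV[R]_n) : 0 <= x ^+ 2 * a + 2 * x * (b *m t^T) ord0 ord0
    + (t *m D *m t^T) ord0 ord0.
  have := Spos1 (row_mx x%:M t).
  rewrite SE tr_row_mx mul_row_block mul_row_col tr_scalar_mx.
  rewrite !mulmxDl !mul_mx_scalar !mul_scalar_mx -scalemxAl tb.
  move: (b *m t^T) (t *m D *m t^T) => u w; rewrite !mxE eqxx mulr1n => H.
  by apply: le_trans H _; rewrite le_eqVlt; apply/orP; left; apply/eqP; ring.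
have a0 : 0 <= a.
  by have := quad 1 0; rewrite trmx0 !mulmx0 !mxE mulr0 !addr0 expr1n mul1r.
have [az|an] := eqVneq a 0.
  have bt (t : 'rV[R]_n) : (b *m t^T) ord0 ord0 = 0.
    apply/eqP; apply/negPn/negP => bn.
    set u : R := (b *m t^T) ord0 ord0 in bn *; set w : R := (t *m D *m t^T) ord0 ord0.
    (* With [a = 0] the form is affine in its first variable, and this value of it makes the form
       equal to -1. *)
    have := quad (- (w + 1) / (2 * u)) t; rewrite az mulr0 add0r -/u -/w.
    rewrite (_ : _ + w = -1); first by rewrite leNgt; lra.
    by field.
  have b0 : b = 0.
    apply/rowP => i; have := bt (delta_mx ord0 i).
    by rewrite trmx_delta -colE !mxE.
  have [L LE] : exists L : 'M[R]_n, D = L *m L^T.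
    apply: IH => // t; have := quad 0 t.
    by rewrite expr0n mulr0 !mul0r !add0r.
  pose M : 'M[R]_(1 + n) := block_mx 0 0 0 L.
  exists M; suff : S1 = M *m M^T by [].
  rewrite SE b0 az trmx0 /M (tr_block_mx (0 : 'M[R]_1)) mulmx_block.
  rewrite !trmx0 !mul0mx !mulmx0 !add0r -LE.
  by rewrite raddf0.
have ap : 0 < a by rewrite lt_def an.
(* The Schur complement is the minimum of the form over the first variable, attained at [- u / a],
   and so inherits positivity. *)
have [L LE] : exists L : 'M[R]_n, D - a^-1 *: (b^T *m b) = L *m L^T.
  apply: IH; first by rewrite linearB linearZ/= trmx_mul trmxK DT.
  move=> t; set u : R := (b *m t^T) ord0 ord0.
  have := quad (- u / a) t; rewrite -/u.
  rewrite mulmxBr mulmxBl -scalemxAr -scalemxAl (mulmxA t b^T b) tb -(mulmxA (b *m t^T) b t^T).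
  rewrite {}/u; move: (b *m t^T) (t *m D *m t^T) => u w.
  have -> : (w - a^-1 *: (u *m u)) ord0 ord0 =
      w ord0 ord0 - a^-1 * (u ord0 ord0 * u ord0 ord0) by rewrite !mxE big_ord1.
  move=> H; apply: le_trans H _; rewrite le_eqVlt; apply/orP; left; apply/eqP.
  by field.
have sa : Num.sqrt a != 0 by rewrite sqrtr_eq0 -ltNge.
pose M : 'M[R]_(1 + n) := block_mx (Num.sqrt a)%:M 0 ((Num.sqrt a)^-1 *: b^T) L.
exists M; suff : S1 = M *m M^T by [].
rewrite SE /M (tr_block_mx (Num.sqrt a)%:M) mulmx_block.
rewrite !trmx0 !mul0mx !mulmx0 !addr0 -LE tr_scalar_mx linearZ/= trmxK.
rewrite -scalar_mxM -expr2 sqr_sqrtr// mul_scalar_mx scalerA divff// scale1r.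
rewrite mul_mx_scalar scalerA divff// scale1r -scalemxAl -scalemxAr scalerA.
by rewrite -invfM -expr2 sqr_sqrtr// addrC subrK.
Qed.

End psd_factor.

(** * Borel structure on row vectors and laws of random vectors *)

Section borel_rV.
Context {R : realType} {n : nat}.

(** Every open set is a countable union of boxes with rational centre and radius [1 / (k + 1)], and
    the preimage of a box is a finite intersection of coordinate conditions. *)
Lemma measurable_borel_rV d (T : measurableType d) (X : T -> borel_rV R n) :
  (forall i, measurable_fun setT (fun w => (X w : 'rV[R]_n) ord0 i)) ->
  measurable_fun setT X.
Proof.
move=> mX.
refine (@measurability _ _ T (borel_rV R n) setT X (@open 'rV[R]_n) erefl _).
move=> _ [U oU <-]; rewrite setTI.
pose box (q : 'rV[rat]_n) (k : nat) : set 'rV[R]_n :=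
  [set y | forall i, `|y ord0 i - ratr (q ord0 i)| < k.+1%:R^-1].
have mbox q k : measurable (X @^-1` box q k).
  rewrite (_ : _ @^-1` _ = \bigcap_(i in [set: 'I_n])
      ((fun w => (X w : 'rV[R]_n) ord0 i - ratr (q ord0 i)) @^-1`
        `]- k.+1%:R^-1, k.+1%:R^-1[%classic)); last first.
    apply/seteqP; split=> w /= H i.
      by move=> _; rewrite /preimage/= in_itv/= -ltr_norml; exact: H.
    by have := H i I; rewrite /preimage/= in_itv/= -ltr_norml.
  apply: fin_bigcap_measurable => // i _; rewrite -[X in measurable X]setTI.
  by apply: measurable_funB => //; exact: measurable_itv.
(* The boxes are enumerated by the codes of their parameters; a code without a box inside [U]
   contributes the empty set. *)
pose F (j : nat) : set T := if @choice.unpickle ('rV[rat]_n * nat)%type j is Some (q, k) then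
  (if `[< box q k `<=` U >] then X @^-1` box q k else set0) else set0.
rewrite (_ : _ @^-1` _ = \bigcup_j F j); last first.
  apply/seteqP; split=> w /=; last first.
    move=> [j _]; rewrite /F; case: choice.unpickle => [[q k]|//].
    by case: asboolP => // qU; exact: qU.
  move=> Uw; have : nbhs (X w : 'rV[R]_n) U by exact: open_nbhs_nbhs.
  move=> /nbhs_ballP[r /= r0 rU].
  pose k := Num.truncn (2 / r).
  have kr : k.+1%:R^-1 < r / 2.
    rewrite -[r / 2]invrK ltf_pV2 ?posrE ?invr_gt0 ?divr_gt0// invf_div.
    exact: truncnS_gt.
  have k0 : 0 < k.+1%:R^-1 :> R by rewrite invr_gt0.
  have /choice[q qX] : forall i, exists q : rat,
      `|(X w : 'rV[R]_n) ord0 i - ratr q| < k.+1%:R^-1.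
    move=> i; have [|q] := @rat_in_itvoo R ((X w : 'rV[R]_n) ord0 i - k.+1%:R^-1)
      ((X w : 'rV[R]_n) ord0 i + k.+1%:R^-1); first by rewrite ltrBlDr -addrA ltrDl addr_gt0.
    by rewrite in_itv/= => qi; exists q; rewrite distrC ltr_distl.
  exists (choice.pickle (\row_i q i, k)) => //; rewrite /F choice.pickleK asboolT.
    by move=> i; rewrite mxE.
  move=> y yb; apply: rU; rewrite -ball_normE/=; apply: norm_rV_lt => // i.
  rewrite !mxE; have := yb i; rewrite mxE => h1; have := qX i => h2.
  rewrite (_ : _ - _ = ((X w : 'rV[R]_n) ord0 i - ratr (q i)) - (y ord0 i - ratr (q i))); last by ring.
  apply: le_lt_trans (ler_normB _ _) _; rewrite [r]splitr.
  by apply: ltrD; [exact: lt_trans kr|exact: lt_trans kr].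
apply: bigcupT_measurable => j; rewrite /F; case: choice.unpickle => [[q k]|//].
by case: ifP.
Qed.

Lemma continuous_borel_rV (f : 'rV[R]_n -> R) : continuous f ->
  measurable_fun setT (f : borel_rV R n -> R).
Proof.
move=> /continuousP fc; apply: (measurability _ (RGenOpens.measurableE R)).
move=> _ [_ [a [b ->]] <-]; rewrite setTI; apply: sub_sigma_algebra.
by apply: fc; exact: interval_open.
Qed.

Section prob_mean.
Context d (T : measurableType d) (P : probability T R) (X : T -> 'rV[R]_n).
Hypothesis mX : measurable_fun setT (X : T -> borel_rV R n).

Definition prob_mean (f : 'rV[R]_n -> R) : R := \int[P]_w f (X w).

Lemma integrable_bounded_continuous f : bounded_continuous f ->
  P.-integrable setT (EFin \o (fun w => f (X w))).
Proof.
move=> [fc [M fM]]; apply: (@integrable_bounded _ _ _ _ _ M) => [|w]; last exact: fM.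
exact: measurableT_comp (continuous_borel_rV fc) mX.
Qed.

Lemma prob_meanE f : bounded_continuous f ->
  (\int[P]_w (f (X w))%:E = (prob_mean f)%:E)%E.
Proof.
move=> bf; rewrite /prob_mean /Rintegral fineK//.
exact: integrable_fin_num (integrable_bounded_continuous bf).
Qed.

Lemma mean_functional_prob : mean_functional prob_mean.
Proof.
split=> [f g bf bg|a f bf|f g bf bg fg|].
- by rewrite /prob_mean RintegralD//; exact: integrable_bounded_continuous.
- by rewrite /prob_mean RintegralZl//; exact: integrable_bounded_continuous.
- by apply: le_Rintegral => //; exact: integrable_bounded_continuous.
- rewrite /prob_mean; have := @Rintegral_cst _ _ _ P setT measurableT 1.
  move=> ->; rewrite mul1r.
  by rewrite [X in fine X](_ : _ = 1%E)//; exact: probability_setT.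
Qed.

(** Dominated convergence: the truncated norms tend to 0 pointwise as the radius grows and are
    bounded by 1. *)
Lemma tight_prob I (F : set_system I) {FF : Filter F} : tight F (fun=> prob_mean).
Proof.
move=> e e0.
have : (\int[P]_w (truncated_norm k.+1%:R (X w))%:E @[k --> \oo] --> \int[P]_w 0)%E.
  apply: (@dominated_cvg _ _ _ P _ measurableT _ _ (cst 1%E)) => //.
  - move=> k; apply: measurable_int (integrable_bounded_continuous _).
    exact: bounded_continuous_truncated_norm.
  - move=> w _; apply: cvg_EFin; first exact: nearW.
    apply: (@squeeze_cvgr _ _ _ _ (cst 0) (fun k : nat => `|X w| * k.+1%:R^-1)).
    + apply: nearW => k /=; rewrite /truncated_norm ge_min lexx orbT andbT.
      by rewrite le_min ler01 divr_ge0.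
    + exact: cvg_cst.
    + rewrite -[X in _ --> X](mulr0 `|X w|); apply: cvgM; first exact: cvg_cst.
      exact: cvg_harmonic.
  - exact: finite_measure_integrable_cst.
  - move=> k w _; rewrite lee_fin ger0_norm; first by rewrite ge_min lexx.
    by rewrite le_min ler01 divr_ge0.
rewrite integral0; under eq_fun => k.
  rewrite prob_meanE; last exact: bounded_continuous_truncated_norm.
  over.
move=> /fine_cvg /cvgrPdist_le /(_ _ e0)[N _ /(_ N (leqnn N))].
rewrite sub0r normrN => H; exists N.+1%:R => //.
by apply: nearW => _; apply: le_trans (ler_norm _) H.
Qed.

End prob_mean.

End borel_rV.

(** * Laws on the line with equal characteristic functions *)

Section uniqueness.
Context {R : realType}.

(** The convergence criterion for a constant sequence shows that both laws integrate bounded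
    continuous functions alike. Open half-lines follow by approximation, and they form a generating
    family closed under intersection. *)
Lemma eq_probability_cos (P Q : probability (measurableTypeR R) R) :
  (forall t theta, \int[P]_x (cos (t * x + theta))%:E = \int[Q]_x (cos (t * x + theta))%:E)%E ->
  forall S, measurable S -> P S = Q S.
Proof.
move=> PQ.
pose X (x : measurableTypeR R) : 'rV[R]_1 := \row__ x.
have mX : measurable_fun setT (X : measurableTypeR R -> borel_rV R 1).
  apply: measurable_borel_rV => i; under eq_fun do rewrite mxE.
  exact: measurable_id.
have E f : bounded_continuous f -> prob_mean P X f = prob_mean Q X f.
  move=> bf; have : prob_mean P X f @[k --> \oo] --> prob_mean Q X f.
    apply: (@cvg_mean_trig R 1 nat \oo _ (fun=> prob_mean P X) (prob_mean Q X)) bf.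
    - by apply: nearW => _; exact: mean_functional_prob.
    - exact: mean_functional_prob.
    - move=> u theta; rewrite (_ : prob_mean Q X _ =
        prob_mean P X (fun x => cos (dot u x + theta))); first exact: cvg_cst.
      rewrite /prob_mean /Rintegral; congr fine.
      have dE (x : R) : dot u (X x) = u ord0 ord0 * x by rewrite /dot big_ord1 mxE.
      by under eq_integral do rewrite dE; under [RHS]eq_integral do rewrite dE.
    - exact: tight_prob.
    - exact: tight_prob.
  by move=> /cvg_lim <- //; rewrite lim_cst.
have mE (U : probability (measurableTypeR R) R) (f : R -> R) :
    bounded_continuous (fun x : 'rV[R]_1 => f (x ord0 ord0)) ->
    (\int[U]_x (f x)%:E = (prob_mean U X (fun x => f (x ord0 ord0)))%:E)%E.
  move=> bf; rewrite -(prob_meanE U mX bf); apply: eq_integral => x _.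
  by rewrite mxE.
have H a : P `]-oo, a[%classic = Q `]-oo, a[%classic.
  (* Piecewise linear functions that tend to the indicator of []-oo, a[]; all of them vanish at [a]
     itself. *)
  pose f (k : nat) (x : R) : R := Num.max 0 (Num.min 1 (k%:R * (a - x))).
  have f01 k x : 0 <= f k x <= 1.
    by rewrite le_max lexx/= ge_max ler01/= ge_min lexx.
  have fc k : continuous (f k).
    move=> x; apply: (@continuous_max R R (fun=> 0) (fun x => Num.min 1 (k%:R * (a - x)))).
      exact: cst_continuous.
    apply: (@continuous_min R R (fun=> 1) (fun x => k%:R * (a - x))); first exact: cst_continuous.
    apply: continuous_scalef; apply: continuous_addf.
      by move=> y; exact: cst_continuous.
    by move=> y; apply: cvgN; exact: cvg_id.
  have bf k : bounded_continuous (fun x : 'rV[R]_1 => f k (x ord0 ord0)).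
    split; last by exists 1 => x; have /andP[h1 h2] := f01 k (x ord0 ord0); rewrite ger0_norm.
    by apply: continuous_compf (fc k); exact: coord_continuous.
  have cvgf (U : probability (measurableTypeR R) R) :
      (\int[U]_x (f k x)%:E @[k --> \oo] --> U `]-oo, a[%classic)%E.
    have -> : U `]-oo, a[%classic = (\int[U]_x (\1_(`]-oo, a[%classic) x)%:E)%E.
      by rewrite integral_indic// setIT.
    apply: (@dominated_cvg _ _ _ U _ measurableT _ _ (cst 1%E)) => //.
    - move=> k; apply/measurable_EFinP.
      exact: continuous_measurable_fun.
    - move=> x _; apply: cvg_near_cst; near=> k.
      rewrite indicE; case: (boolP (x \in _)) => xa; rewrite /f.
        have {}xa : 0 < a - x by rewrite subr_gt0; move: xa; rewrite inE/= in_itv.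
        rewrite min_l ?max_r// -ler_pdivrMr// mul1r.
        by near: k; exact: nbhs_infty_ger.
      rewrite max_l// ge_min; apply/orP; right; rewrite mulr_ge0_le0//.
      by rewrite subr_le0 leNgt; apply: contraNN xa => xa; rewrite inE/= in_itv.
    - exact: finite_measure_integrable_cst.
    - by move=> k x _; have /andP[h1 h2] := f01 k x; rewrite lee_fin ger0_norm.
  have := cvgf P; rewrite (_ : (fun k => _) = fun k => \int[Q]_x (f k x)%:E)%E.
    by move=> h; exact: cvg_unique h (cvgf Q).
  by apply/funext => k; rewrite !mE// E.
move=> S mS.
apply: (@measure_unique _ _ (measurableTypeR R) (@RGenInftyO.G R)
  (fun k : nat => `]-oo, k%:R[%classic) _ _ _ _ P Q _ _ S mS) => //.
- exact: RGenInftyO.measurableE.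
- move=> _ _ [x ->] [y ->]; exists (Num.min x y).
  by apply/seteqP; split=> z /=; rewrite !in_itv/= lt_min => /andP.
- by move=> k; exists k%:R.
- apply/seteqP; split=> // x _; exists (Num.truncn x).+1 => //=.
  by rewrite in_itv/=; exact: truncnS_gt.
- by move=> _ [x ->]; exact: H.
- by move=> k; apply: le_lt_trans (ltry 1); exact: probability_le1.
Unshelve. all: by end_near. Qed.

End uniqueness.

(** * Gaussian vectors from their characteristic function *)

Section gaussian_vector.
Context {R : realType} {n : nat}.
Variable S : 'M[R]_n.
Local Notation Q t := ((t *m S *m t^T) ord0 ord0).

Lemma quadZ (a : R) (t : 'rV[R]_n) : Q (a *: t) = a ^+ 2 * Q t.
Proof.
by rewrite linearZ/= -!scalemxAl -scalemxAr scalerA -expr2 mxE.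
Qed.

Lemma quad_sumE (t : 'rV[R]_n) : Q t = \sum_i \sum_j t ord0 i * S i j * t ord0 j.
Proof.
rewrite mxE exchange_big/=; apply: eq_bigr => j _.
by rewrite mxE mulr_suml; apply: eq_bigr => i _; rewrite mxE.
Qed.

Lemma quad_delta (i j : 'I_n) (a : R) : S^T = S ->
  Q ((delta_mx ord0 i + a *: delta_mx ord0 j) : 'rV[R]_n) = S i i + 2 * a * S i j + a ^+ 2 * S j j.
Proof.
move=> ST; have Sji : S j i = S i j by rewrite -[in LHS]ST mxE.
have E k l : ((delta_mx ord0 k : 'rV[R]_n) *m S *m (delta_mx ord0 l : 'rV[R]_n)^T) ord0 ord0 = S k l.
  by rewrite -rowE trmx_delta -colE !mxE.
have D (M N : 'M[R]_1) : (M + N) ord0 ord0 = M ord0 ord0 + N ord0 ord0 by rewrite mxE.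
have Z b (M : 'M[R]_1) : (b *: M) ord0 ord0 = b * M ord0 ord0 by rewrite mxE.
rewrite linearD linearZ/= !mulmxDl !mulmxDr -!scalemxAl -!scalemxAr scalerA.
by rewrite !D !Z !E Sji; ring.
Qed.

Variable nu : probability (borel_rV R n) R.
Hypothesis ST : S^T = S.
Hypothesis Q0 : forall t : 'rV[R]_n, 0 <= Q t.
Hypothesis nu_cos : forall t theta, (\int[nu]_x (cos (dot t x + theta))%:E
  = (expR (- (Q t / 2)) * cos theta)%:E)%E.

Lemma measurable_dot t : measurable_fun setT (dot t : borel_rV R n -> measurableTypeR R).
Proof. by apply: continuous_borel_rV; exact: continuous_dot. Qed.

Definition dot_mfun t : {mfun borel_rV R n >-> measurableTypeR R} :=
  HB.pack (dot t : borel_rV R n -> measurableTypeR R)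
    (isMeasurableFun.Build _ _ _ _ _ (measurable_dot t)).

Lemma dot_distribution_cos t a theta :
  (\int[distribution nu (dot_mfun t)]_y (cos (a * y + theta))%:E
    = (expR (- (a ^+ 2 * Q t / 2)) * cos theta)%:E)%E.
Proof.
rewrite integral_distribution; first last.
- apply: integrable_cos; apply: measurable_funD => //.
  by apply: measurable_funM => //; exact: measurable_dot.
- apply/measurable_EFinP; apply: continuous_measurable_fun.
  exact: continuous_cos_lin.
rewrite -quadZ -nu_cos; apply: eq_integral => x _ /=.
by rewrite dotZl.
Qed.

Lemma dot_distribution_normal t A : 0 < Q t -> measurable A ->
  distribution nu (dot_mfun t) A = normal_prob 0 (Num.sqrt (Q t)) A.
Proof.
move=> Qt mA; apply: (@eq_probability_cos R (distribution nu (dot_mfun t))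
  (normal_prob 0 (Num.sqrt (Q t)))) => // a theta.
rewrite dot_distribution_cos normal_charfun ?sqrtr_gt0//.
by rewrite sqr_sqrtr// [a ^+ 2 * _]mulrC.
Qed.

Lemma dot_distribution_dirac t A : Q t = 0 -> measurable A ->
  distribution nu (dot_mfun t) A = \d_(0%R : measurableTypeR R) A.
Proof.
move=> Qt mA; apply: (@eq_probability_cos R (distribution nu (dot_mfun t))
  (dirac (0%R : measurableTypeR R))) => // a theta.
rewrite dot_distribution_cos integral_dirac//; last first.
  apply/measurable_EFinP; apply: continuous_measurable_fun.
  exact: continuous_cos_lin.
by rewrite diracT mul1e Qt !mulr0 add0r mul0r oppr0 expR0 mul1r.
Qed.

(** The law of [dot t] is known exactly: normal of variance [Q t], or the Dirac mass at 0 when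
    [Q t = 0], where the formulas for positive deviation do not apply. *)
Lemma integral_dot_sqr t : (\int[nu]_x (dot t x ^+ 2)%:E = (Q t)%:E)%E.
Proof.
transitivity (\int[distribution nu (dot_mfun t)]_y (y ^+ 2)%:E)%E.
  rewrite ge0_integral_distribution//.
    by apply/measurable_EFinP; exact: exprn_measurable.
  by move=> y; rewrite lee_fin sqr_ge0.
have := Q0 t; rewrite le_eqVlt => /predU1P[Qt|Qt].
  transitivity (\int[\d_(0%R : measurableTypeR R)]_y (y ^+ 2)%:E)%E.
    by apply: eq_measure_integral => A mA _; exact: dot_distribution_dirac.
  rewrite integral_dirac//; first by rewrite diracT mul1e expr0n -Qt.
  by apply/measurable_EFinP; exact: exprn_measurable.
transitivity (\int[normal_prob 0 (Num.sqrt (Q t))]_y (y ^+ 2)%:E)%E.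
  by apply: eq_measure_integral => A mA _; exact: dot_distribution_normal.
by rewrite integral_normal_sqr ?sqrtr_gt0// sqr_sqrtr// ltW.
Qed.

Lemma integrable_dot_sqr t : nu.-integrable setT (fun x => (dot t x ^+ 2)%:E).
Proof.
apply/integrableP; split.
  apply/measurable_EFinP; apply: measurable_funX; exact: measurable_dot.
under eq_integral do rewrite gee0_abs ?lee_fin ?sqr_ge0//.
by rewrite integral_dot_sqr ltry.
Qed.

Lemma integrable_dot t : nu.-integrable setT (fun x => (dot t x)%:E).
Proof.
have := integrableD measurableT (finite_measure_integrable_cst nu 1 measurableT) (integrable_dot_sqr t).
apply: le_integrable => //; first by apply/measurable_EFinP; exact: measurable_dot.
move=> x _ /=; rewrite lee_fin; apply: le_trans (ler_norm _).
rewrite -(real_normK (num_real (dot t x))).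
by have := sqr_ge0 (`|dot t x| - 1); have := normr_ge0 (dot t x); nra.
Qed.

Lemma integral_dot t : (\int[nu]_x (dot t x)%:E = 0)%E.
Proof.
transitivity (\int[distribution nu (dot_mfun t)]_y y%:E)%E.
  by rewrite integral_distribution//; exact: integrable_dot.
have := Q0 t; rewrite le_eqVlt => /predU1P[Qt|Qt].
  transitivity (\int[\d_(0%R : measurableTypeR R)]_y y%:E)%E.
    by apply: eq_measure_integral => A mA _; exact: dot_distribution_dirac.
  by rewrite integral_dirac// mule0.
transitivity (\int[normal_prob 0 (Num.sqrt (Q t))]_y y%:E)%E.
  by apply: eq_measure_integral => A mA _; exact: dot_distribution_normal.
by rewrite integral_normal_id ?sqrtr_gt0.
Qed.

Lemma central_normal_cos : central_normal nu S.
Proof.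
have Ei i : ('E_nu[fun x : 'rV[R]_n => x ord0 i] = 0)%E.
  rewrite unlock -(integral_dot (delta_mx ord0 i)).
  by apply: eq_integral => x _; rewrite dot_delta.
split=> [t|//|i j].
  have := Q0 t; rewrite le_eqVlt => /predU1P[Qt|Qt].
    by left; exists 0 => A mA; exact: dot_distribution_dirac.
  right; exists 0, (Num.sqrt (Q t)); split; first by rewrite sqrtr_gt0.
  by move=> A mA; exact: dot_distribution_normal.
rewrite unlock !Ei/= unlock.
(* Polarization: [4 x_i x_j] is the difference of the squares of [dot (u 1) x] and
   [dot (u (-1)) x]. *)
pose u (a : R) : 'rV[R]_n := delta_mx ord0 i + a *: delta_mx ord0 j.
have uE a x : dot (u a) x = x ord0 i + a * x ord0 j by rewrite dotDl dotZl !dot_delta.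
transitivity (\int[nu]_x ((4^-1)%:E * ((dot (u 1) x ^+ 2)%:E - (dot (u (-1)) x ^+ 2)%:E)))%E.
  apply: eq_integral => x _; rewrite -EFinB -EFinM !uE; congr EFin.
  transitivity ((x ord0 i - 0) * (x ord0 j - 0)); first by [].
  by field.
rewrite integralZl//; last by apply: integrableB => //; exact: integrable_dot_sqr.
rewrite integralB//; [|exact: integrable_dot_sqr..].
rewrite !integral_dot_sqr -EFinB -EFinM !quad_delta//; congr EFin.
by field.
Qed.

End gaussian_vector.

(** The law is the image of independent standard normal variables under a factor [L] of [S]: the
    coefficient vector [t L] has squared length [t S t^T]. *)
Theorem gaussian_exists {R : realType} n (S : 'M[R]_n) : S^T = S ->
  (forall t : 'rV[R]_n, 0 <= (t *m S *m t^T) ord0 ord0) ->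
  exists nu : probability (borel_rV R n) R, central_normal nu S /\
    forall t theta, (\int[nu]_x (cos (dot t x + theta))%:E
      = (expR (- ((t *m S *m t^T) ord0 ord0 / 2)) * cos theta)%:E)%E.
Proof.
move=> ST Spos; have [L SL] := psd_factor ST Spos.
have [d [T [P [X [mX XE]]]]] := @iid_normal R n.
pose V (w : T) : borel_rV R n := \row_i \sum_k L i k * X k w.
have mV : measurable_fun setT V.
  apply: measurable_borel_rV => i; under eq_fun do rewrite mxE.
  by apply: measurable_sum => k; apply: measurable_funM.
pose V' : {mfun T >-> borel_rV R n} := HB.pack V (isMeasurableFun.Build _ _ _ _ _ mV).
have VE t w : dot t (V w) = \sum_k (t *m L) ord0 k * X k w.
  rewrite /dot; under eq_bigr do rewrite mxE mulr_sumr.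
  rewrite exchange_big/=; apply: eq_bigr => k _.
  by rewrite mxE mulr_suml; apply: eq_bigr => i _; rewrite mulrA.
have nu_cos t theta : (\int[distribution P V']_x (cos (dot t x + theta))%:E
      = (expR (- ((t *m S *m t^T) ord0 ord0 / 2)) * cos theta)%:E)%E.
  have bc : bounded_continuous (fun x => cos (dot t x + theta)).
    exact/bounded_continuous_trigpoly/trigpoly_cos.
  rewrite integral_distribution; first last.
  - exact: (@integrable_bounded_continuous R n _ _ P V mV _ bc).
  - by apply/measurable_EFinP; apply: continuous_borel_rV; case: bc.
  transitivity (\int[P]_w (cos (\sum_k (t *m L) ord0 k * X k w + theta))%:E)%E.
    by apply: eq_integral => w _ /=; rewrite VE.
  rewrite XE; congr (expR (- (_ / 2)) * _)%:E.
  rewrite SL mulmxA -mulmxA -trmx_mul [RHS]mxE; apply: eq_bigr => k _.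
  by rewrite [X in _ * X]mxE expr2.
by exists (distribution P V'); split=> //; exact: central_normal_cos.
Qed.
(** * Averages over bounded height *)

Section average.
Context {R : realType} {Omega : pointedType}.
Variable h : Omega -> R.
Implicit Types (B : R) (u v : Omega -> R).

(** An empty height set gives 0 through division by zero, so linearity and monotonicity hold for all
    [B]; only the average of a constant requires an element of height at most [B]. *)
Definition avg B u : R :=
  (\sum_(a <- fset_set (height_le h B)) u a) / (height_count h B)%:R.

Lemma avgD B u v : avg B (fun a => u a + v a) = avg B u + avg B v.
Proof. by rewrite /avg big_split mulrDl. Qed.

Lemma avgZ B c u : avg B (fun a => c * u a) = c * avg B u.
Proof. by rewrite /avg -mulr_sumr mulrA. Qed.

Lemma avgN B u : avg B (fun a => - u a) = - avg B u.
Proof. by rewrite /avg sumrN mulNr. Qed.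

Lemma avg0 B : avg B (fun=> 0) = 0.
Proof. by rewrite /avg big1 ?mul0r. Qed.

Lemma avg_sum B (I : Type) (r : seq I) (P : pred I) (F : I -> Omega -> R) :
  avg B (fun a => \sum_(i <- r | P i) F i a) = \sum_(i <- r | P i) avg B (F i).
Proof. by rewrite /avg exchange_big/= mulr_suml. Qed.

Lemma ler_avg B u v : (forall a, u a <= v a) -> avg B u <= avg B v.
Proof. by move=> uv; rewrite /avg ler_wpM2r ?invr_ge0// ler_sum. Qed.

Lemma norm_avg_le B u v : (forall a, `|u a| <= v a) -> `|avg B u| <= avg B v.
Proof.
move=> uv; rewrite ler_norml -avgN; apply/andP; split; apply: ler_avg => a.
  by have := uv a; rewrite ler_norml => /andP[].
by have := uv a; rewrite ler_norml => /andP[].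
Qed.

Hypothesis height_finite : forall B : R, 0 <= B -> finite_set [set a | h a <= B].
Hypothesis h_ge0 : forall a, 0 <= h a.

Lemma finite_height_le B : finite_set (height_le h B).
Proof.
have [B0|B0] := leP 0 B; first exact: height_finite.
apply: (sub_finite_set _ (@finite_set0 Omega)) => a /= /le_lt_trans /(_ B0).
by rewrite ltNge h_ge0.
Qed.

Lemma mem_height_le B a : (a \in fset_set (height_le h B)) = (h a <= B).
Proof.
rewrite in_fset_set; last exact: finite_height_le.
by apply/idP/idP => [/set_mem|ha]; [|exact: mem_set].
Qed.

Lemma set_card_avg B (P : set Omega) (b : Omega -> bool) : (forall a, P a <-> b a) ->
  (set_card [set a | h a <= B /\ P a])%:R / (height_count h B)%:R
  = avg B (fun a => (b a)%:R).
Proof.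
move=> Pb; rewrite /avg; congr (_ / _).
have fin : finite_set [set a | h a <= B /\ P a].
  by apply: sub_finite_set (finite_height_le B) => a [].
have -> : \sum_(a <- fset_set (height_le h B)) (b a)%:R =
    (count b (fset_set (height_le h B)))%:R :> R.
  by rewrite -sum1_count natr_sum [RHS]big_mkcond/=; apply: eq_bigr => a _; case: (b a).
congr _%:R; rewrite /set_card -size_filter; apply/perm_size/uniq_perm; rewrite ?filter_uniq ?fset_uniq// => a.
rewrite mem_filter mem_height_le in_fset_set//.
apply/idP/idP => [/set_mem[-> /Pb ->]//|/andP[ba ha]].
by apply/mem_set; split=> //; apply/Pb.
Qed.

Lemma near_height_count : \forall B \near +oo, (0 < height_count h B)%N.
Proof.
near=> B; rewrite /height_count /set_card cardfs_gt0; apply/fset0Pn.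
by exists (point : Omega); rewrite mem_height_le; near: B; apply: nbhs_pinfty_ge; exact: num_real.
Unshelve. all: by end_near. Qed.

Lemma avg_cst B c : (0 < height_count h B)%N -> avg B (fun=> c) = c.
Proof.
move=> N0; rewrite /avg big_const_seq count_predT iter_addr_0.
rewrite -[size _]/(height_count h B) -[c *+ _]mulr_natr mulfK//.
by rewrite pnatr_eq0 -lt0n.
Qed.

Lemma expectation_prob_height B u : (0 < height_count h B)%N ->
  ('E_(prob_height h B)[u] = (avg B u)%:E)%E.
Proof.
move=> N0.
pose s := fset_set (height_le h B).
pose N := height_count h B.
have Ni : 0 <= N%:R^-1 :> R by rewrite invr_ge0.
(* The conditioned counting measure is written as a finite sum of scaled Dirac masses, so that
   integrals become sums. *)
pose D (k : nat) : {measure set (discrete_space Omega) -> \bar R} :=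
  mscale (NngNum Ni) (dirac (nth point s k : discrete_space Omega)).
have ne0 : height_le h B !=set0.
  by move: N0; rewrite cardfs_gt0 => /fset0Pn[a]; rewrite mem_height_le; exists a.
have avgE v : avg B v = \sum_(k < N) N%:R^-1 * v (nth point s k).
  by rewrite /avg mulrC mulr_sumr (big_nth point) big_mkord.
have PE (U : set Omega) : prob_height h B U = msum D N U.
  rewrite prob_heightE//; last exact: finite_height_le.
  rewrite (_ : [set a | _] = [set a | h a <= B /\ U a]); last first.
    by apply/seteqP; split=> a [].
  rewrite (@set_card_avg B U (fun a => a \in U)); last first.
    by move=> a; split=> [/mem_set|/set_mem].
  rewrite avgE /msum -sumEFin; apply: eq_bigr => k _.
  by rewrite EFinM.
have mf (f : discrete_space Omega -> \bar R) : measurable_fun setT f by [].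
have ge0E (f : discrete_space Omega -> \bar R) : (forall a, 0 <= f a)%E ->
    (\int[prob_height h B]_a f a = \sum_(k < N) (N%:R^-1)%:E * f (nth point s k))%E.
  move=> f0.
  transitivity (\int[msum D N]_a f a)%E.
    by apply: eq_measure_integral => U mU _; exact: PE.
  rewrite ge0_integral_measure_sum//; apply: eq_bigr => k _.
  by rewrite ge0_integral_mscale//= integral_dirac// diracT mul1e.
rewrite unlock integralE !ge0E//.
under eq_bigr do rewrite funeposE -EFin_max -EFinM.
under [X in (_ - X)%E]eq_bigr do rewrite funenegE -EFinN -EFin_max -EFinM.
rewrite !sumEFin -EFinB avgE -sumrB; congr EFin; apply: eq_bigr => k _.
rewrite -mulrBr; congr (_ * _).
set x := u _; have [x0|x0] := leP 0 x.
  by rewrite max_r ?oppr_le0// subr0.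
by rewrite max_l ?oppr_ge0 ?(ltW x0)// sub0r opprK.
Qed.

End average.

(** * Functions of finitely many divisibilities and their limit mean *)

Section finite_dependence.
Context {R : realType} {n : nat} {Omega : pointedType}.
Variables (A : R) (h : Omega -> R) (m : Omega -> {ffun 'I_n -> nat}).
Implicit Types (d e : {ffun 'I_n -> nat}) (u v : Omega -> R) (s : seq nat).

Definition div_ind d (a : Omega) : bool := [forall i, d i %| m a i]%N.

Definition admissible s := forall p, p \in s -> prime p /\ A < p%:R.

Definition supported s d :=
  pos_vec d /\ forall p i, prime p -> (p %| d i)%N -> p \in s.

Definition depends_on s u := forall a b,
  (forall p i, p \in s -> (p %| m a i)%N = (p %| m b i)%N) -> u a = u b.

(** Combinations of divisibility indicators are the functions whose averages converge directly by
    the definition of [g]. *)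
Definition span s u := exists l : seq (R * {ffun 'I_n -> nat}),
  (forall c, c \in l -> supported s c.2) /\
  forall a, u a = \sum_(c <- l) c.1 * (div_ind c.2 a)%:R.

Lemma span_cst s c : span s (fun=> c).
Proof.
exists [:: (c, [ffun=> 1%N])]; split=> [x|a]; last first.
  rewrite big_seq1/= (_ : div_ind _ _) ?mulr1//.
  by apply/forallP => i; rewrite ffunE dvd1n.
rewrite inE => /eqP ->; split=> [i|p i pp]; rewrite ffunE//.
by rewrite dvdn1 => /eqP p1; rewrite p1 in pp.
Qed.

Lemma spanD s u v : span s u -> span s v -> span s (fun a => u a + v a).
Proof.
move=> [l [ls lE]] [l' [ls' lE']]; exists (l ++ l'); split=> [c|a].
  by rewrite mem_cat => /orP[/ls|/ls'].
by rewrite big_cat lE lE'.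
Qed.

Lemma spanN s u : span s u -> span s (fun a => - u a).
Proof.
move=> [l [ls lE]]; exists [seq (- c.1, c.2) | c <- l]; split=> [c|a].
  by move=> /mapP[c' /ls ? ->].
by rewrite big_map lE -sumrN; apply: eq_bigr => c _; rewrite mulNr.
Qed.

Lemma span_ind s u p i : prime p -> p \in s -> span s u ->
  span s (fun a => (p %| m a i)%N%:R * u a).
Proof.
move=> pp ps [l [ls lE]].
(* The least common multiple, not the product: [p] may already divide the entry. *)
pose ext d : {ffun 'I_n -> nat} := [ffun k => if k == i then lcmn (d k) p else d k].
exists [seq (c.1, ext c.2) | c <- l]; split=> [c /mapP[c' /ls [c0 cs] ->]|a].
  split=> [k|q k qq]; rewrite ffunE; case: eqP => // _.
  - by rewrite lcmn_gt0 c0 prime_gt0.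
  - move=> qd; have : (q %| c'.2 k * p)%N.
      by apply: dvdn_trans qd _; rewrite dvdn_lcm dvdn_mulr ?dvdn_mull.
    rewrite Euclid_dvdM// => /orP[/(cs _ _ qq)//|].
    by rewrite dvdn_prime2// => /eqP ->.
  - exact: cs.
rewrite big_map lE mulr_sumr; apply: eq_bigr => c _ /=; rewrite mulrCA -natrM mulnb.
congr (_ * _%:R); apply: congr1; apply/andP/forallP => [[pa /forallP da] k|da].
  by rewrite ffunE; case: eqP => [->|//]; rewrite dvdn_lcm da.
split; first by have := da i; rewrite ffunE eqxx dvdn_lcm => /andP[].
apply/forallP => k; have := da k; rewrite ffunE; case: eqP => // _.
by rewrite dvdn_lcm => /andP[].
Qed.

(** Case analysis on one condition [p %| m a i] at a time: [v] is the indicator times a difference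
    of two functions of the remaining conditions, plus one of these functions. *)
Lemma depends_on_span s u : admissible s -> depends_on s u -> span s u.
Proof.
move=> adm.
pose agree (l : seq (nat * 'I_n)) (a b : Omega) :=
  forall x, x \in l -> (x.1 %| m a x.2)%N = (x.1 %| m b x.2)%N.
suff H (l : seq (nat * 'I_n)) : (forall x, x \in l -> x.1 \in s) ->
    forall v, (forall a b, agree l a b -> v a = v b) -> span s v.
  move=> du; apply: (H [seq (p, i) | p <- s, i <- enum 'I_n]).
    by move=> _ /allpairsP[[p i] /= [ps _ ->]].
  move=> a b ab; apply: du => p i ps; apply: (ab (p, i)).
  by apply/allpairsP; exists (p, i); rewrite /= mem_enum.
elim: l => [|[p i] l IH] ls v vd.
  have -> : v = fun=> v point by apply/funext => a; apply: vd.
  exact: span_cst.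
have ps : p \in s by apply: (ls (p, i)); rewrite inE eqxx.
have ls' x : x \in l -> x.1 \in s by move=> xl; apply: ls; rewrite inE xl orbT.
(* [w c] evaluates [v] at a representative with the same remaining divisibilities and truth value
   [c]. If there is none, [get] returns a default, which is harmless: in the branch relevant to [a],
   the point [a] itself is a candidate. *)
pose w (c : bool) (a : Omega) :=
  v (get [set b | agree l a b /\ (p %| m b i)%N = c]).
have wd c a b : agree l a b -> w c a = w c b.
  move=> ab; rewrite /w; congr (v (get _)); apply/seteqP; split=> x /= [ax cx]; split=> // y yl.
    by rewrite -ab// ax.
  by rewrite ab// ax.
have vw a : v a = w (p %| m a i)%N a.
  rewrite /w; have [//|] := getPex (P := [set b | agree l a b /\ (p %| m b i)%N = (p %| m a i)%N]).
    by exists a.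
  move=> ab pb; apply: vd => x; rewrite inE => /predU1P[->//|]; exact: ab.
have -> : v = fun a => (p %| m a i)%N%:R * (w true a + - w false a) + w false a.
  apply/funext => a; rewrite {1}vw; case: (p %| m a i)%N; first by rewrite mul1r subrK.
  by rewrite mul0r add0r.
have [pp _] := adm _ ps.
apply: spanD; last by apply: IH => // a b; exact: wd.
apply: span_ind => //; apply: spanD; first by apply: IH => // a b; exact: wd.
by apply: spanN; apply: IH => // a b; exact: wd.
Qed.

Lemma depends_on_sub s s' u : {subset s <= s'} -> depends_on s u -> depends_on s' u.
Proof. by move=> ss du a b ab; apply: du => p i ps; apply: ab; exact: ss. Qed.

Lemma depends_on2 s u v (f : R -> R -> R) : depends_on s u -> depends_on s v ->
  depends_on s (fun a => f (u a) (v a)).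
Proof. by move=> du dv a b ab; rewrite (du _ _ ab) (dv _ _ ab). Qed.

Lemma depends_on1 s u (f : R -> R) : depends_on s u -> depends_on s (fun a => f (u a)).
Proof. by move=> du a b ab; rewrite (du _ _ ab). Qed.

Variable g : {ffun 'I_n -> nat} -> R.
Hypothesis height_finite : forall B : R, 0 <= B -> finite_set [set a | h a <= B].
Hypothesis h_ge0 : forall a, 0 <= h a.
Hypothesis g_lim : forall d, pos_vec d -> rough A d ->
    (div_count h m d B)%:R / (height_count h B)%:R @[B --> +oo] --> g d.
Hypothesis g_mul : forall a b, pos_vec a -> pos_vec b -> rough A a -> rough A b ->
    coprime (\prod_i a i) (\prod_i b i) -> g (vec_mul a b) = g a * g b.

Lemma supported_rough s d : admissible s -> supported s d -> rough A d.
Proof.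
move=> adm [d0 ds] p pp; rewrite Euclid_dvd_prod//.
rewrite big_has => /hasP[i _ pd].
by have [] := adm p (ds _ _ pp pd).
Qed.

Lemma avg_div_ind d B : avg h B (fun a => (div_ind d a)%:R) =
  (div_count h m d B)%:R / (height_count h B)%:R.
Proof.
rewrite -(@set_card_avg R Omega h height_finite h_ge0 B
  [set a | forall i, (d i %| m a i)%N] (div_ind d))// => a.
by split=> [H|/forallP//]; apply/forallP.
Qed.

(** Defined as a limit of averages instead of through [g], so that positivity is inherited; the
    limit exists for functions of finitely many divisibilities by admissible primes. *)
Definition mean u : R := lim (avg h B u @[B --> +oo]).

Lemma cvg_avg_sum s (l : seq (R * {ffun 'I_n -> nat})) : admissible s ->
  (forall c, c \in l -> supported s c.2) ->
  avg h B (fun a => \sum_(c <- l) c.1 * (div_ind c.2 a)%:R) @[B --> +oo] -->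
    \sum_(c <- l) c.1 * g c.2.
Proof.
move=> adm; elim: l => [|c l IH] ls.
  rewrite big_nil; under eq_fun => B.
    rewrite (_ : (fun a => _) = fun=> 0); last by apply/funext => a; rewrite big_nil.
    rewrite avg0; over.
  exact: cvg_cst.
rewrite big_cons; under eq_fun => B.
  rewrite (_ : (fun a => _) = fun a => c.1 * (div_ind c.2 a)%:R +
    \sum_(c <- l) c.1 * (div_ind c.2 a)%:R); last by apply/funext => a; rewrite big_cons.
  rewrite avgD avgZ avg_div_ind; over.
have [c0 cs] : supported s c.2 by apply: ls; rewrite inE eqxx.
apply: cvgD; last by apply: IH => x xl; apply: ls; rewrite inE xl orbT.
apply: cvgM; first exact: cvg_cst.
by apply: g_lim => //; exact: supported_rough (conj c0 cs).
Qed.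

Lemma mean_sum s (l : seq (R * {ffun 'I_n -> nat})) : admissible s ->
  (forall c, c \in l -> supported s c.2) ->
  mean (fun a => \sum_(c <- l) c.1 * (div_ind c.2 a)%:R) = \sum_(c <- l) c.1 * g c.2.
Proof. by move=> adm ls; apply/cvg_lim => //; exact: cvg_avg_sum adm ls. Qed.

Lemma cvg_mean s u : admissible s -> depends_on s u ->
  avg h B u @[B --> +oo] --> mean u.
Proof.
move=> adm /(depends_on_span adm)[l [ls /funext ->]].
by rewrite (mean_sum adm ls); exact: cvg_avg_sum adm ls.
Qed.

Lemma mean_div_ind s d : admissible s -> supported s d ->
  mean (fun a => (div_ind d a)%:R) = g d.
Proof.
move=> adm ds; have := @mean_sum s [:: (1, d)] adm.
rewrite big_seq1 mul1r (_ : (fun a => _) = fun a => (div_ind d a)%:R); last first.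
  by apply/funext => a; rewrite big_seq1 mul1r.
by apply => c; rewrite inE => /eqP ->.
Qed.

Lemma mean_cst c : mean (fun=> c) = c.
Proof.
apply/cvg_lim => //; suff : avg h B (fun=> c) @[B --> +oo] --> c by [].
apply: (cvg_trans _ (@cvg_cst _ c _ (+oo : set_system R) _)); apply: near_eq_cvg.
have := near_height_count height_finite h_ge0.
by apply: filterS => B N0; rewrite avg_cst.
Qed.

Lemma meanD s u v : admissible s -> depends_on s u -> depends_on s v ->
  mean (fun a => u a + v a) = mean u + mean v.
Proof.
move=> adm du dv; apply/cvg_lim => //.
under eq_fun do rewrite avgD.
by apply: cvgD; exact: cvg_mean adm _.
Qed.

Lemma meanZ s c u : admissible s -> depends_on s u ->
  mean (fun a => c * u a) = c * mean u.
Proof.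
move=> adm du; apply/cvg_lim => //.
under eq_fun do rewrite avgZ.
by apply: cvgM; [exact: cvg_cst|exact: cvg_mean adm du].
Qed.

Lemma meanB s u v : admissible s -> depends_on s u -> depends_on s v ->
  mean (fun a => u a - v a) = mean u - mean v.
Proof.
move=> adm du dv; rewrite (meanD adm du); last exact: (depends_on1 (fun x => - x)).
congr (_ + _); rewrite -mulN1r -(meanZ (-1) adm dv); congr mean.
by apply/funext => a; rewrite mulN1r.
Qed.

Lemma ler_mean s u v : admissible s -> depends_on s u -> depends_on s v ->
  (forall a, u a <= v a) -> mean u <= mean v.
Proof.
move=> adm du dv uv; apply: ler_cvg_to (cvg_mean adm du) (cvg_mean adm dv) _.
by apply: nearW => B; exact: ler_avg.
Qed.

Lemma norm_mean_le s u v : admissible s -> depends_on s u -> depends_on s v ->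
  (forall a, `|u a| <= v a) -> `|mean u| <= mean v.
Proof.
move=> adm du dv uv; rewrite ler_norml -lerN2 opprK.
have -> : - mean u = mean (fun a => -1 * u a) by rewrite (meanZ _ adm du) mulN1r.
have dNu : depends_on s (fun a => -1 * u a) by exact: (depends_on1 (fun x => -1 * x)).
apply/andP; split; apply: (ler_mean adm) => // a; last first.
  by have := uv a; rewrite ler_norml => /andP[].
by have := uv a; rewrite mulN1r ler_norml lerNl => /andP[].
Qed.

Lemma mean_linear s (I : eqType) (r : seq I) (F : I -> Omega -> R) : admissible s ->
  (forall i, i \in r -> depends_on s (F i)) ->
  mean (fun a => \sum_(i <- r) F i a) = \sum_(i <- r) mean (F i).
Proof.
move=> adm; elim: r => [|i r IH] dF.
  rewrite big_nil (_ : (fun a => _) = fun=> 0) ?mean_cst//.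
  by apply/funext => a; rewrite big_nil.
rewrite big_cons -IH; last by move=> j jr; apply: dF; rewrite inE jr orbT.
rewrite -(meanD adm); first by congr mean; apply/funext => a; rewrite big_cons.
  by apply: dF; rewrite inE eqxx.
move=> a b ab; rewrite big_seq [RHS]big_seq; apply: eq_bigr => j jr.
by apply: dF ab; rewrite inE jr orbT.
Qed.

Lemma supported_coprime s s' d e : supported s d -> supported s' e ->
  {in s, forall p, p \notin s'} -> forall i j, coprime (d i) (e j).
Proof.
move=> [d0 ds] [e0 es] ss' i j; rewrite /coprime; apply/eqP/eqP.
rewrite eqn_leq gcdn_gt0 d0 andbT leqNgt; apply/negP => g1.
have pp := pdiv_prime g1; have pg := pdiv_dvd (gcdn (d i) (e j)).
have := ss' _ (ds _ i pp (dvdn_trans pg (dvdn_gcdl _ _))).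
by rewrite (es _ j pp (dvdn_trans pg (dvdn_gcdr _ _))).
Qed.

Lemma div_ind_vec_mul s s' d e a : supported s d -> supported s' e ->
  {in s, forall p, p \notin s'} ->
  div_ind (vec_mul d e) a = div_ind d a && div_ind e a.
Proof.
move=> sd se ss'; have cde := supported_coprime sd se ss'.
apply/forallP/andP => [H|[/forallP H1 /forallP H2] i].
  by split; apply/forallP => i; have := H i; rewrite ffunE Gauss_dvd// => /andP[].
by rewrite ffunE Gauss_dvd// H1 H2.
Qed.

(** The source of independence: disjoint sets of primes give coprime vectors, for which the product
    of two indicators is the indicator of [vec_mul] and [g] is multiplicative. *)
Lemma mean_indep s s' u v : admissible s -> admissible s' ->
  {in s, forall p, p \notin s'} -> depends_on s u -> depends_on s' v ->
  mean (fun a => u a * v a) = mean u * mean v.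
Proof.
move=> adm adm' ss' /(depends_on_span adm)[l [ls /funext ->]].
move=> /(depends_on_span adm')[l' [ls' /funext ->]].
rewrite (mean_sum adm ls) (mean_sum adm' ls').
have admc : admissible (s ++ s').
  by move=> p; rewrite mem_cat => /orP[/adm|/adm'].
pose ll := [seq (c.1 * c'.1, vec_mul c.2 c'.2) | c <- l, c' <- l'].
have sll c : c \in ll -> supported (s ++ s') c.2.
  move=> /allpairsP[[c1 c2] /= [/ls [d0 ds] /ls' [e0 es] ->]] /=; split=> [i|p i pp].
    by rewrite ffunE muln_gt0 d0 e0.
  rewrite ffunE Euclid_dvdM// mem_cat => /orP[/(ds _ _ pp) -> //|/(es _ _ pp) ->].
  by rewrite orbT.
transitivity (mean (fun a => \sum_(c <- ll) c.1 * (div_ind c.2 a)%:R)).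
  congr mean; apply/funext => a; rewrite big_allpairs_dep/= mulr_suml.
  rewrite big_seq [RHS]big_seq; apply: eq_bigr => c cl.
  rewrite mulr_sumr big_seq [RHS]big_seq; apply: eq_bigr => c' cl'.
  by rewrite (div_ind_vec_mul a (ls _ cl) (ls' _ cl') ss') -mulnb natrM mulrACA.
rewrite (mean_sum admc sll) big_allpairs_dep/= mulr_suml.
rewrite big_seq [RHS]big_seq; apply: eq_bigr => c cl.
rewrite mulr_sumr big_seq [RHS]big_seq; apply: eq_bigr => c' cl'.
have [sc sc'] := (ls _ cl, ls' _ cl').
have -> : g (vec_mul c.2 c'.2) = g c.2 * g c'.2; last exact: mulrACA.
have [[c0 _] [c'0 _]] := (sc, sc').
apply: g_mul c0 c'0 (supported_rough adm sc) (supported_rough adm' sc') _.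
elim/big_rec: _ => [|i x _ cx]; first exact: coprime1n.
rewrite coprimeMl cx andbT; elim/big_rec: _ => [|j y _ cy]; first exact: coprimen1.
by rewrite coprimeMr cy andbT; exact: supported_coprime sc sc' ss' i j.
Qed.

End finite_dependence.
Lemma dvdn_prod_coprime (T : eqType) (r : seq T) (P : pred T) (p : T -> nat) M :
  uniq r -> {in r &, forall x y, P x -> P y -> x != y -> coprime (p x) (p y)} ->
  (\prod_(x <- r | P x) p x %| M)%N = all (fun x => P x ==> (p x %| M)%N) r.
Proof.
elim: r => [|x r IH] /=; first by rewrite big_nil dvd1n.
move=> /andP[xr ur] co; rewrite big_cons; case: ifP => Px; last first.
  by rewrite IH//= => y z yr zr; apply: co; rewrite inE ?yr ?zr orbT.
rewrite Gauss_dvd; first by rewrite /= IH// => y z yr zr; apply: co; rewrite inE ?yr ?zr orbT.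
rewrite big_seq_cond; elim/big_rec: _ => [|y z /andP[yr Py] cz]; first exact: coprimen1.
rewrite coprimeMr cz andbT; apply: co => //; rewrite ?inE ?eqxx ?yr ?orbT//.
by apply: contraNneq xr => ->.
Qed.

Lemma ler_sum_sub_seq (R : numDomainType) (T : eqType) (D E : seq T) (F : T -> R) :
  uniq D -> uniq E -> {subset D <= E} -> (forall x, 0 <= F x) ->
  \sum_(x <- D) F x <= \sum_(x <- E) F x.
Proof.
move=> uD uE DE F0; rewrite (perm_big [seq x <- E | x \in D]) /=.
  rewrite big_filter [leLHS]big_mkcond/=; apply: ler_sum => x _.
  by case: ifP.
apply: uniq_perm => //; first exact: filter_uniq.
by move=> x; rewrite mem_filter; case: (boolP (x \in D)) => //= /DE.
Qed.

(** * Moments and the level of distribution *)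

Section moments.
Context {R : realType} {n : nat} {Omega : pointedType}.
Variables (A : R) (h : Omega -> R) (m : Omega -> {ffun 'I_n -> nat}).
Variable g : {ffun 'I_n -> nat} -> R.
Hypothesis height_finite : forall B : R, 0 <= B -> finite_set [set a | h a <= B].
Hypothesis h_ge0 : forall a, 0 <= h a.
Hypothesis g_lim : forall d, pos_vec d -> rough A d ->
    (div_count h m d B)%:R / (height_count h B)%:R @[B --> +oo] --> g d.

Variable s : seq nat.
Hypothesis adm : admissible A s.
Hypothesis us : uniq s.

Local Notation T := ('I_(size s) * 'I_n)%type.
Implicit Types (x y : T) (Q : {set T}).

Definition prime_at x : nat := nth 0%N s x.1.

Lemma prime_at_in x : prime_at x \in s.
Proof. exact: mem_nth. Qed.

Lemma prime_prime_at x : prime (prime_at x).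
Proof. by have [] := adm (prime_at_in x). Qed.

Lemma prime_at_inj x y : prime_at x = prime_at y -> x.2 = y.2 -> x = y.
Proof.
case: x y => [x i] [y j] /eqP; rewrite nth_uniq// => /eqP xy /= ->.
by congr (_, _); apply/val_inj.
Qed.

(** Sets of pairs (prime, coordinate) encode the vectors with squarefree entries composed of primes
    of [s]. A product of divisibility indicators then depends only on the set of pairs involved. *)
Definition set_vec Q : {ffun 'I_n -> nat} :=
  [ffun i => \prod_(x in Q | x.2 == i) prime_at x].

Lemma dvdn_set_vec Q i M :
  (set_vec Q i %| M)%N = [forall x in Q, (x.2 == i) ==> (prime_at x %| M)%N].
Proof.
rewrite ffunE dvdn_prod_coprime ?index_enum_uniq//.
  apply/allP/forallP => [H x|H x _].
    by have := H x (mem_index_enum x); case: (x \in Q).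
  by have := H x; case: (x \in Q).
move=> x y _ _ /andP[_ /eqP xi] /andP[_ /eqP yi] xy.
rewrite prime_coprime ?prime_prime_at// dvdn_prime2 ?prime_prime_at//.
by apply: contra xy => /eqP /prime_at_inj ->//; rewrite xi yi.
Qed.

Lemma prime_dvdn_set_vec Q q i : prime q -> (q %| set_vec Q i)%N ->
  exists2 x, x \in Q /\ x.2 = i & q = prime_at x.
Proof.
move=> qq; rewrite ffunE Euclid_dvd_prod// big_has_cond => /hasP[x _] /=.
rewrite dvdn_prime2 ?prime_prime_at// => /andP[/andP[xQ /eqP xi] /eqP ->].
by exists x.
Qed.

Lemma mem_set_vec Q x : (x \in Q) = (prime_at x %| set_vec Q x.2)%N.
Proof.
apply/idP/idP => [xQ|/(prime_dvdn_set_vec (prime_prime_at x))[y [yQ yx] xy]].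
  by rewrite ffunE (bigD1 x)/= ?xQ ?eqxx// dvdn_mulr.
by rewrite (prime_at_inj xy).
Qed.

Lemma set_vec_inj : injective set_vec.
Proof. by move=> Q Q' E; apply/setP => x; rewrite !mem_set_vec E. Qed.

Lemma supported_set_vec Q : supported s (set_vec Q).
Proof.
split=> [i|q i qq /(prime_dvdn_set_vec qq)[x _ ->]]; last exact: prime_at_in.
by rewrite ffunE; apply: prodn_cond_gt0 => x _; exact/prime_gt0/prime_prime_at.
Qed.

(** The entries are squarefree, so these vectors carry weight 1 in the level of distribution. *)
Lemma mobius_set_vec Q i : (mobius (set_vec Q i))%:~R ^+ 2 = 1 :> R.
Proof.
rewrite /mobius; case: ifP => [_|/negP[]].
  by rewrite rmorphXn/= rmorphN1 sqrr_sign.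
have d0 : (0 < set_vec Q i)%N by case: (supported_set_vec Q).
apply/allP => q; rewrite mem_primes => /and3P[qq _ qd].
have [x [xQ xi] qx] := prime_dvdn_set_vec qq qd.
rewrite ffunE (bigD1 x)/= ?xQ ?xi ?eqxx//.
rewrite lognM; [|exact/prime_gt0/prime_prime_at|]; last first.
  by apply: prodn_cond_gt0 => y _; exact/prime_gt0/prime_prime_at.
rewrite qx logn_prime ?prime_prime_at// eqxx; apply/eqP; congr _.+1.
rewrite logn_coprime// prime_coprime ?prime_prime_at// Euclid_dvd_prod ?prime_prime_at//.
rewrite big_has_cond; apply/hasPn => y _ /=; rewrite dvdn_prime2 ?prime_prime_at//.
apply/negP => /andP[/andP[/andP[yQ /eqP yi] yx] /eqP xy].
by move: yx; rewrite (prime_at_inj xy) ?eqxx// yi.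
Qed.

Lemma set_vec_le Q (y : R) i : 1 <= y -> (forall p, p \in s -> p%:R <= y) ->
  (set_vec Q i)%:R <= y ^+ #|Q|.
Proof.
move=> y1 sy; rewrite ffunE natr_prod.
rewrite -prodr_const [leLHS]big_mkcondr/=; apply: ler_prod => x xQ.
by case: ifP => _; rewrite ?ler01 ?y1// ler0n sy// prime_at_in.
Qed.

Lemma div_ind_set_vec Q a :
  div_ind m (set_vec Q) a = [forall x in Q, (prime_at x %| m a x.2)%N].
Proof.
apply/forallP/forallP => [H x|H i].
  apply/implyP => xQ; have := H x.2; rewrite dvdn_set_vec => /forallP /(_ x).
  by rewrite xQ eqxx.
rewrite dvdn_set_vec; apply/forallP => x; apply/implyP => xQ; apply/implyP => /eqP <-.
by have := H x; rewrite xQ.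
Qed.

Variable w : T -> R.
Variable W : R.
Hypothesis W0 : 0 <= W.
Hypothesis wW : forall x, `|w x| <= W.

Definition weighted_sum (a : Omega) : R :=
  \sum_x w x * (prime_at x %| m a x.2)%N%:R.

(** Indicators are idempotent, so in the expanded power the term of [f] involves only the image of
    [f]. *)
Lemma weighted_sum_expE j a : weighted_sum a ^+ j =
  \sum_(f : {ffun 'I_j -> T}) (\prod_k w (f k)) * (div_ind m (set_vec [set f k | k : 'I_j]) a)%:R.
Proof.
rewrite -[in LHS](card_ord j) -prodr_const bigA_distr_bigA/=.
apply: eq_bigr => f _; rewrite big_split/=; congr (_ * _).
rewrite div_ind_set_vec.
case: forallP => [H|H].
  rewrite big1// => k _; have := H (f k); rewrite imset_f// => /= ->//.
have [k kf] : exists k, ~~ (prime_at (f k) %| m a (f k).2)%N.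
  apply/existsP; rewrite -negb_forall; apply/negP => /forallP H'; apply: H => x.
  by apply/implyP => /imsetP[k _ ->].
by rewrite (bigD1 k)//= (negbTE kf) mul0r.
Qed.

Lemma avg_sub_mean_div_ind Q B : (0 < height_count h B)%N ->
  avg h B (fun a => (div_ind m (set_vec Q) a)%:R) - mean h (fun a => (div_ind m (set_vec Q) a)%:R)
  = remainder h m g (set_vec Q) B / (height_count h B)%:R.
Proof.
move=> N0; rewrite (avg_div_ind _ height_finite h_ge0).
rewrite (mean_div_ind height_finite h_ge0 g_lim adm (supported_set_vec Q)).
by rewrite /remainder mulrBl mulfK// pnatr_eq0 -lt0n.
Qed.

Lemma depends_on_set_vec Q :
  depends_on m s (fun a => (div_ind m (set_vec Q) a)%:R : R).
Proof.
move=> a b ab; congr (nat_of_bool _)%:R; rewrite !div_ind_set_vec.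
by apply: eq_forallb => x; rewrite ab// prime_at_in.
Qed.

(** The maps are grouped by their image [Q]. At most [#|Q| ^ j <= j ^ j] of them share one, so each
    remainder is counted a number of times independent of [s]. *)
Lemma weighted_sum_moment j B : (0 < height_count h B)%N ->
  `|avg h B (fun a => weighted_sum a ^+ j) - mean h (fun a => weighted_sum a ^+ j)|
  <= W ^+ j * (j ^ j)%:R *
    ((\sum_(Q : {set T} | (#|Q| <= j)%N) `|remainder h m g (set_vec Q) B|)
      / (height_count h B)%:R).
Proof.
move=> N0; pose im (f : {ffun 'I_j -> T}) := [set f k | k : 'I_j].
pose F (f : {ffun 'I_j -> T}) a := (\prod_k w (f k)) * (div_ind m (set_vec (im f)) a)%:R.
have E : (fun a => weighted_sum a ^+ j) = (fun a => \sum_f F f a).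
  by apply/funext => a; rewrite weighted_sum_expE.
have dF := depends_on_set_vec.
rewrite E avg_sum (mean_linear height_finite h_ge0 g_lim adm); last first.
  by move=> f _ a b ab; rewrite /F (dF _ _ _ ab).
rewrite -sumrB; apply: le_trans (ler_norm_sum _ _ _) _.
have le f : `|avg h B (F f) - mean h (F f)| <=
    W ^+ j * (`|remainder h m g (set_vec (im f)) B| / (height_count h B)%:R).
  rewrite /F avgZ (meanZ height_finite h_ge0 g_lim _ adm (dF _)) -mulrBr.
  rewrite avg_sub_mean_div_ind// normrM normf_div (ger0_norm (ler0n _ _)).
  rewrite ler_wpM2r ?divr_ge0// normr_prod -[in leRHS](card_ord j) -prodr_const.
  by apply: ler_prod => k _; rewrite normr_ge0 wW.
apply: le_trans (ler_sum _ (fun f _ => le f)) _.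
rewrite -mulr_sumr -mulrA.
have Wj : 0 <= W ^+ j * (j ^ j)%:R by rewrite mulr_ge0// exprn_ge0.
rewrite ler_wpM2l ?exprn_ge0// -mulr_suml mulrA ler_wpM2r ?invr_ge0//.
rewrite (partition_big im (fun Q => (#|Q| <= j)%N)) /=; last first.
  by move=> f _; rewrite -[leqRHS](card_ord j) leq_imset_card.
rewrite mulr_sumr; apply: ler_sum => Q Qj.
rewrite (eq_bigr (fun=> `|remainder h m g (set_vec Q) B|)); last by move=> f /eqP ->.
rewrite sumr_const -[leLHS]mulr_natl ler_wpM2r// ler_nat.
apply: (@leq_trans (#|Q| ^ j)%N); last first.
  by case: (posnP j) => [->//|j0]; rewrite leq_exp2r.
rewrite -[j in (_ ^ j)%N](card_ord j) -card_ffun_on; apply: subset_leq_card; apply/fintype.subsetP => f.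
move=> fQ; have /eqP <- : im f == Q := fQ.
by apply/ffun_onP => k; exact: imset_f.
Qed.

(** Distinct sets give distinct squarefree vectors, with entries at most [y ^ j], so the left side
    is part of the sum controlled by the level of distribution. *)
Lemma sum_remainder_le j B (X y : R) : 1 <= y -> (forall p, p \in s -> p%:R <= y) ->
  y ^+ j <= X ->
  \sum_(Q : {set T} | (#|Q| <= j)%N) `|remainder h m g (set_vec Q) B| <=
  \sum_(d \in [set d : {ffun 'I_n -> nat} |
      [/\ pos_vec d, (\max_i d i)%:R <= X & rough A d]])
         (\prod_i (mobius (d i))%:~R ^+ 2) * `|remainder h m g d B|.
Proof.
move=> y1 sy yX; set LS := [set d | _].
(* Finiteness is what lets the sum over the set [LS] be unfolded into a sum over a list. *)
have finLS : finite_set LS.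
  pose N := (Num.truncn X).+1.
  apply: (@sub_finite_set _ _ [set ([ffun i => nat_of_ord (f i)] : {ffun 'I_n -> nat}) |
    f in [set: {ffun 'I_n -> 'I_N}]]).
    move=> d /= [_ dX _]; have dN i : (d i < N)%N.
      rewrite /N ltnS -ltnS -(ltr_nat R).
      apply: le_lt_trans (truncnS_gt X); apply: le_trans dX.
      by rewrite ler_nat; apply: leq_bigmax.
    exists [ffun i => Ordinal (dN i)] => //.
    by apply/ffunP => i; rewrite !ffunE.
  exact/finite_image/finite_finset.
rewrite fsbig_finite//=.
pose D := [seq set_vec Q | Q <- enum [pred Q : {set T} | (#|Q| <= j)%N]].
apply: le_trans (_ : \sum_(d <- D) (\prod_i (mobius (d i))%:~R ^+ 2) * `|remainder h m g d B| <= _).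
  rewrite big_map big_enum/= le_eqVlt; apply/orP; left; apply/eqP.
  apply: eq_bigr => Q _; rewrite big1 ?mul1r// => i _; exact: mobius_set_vec.
apply: ler_sum_sub_seq.
- by rewrite map_inj_uniq ?enum_uniq//; exact: set_vec_inj.
- exact: fset_uniq.
- move=> d /mapP[Q]; rewrite mem_enum inE => Qj ->.
  rewrite in_fset_set// inE; split.
  + by case: (supported_set_vec Q).
  + apply: le_trans yX; have ge1 : 1 <= y ^+ j by rewrite exprn_ege1.
    elim/big_ind: _ => [|x z hx hz|i _]; first exact: le_trans ge1.
      by rewrite /maxn; case: ifP.
    by apply: le_trans (set_vec_le Q i y1 sy) _; rewrite ler_weXn2l.
  + exact: supported_rough adm (supported_set_vec Q).
- by move=> d; rewrite mulr_ge0// prodr_ge0// => i _; rewrite sqr_ge0.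
Qed.

End moments.
(** * The limiting model with independent primes *)

Section exponential_bounds.
Context {R : realType}.

Lemma expRN_sub1_sqr (x : R) : 0 <= x -> `|expR (- x) - (1 - x)| <= x ^+ 2.
Proof.
move=> x0; have h1 := expR_ge1Dx (- x); have h2 := expR_ge1Dx x.
rewrite ger0_norm; last by lra.
have : expR (- x) <= (1 + x)^-1.
  by rewrite expRN lef_pV2// posrE ?expR_gt0// ltr_wpDr.
move=> /le_trans h; rewrite lerBlDr; apply: h.
rewrite -[leLHS]mul1r ler_pdivrMr ?ltr_wpDr//.
have := mulr_ge0 x0 (sqr_ge0 x); nra.
Qed.

(** Squaring [exp (- x / 2) >= 1 - x / 2] bounds [exp x] by [(1 - x / 2) ^ -2], and [(1 + x + x ^ 2)
    (1 - x / 2) ^ 2 = 1 + x ^ 2 (1 - 3 x + x ^ 2) / 4]. The condition on [x] keeps [1 - 3 x]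
    nonnegative. *)
Lemma expR_le_quad (x : R) : `|x| <= 3^-1 -> expR x <= 1 + x + x ^+ 2.
Proof.
rewrite ler_norml => /andP[x0 x1].
have h : 0 < 1 - x / 2 by lra.
have e2 : expR (x / 2) <= (1 - x / 2)^-1.
  rewrite -[x / 2]opprK expRN opprK lef_pV2 ?posrE ?expR_gt0//.
  exact: expR_ge1Dx.
have -> : expR x = expR (x / 2) ^+ 2 by rewrite expr2 -expRD -splitr.
apply: (@le_trans _ _ ((1 - x / 2)^-1 ^+ 2)).
  by rewrite ler_sqr ?nnegrE ?expR_ge0// invr_ge0 ltW.
rewrite exprVn -[leLHS]mul1r ler_pdivrMr ?exprn_gt0//.
have xx : 0 <= x ^+ 2 * (1 - 3 * x + x ^+ 2).
  rewrite mulr_ge0 ?sqr_ge0//; have := sqr_ge0 x; lra.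
nra.
Qed.

Lemma exp_fact_le_expR (x : R) k : 0 <= x -> x ^+ k / k`!%:R <= expR x.
Proof.
move=> x0; case: k => [|k]; last by apply: le_trans (expR_ge1Dxn k x0); rewrite lerDr.
by rewrite expr0 fact0 divr1; apply: le_trans (expR_ge1Dx x); rewrite lerDl.
Qed.

End exponential_bounds.

Section model.
Context {R : realType} {n : nat} {Omega : pointedType}.
Variables (A : R) (h : Omega -> R) (m : Omega -> {ffun 'I_n -> nat}).
Variable g : {ffun 'I_n -> nat} -> R.
Hypothesis height_finite : forall B : R, 0 <= B -> finite_set [set a | h a <= B].
Hypothesis h_ge0 : forall a, 0 <= h a.
Hypothesis g_lim : forall d, pos_vec d -> rough A d ->
    (div_count h m d B)%:R / (height_count h B)%:R @[B --> +oo] --> g d.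
Hypothesis g_mul : forall a b, pos_vec a -> pos_vec b -> rough A a -> rough A b ->
    coprime (\prod_i a i) (\prod_i b i) -> g (vec_mul a b) = g a * g b.

Local Notation mean := (mean h).
Local Notation mean_le := (ler_mean height_finite h_ge0 g_lim).
Local Notation norm_mean := (norm_mean_le height_finite h_ge0 g_lim).
Local Notation mean1 := (mean_cst height_finite h_ge0).

Variable Y : nat -> Omega -> R.
Variable delta : R.
Hypothesis delta01 : 0 <= delta <= 1.
Implicit Types s : seq nat.

(** What a Lindeberg argument needs of the contribution of one prime: it depends on that prime
    alone, is centred and is uniformly small. *)
Definition local_terms s := forall p, p \in s ->
  [/\ depends_on m [:: p] (Y p), mean (Y p) = 0 & forall a, `|Y p a| <= delta].

Definition total s (a : Omega) : R := \sum_(p <- s) Y p a.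

Definition total_variance s : R := \sum_(p <- s) mean (fun a => Y p a ^+ 2).

Lemma local_terms_cons p s : local_terms (p :: s) -> local_terms s.
Proof. by move=> H q qs; apply: H; rewrite inE qs orbT. Qed.

Lemma admissible_cons p s : admissible A (p :: s) -> admissible A s.
Proof. by move=> H q qs; apply: H; rewrite inE qs orbT. Qed.

Lemma admissible_head p s : admissible A (p :: s) -> admissible A [:: p].
Proof. by move=> H q; rewrite inE => /eqP ->; apply: H; rewrite inE eqxx. Qed.

Lemma depends_on_total s : local_terms s -> depends_on m s (total s).
Proof.
move=> ls a b ab; rewrite /total big_seq [RHS]big_seq; apply: eq_bigr => p ps.
have [dY _ _] := ls p ps; apply: dY => q i; rewrite inE => /eqP ->; exact: ab.
Qed.

Lemma total_cons p s a : total (p :: s) a = Y p a + total s a.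
Proof. by rewrite /total big_cons. Qed.

Lemma mean_sqr_ge0 p s : admissible A s -> local_terms s -> p \in s ->
  0 <= mean (fun a => Y p a ^+ 2) <= delta ^+ 2.
Proof.
move=> adm ls ps; have [dY _ Yd] := ls p ps.
have admp : admissible A [:: p] by move=> q; rewrite inE => /eqP ->; exact: adm.
rewrite -[X in X <= _ <= _](mean1 0) -[X in _ <= _ <= X](mean1 (delta ^+ 2)).
have dY2 := depends_on1 (fun x => x ^+ 2) dY.
apply/andP; split; apply: (mean_le admp) => // a; first exact: sqr_ge0.
rewrite -(real_normK (num_real (Y p a))) ler_sqr ?nnegrE//.
by case/andP: delta01.
Qed.

Lemma total_variance_ge0 s : admissible A s -> local_terms s -> 0 <= total_variance s.
Proof.
move=> adm ls; rewrite /total_variance big_seq; apply: sumr_ge0 => p ps.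
by have /andP[] := mean_sqr_ge0 adm ls ps.
Qed.

(** One prime is split off at a time by the addition formula and independence. Its cosine mean is
    [1 - v / 2] up to [delta * v], hence close to [exp (- v / 2)], and its sine mean is negligible
    because the term is centred. *)
Lemma model_cos s theta : uniq s -> admissible A s -> local_terms s ->
  `|mean (fun a => cos (total s a + theta))
    - expR (- (total_variance s / 2)) * cos theta| <= 3 * delta * total_variance s.
Proof.
have /andP[d0 d1] := delta01.
elim: s theta => [|p s IH] theta /=.
  move=> _ _ _; rewrite /total_variance big_nil mul0r oppr0 expR0 mul1r mulr0.
  rewrite (_ : (fun a => _) = fun=> cos theta) ?mean1 ?subrr ?normr0//.
  by apply/funext => a; rewrite /total big_nil add0r.
move=> /andP[ps us] adm ls; have ls' := local_terms_cons ls.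
have adm' := admissible_cons adm; have admp := admissible_head adm.
have pin : p \in p :: s by rewrite inE eqxx.
have [dY Y0 Yd] := ls p pin.
have dS := depends_on_total ls'.
have dis : {in [:: p], forall q, q \notin s} by move=> q; rewrite inE => /eqP ->.
set v := mean (fun a => Y p a ^+ 2).
have /andP[v0 vd] : 0 <= v <= delta ^+ 2 := mean_sqr_ge0 adm ls pin.
set V := total_variance s.
have VE : total_variance (p :: s) = v + V by rewrite /total_variance big_cons.
have V0 : 0 <= V by exact: total_variance_ge0.
pose alpha := mean (fun a => cos (Y p a)).
pose beta := mean (fun a => sin (Y p a)).
pose c := mean (fun a => cos (total s a + theta)).
pose sg := mean (fun a => sin (total s a + theta)).
have dcos := depends_on1 (fun x => cos (x + theta)) dS.
have dsin := depends_on1 (fun x => sin (x + theta)) dS.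
have dcY := depends_on1 cos dY.
have dsY := depends_on1 sin dY.
have -> : mean (fun a => cos (total (p :: s) a + theta)) = alpha * c - beta * sg.
  rewrite -(mean_indep height_finite h_ge0 g_lim g_mul admp adm' dis dcY dcos).
  rewrite -(mean_indep height_finite h_ge0 g_lim g_mul admp adm' dis dsY dsin).
  have sub : {subset [:: p] <= p :: s} by move=> q; rewrite !inE => /eqP ->; rewrite eqxx.
  have sub' : {subset s <= p :: s} by move=> q qs; rewrite inE qs orbT.
  rewrite -(meanB height_finite h_ge0 g_lim adm).
  - by congr mean; apply/funext => a; rewrite total_cons -addrA; exact: cosD.
  - apply: (depends_on2 (fun x y => x * y)).
      exact: depends_on_sub sub dcY.
    exact: depends_on_sub sub' dcos.
  - apply: (depends_on2 (fun x y => x * y)).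
      exact: depends_on_sub sub dsY.
    exact: depends_on_sub sub' dsin.
have c1 : `|c| <= 1.
  by rewrite -(mean1 1); apply: (norm_mean adm') => // a; exact: cos_max.
have sg1 : `|sg| <= 1.
  by rewrite -(mean1 1); apply: (norm_mean adm') => // a; exact: sin_max.
have cube a : `|Y p a| ^+ 3 <= delta * Y p a ^+ 2.
  rewrite exprS -(real_normK (num_real (Y p a))) ler_wpM2r ?sqr_ge0//.
have dq := depends_on1 (fun x => delta * x ^+ 2) dY.
have mdq : mean (fun a => delta * Y p a ^+ 2) = delta * v.
  by rewrite (meanZ height_finite h_ge0 g_lim _ admp)//; exact: (depends_on1 (fun x => x ^+ 2)).
have ha : `|alpha - (1 - v / 2)| <= delta * v.
  have -> : alpha - (1 - v / 2) = mean (fun a => cos (Y p a) - (1 - Y p a ^+ 2 / 2)).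
    rewrite (meanB height_finite h_ge0 g_lim admp)//; last first.
      exact: (depends_on1 (fun x => 1 - x ^+ 2 / 2)).
    rewrite (meanB height_finite h_ge0 g_lim admp)//; last first.
      exact: (depends_on1 (fun x => x ^+ 2 / 2)).
    rewrite mean1 -/alpha; congr (_ - (_ - _)).
    rewrite (_ : (fun a => _) = fun a => 2^-1 * Y p a ^+ 2); last first.
      by apply/funext => a; rewrite mulrC.
    by rewrite (meanZ height_finite h_ge0 g_lim _ admp) 1?mulrC//; exact: (depends_on1 (fun x => x ^+ 2)).
  rewrite -mdq; apply: (norm_mean admp) => //.
    exact: (depends_on1 (fun x => cos x - (1 - x ^+ 2 / 2))).
  by move=> a; apply: le_trans (cos_sub1_sqr _) (cube a).
have hb : `|beta| <= delta * v.
  have -> : beta = mean (fun a => sin (Y p a) - Y p a).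
    by rewrite (meanB height_finite h_ge0 g_lim admp)// Y0 subr0.
  rewrite -mdq; apply: (norm_mean admp) => //.
    exact: (depends_on1 (fun x => sin x - x)).
  by move=> a; apply: le_trans (sin_sub_id _) (cube a).
have he : `|expR (- (v / 2)) - (1 - v / 2)| <= delta * v.
  apply: le_trans (expRN_sub1_sqr _) _; first by rewrite divr_ge0.
  have : v <= delta by apply: le_trans vd _; rewrite expr2 ler_piMl.
  by nra.
have e1 : expR (- (v / 2)) <= 1 by rewrite -expR0 ler_expR oppr_le0 divr_ge0.
have e0 := expR_ge0 (- (v / 2)).
rewrite VE [(v + V) / 2]mulrDl opprD expRD -mulrA.
have := IH theta us adm' ls'; rewrite -/c -/V; set E := _ * cos theta => hc.
rewrite (_ : _ - _ = ((alpha - (1 - v / 2)) - (expR (- (v / 2)) - (1 - v / 2))) * c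
  + expR (- (v / 2)) * (c - E) - beta * sg); last by ring.
apply: le_trans (ler_normB _ _) _.
(* Each prime costs three errors of size [delta * v]: the Taylor errors of the cosine mean and of
   the exponential, and the sine mean. *)
rewrite (_ : 3 * delta * (v + V) =
  (delta * v + delta * v) * 1 + 1 * (3 * delta * V) + delta * v * 1); last by ring.
apply: lerD; last by rewrite normrM ler_pM.
apply: le_trans (ler_normD _ _) _; apply: lerD.
  rewrite normrM ler_pM//; apply: le_trans (ler_normB _ _) _; exact: lerD.
by rewrite normrM ler_pM// ger0_norm.
Qed.

(** Independence factors the mean; as the terms are centred, each factor is at most
    [1 + lam ^+ 2 * v], hence at most its exponential. *)
Lemma model_exp s (lam : R) : uniq s -> admissible A s -> local_terms s ->
  `|lam| * delta <= 3^-1 ->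
  mean (fun a => expR (lam * total s a)) <= expR (lam ^+ 2 * total_variance s).
Proof.
move=> + + + ld.
elim: s => [|p s IH] /=.
  move=> _ _ _; rewrite /total_variance big_nil mulr0 expR0.
  rewrite (_ : (fun a => _) = fun=> 1) ?mean1//.
  by apply/funext => a; rewrite /total big_nil mulr0 expR0.
move=> /andP[ps us] adm ls; have ls' := local_terms_cons ls.
have adm' := admissible_cons adm; have admp := admissible_head adm.
have pin : p \in p :: s by rewrite inE eqxx.
have [dY Y0 Yd] := ls p pin.
have dS := depends_on_total ls'.
have dis : {in [:: p], forall q, q \notin s} by move=> q; rewrite inE => /eqP ->.
have deY := depends_on1 (fun x => expR (lam * x)) dY.
have deS := depends_on1 (fun x => expR (lam * x)) dS.
set v := mean (fun a => Y p a ^+ 2).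
have -> : mean (fun a => expR (lam * total (p :: s) a)) =
    mean (fun a => expR (lam * Y p a)) * mean (fun a => expR (lam * total s a)).
  rewrite -(mean_indep height_finite h_ge0 g_lim g_mul admp adm' dis deY deS).
  by congr mean; apply/funext => a; rewrite total_cons mulrDr expRD.
rewrite /total_variance big_cons mulrDr expRD -/(total_variance s) -/v.
have ge0 (q : seq nat) (u : Omega -> R) : admissible A q -> depends_on m q u ->
    0 <= mean (fun a => expR (lam * u a)).
  move=> admq dq; rewrite -[X in X <= _](mean1 0); apply: (mean_le admq) => //.
  exact: (depends_on1 (fun x => expR (lam * x))).
apply: ler_pM; [exact: (ge0 [:: p])|exact: (ge0 s)| |exact: IH].
apply: le_trans (expR_ge1Dx _).
have -> : 1 + lam ^+ 2 * v = mean (fun a => 1 + lam * Y p a + (lam * Y p a) ^+ 2).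
  rewrite (meanD height_finite h_ge0 g_lim admp); first last.
  - exact: (depends_on1 (fun x => (lam * x) ^+ 2)).
  - exact: (depends_on1 (fun x => 1 + lam * x)).
  rewrite (meanD height_finite h_ge0 g_lim admp)//; last exact: (depends_on1 (fun x => lam * x)).
  rewrite mean1 (meanZ height_finite h_ge0 g_lim _ admp)// Y0 mulr0 addr0.
  rewrite -(meanZ height_finite h_ge0 g_lim _ admp); last exact: (depends_on1 (fun x => x ^+ 2)).
  by congr (_ + mean _); apply/funext => a; rewrite exprMn.
apply: (mean_le admp) => //.
  exact: (depends_on1 (fun x => 1 + lam * x + (lam * x) ^+ 2)).
move=> a; apply: expR_le_quad; rewrite normrM.
by apply: le_trans ld; rewrite ler_wpM2l.
Qed.

(** An even power of [lam * total] over the factorial is at most the sum of the two exponentials of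
    opposite sign. For [lam > 1] and bounded variance the bound decays geometrically in [K],
    uniformly in [s]. *)
Lemma model_moment s (lam : R) K : uniq s -> admissible A s -> local_terms s ->
  0 < lam -> lam * delta <= 3^-1 ->
  mean (fun a => total s a ^+ K.*2) / K.*2`!%:R
    <= 2 * expR (lam ^+ 2 * total_variance s) / lam ^+ K.*2.
Proof.
move=> us adm ls l0 ld; have dS := depends_on_total ls.
have k0 : 0 < K.*2`!%:R :> R by rewrite ltr0n fact_gt0.
rewrite ler_pdivlMr ?exprn_gt0// mulrAC ler_pdivrMr//.
pose c : R := K.*2`!%:R.
have -> : mean (fun a => total s a ^+ K.*2) * lam ^+ K.*2 =
    mean (fun a => lam ^+ K.*2 * total s a ^+ K.*2).
  rewrite (meanZ height_finite h_ge0 g_lim _ adm) 1?mulrC//.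
  exact: (depends_on1 (fun x => x ^+ K.*2)).
apply: (@le_trans _ _ (mean (fun a => c * (expR (lam * total s a) + expR (- lam * total s a))))).
  apply: (mean_le adm).
  - exact: (depends_on1 (fun x => lam ^+ K.*2 * x ^+ K.*2)).
  - exact: (depends_on1 (fun x => c * (expR (lam * x) + expR (- lam * x)))).
  move=> a; rewrite -exprMn -ler_pdivrMl//  mulrC.
  rewrite -[(_ * _) ^+ K.*2]ger0_norm ?exprn_even_ge0 ?odd_double// normrX.
  apply: le_trans (exp_fact_le_expR K.*2 (normr_ge0 _)) _.
  case: (ger0P (lam * total s a)) => _; first by rewrite lerDl expR_ge0.
  by rewrite mulNr lerDr expR_ge0.
rewrite (meanZ height_finite h_ge0 g_lim _ adm); last first.
  exact: (depends_on1 (fun x => expR (lam * x) + expR (- lam * x))).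
rewrite [leRHS]mulrC ler_pM2l//.
rewrite (meanD height_finite h_ge0 g_lim adm); first last.
- exact: (depends_on1 (fun x => expR (- lam * x))).
- exact: (depends_on1 (fun x => expR (lam * x))).
rewrite mulr2n mulrDl mul1r; apply: lerD; first by apply: model_exp => //; rewrite gtr0_norm.
by rewrite -[lam ^+ 2]sqrrN; apply: model_exp => //; rewrite normrN gtr0_norm.
Qed.

End model.
(** * Linear statistics of the small primes *)

Section linear_statistics.
Context {R : realType} {n : nat} {Omega : pointedType}.
Variables (A : R) (h : Omega -> R) (m : Omega -> {ffun 'I_n -> nat}).
Variable g : {ffun 'I_n -> nat} -> R.
Hypothesis height_finite : forall B : R, 0 <= B -> finite_set [set a | h a <= B].
Hypothesis h_ge0 : forall a, 0 <= h a.
Hypothesis g_lim : forall d, pos_vec d -> rough A d ->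
    (div_count h m d B)%:R / (height_count h B)%:R @[B --> +oo] --> g d.
Hypothesis g_mul : forall a b, pos_vec a -> pos_vec b -> rough A a -> rough A b ->
    coprime (\prod_i a i) (\prod_i b i) -> g (vec_mul a b) = g a * g b.

Local Notation mean := (mean h).
Local Notation mean_le := (ler_mean height_finite h_ge0 g_lim).
Local Notation norm_mean := (norm_mean_le height_finite h_ge0 g_lim).
Local Notation mean1 := (mean_cst height_finite h_ge0).
Local Notation mean_sum := (mean_linear height_finite h_ge0 g_lim).
Local Notation mean_scale := (meanZ height_finite h_ge0 g_lim).

Lemma supported_vec2 i j p : prime p -> supported [:: p] (@vec2 n i j p).
Proof.
move=> pp; split=> [k|q k qq]; rewrite ffunE; case: ifP => // _; first exact: prime_gt0.
  by rewrite dvdn_prime2// inE.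
by rewrite dvdn1 => /eqP q1; rewrite q1 in qq.
Qed.

Lemma div_ind_vec2 i j p a :
  div_ind m (vec2 i j p) a = (p %| m a i)%N && (p %| m a j)%N.
Proof.
apply/forallP/andP => [H|[pi pj] k].
  by split; [have := H i|have := H j]; rewrite ffunE eqxx ?orbT.
by rewrite ffunE; case: ifP => [/orP[/eqP ->|/eqP ->]//|_]; exact: dvd1n.
Qed.

Definition dvd_ind i p (a : Omega) : R := (p %| m a i)%N%:R.

Lemma dvd_ind_mul i j p a :
  dvd_ind i p a * dvd_ind j p a = (div_ind m (vec2 i j p) a)%:R.
Proof. by rewrite div_ind_vec2 -mulnb natrM. Qed.

Lemma depends_on_dvd_ind i p : depends_on m [:: p] (dvd_ind i p).
Proof. by move=> a b ab; rewrite /dvd_ind ab// inE. Qed.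

Section local.
Variable p : nat.
Hypothesis admp : admissible A [:: p].

Let pp : prime p. Proof. by have [] := admp (mem_head _ _). Qed.

Lemma mean_dvd_ind_mul i j :
  mean (fun a => dvd_ind i p a * dvd_ind j p a) = g (vec2 i j p).
Proof.
rewrite (_ : (fun a => _) = fun a => (div_ind m (vec2 i j p) a)%:R); last first.
  by apply/funext => a; exact: dvd_ind_mul.
by rewrite (mean_div_ind height_finite h_ge0 g_lim admp)//; exact: supported_vec2.
Qed.

Lemma mean_dvd_ind i : mean (dvd_ind i p) = g (vec1 i p).
Proof.
rewrite -vec2_diag -mean_dvd_ind_mul; congr mean; apply/funext => a.
by rewrite dvd_ind_mul div_ind_vec2 andbb.
Qed.

Lemma g_vec1_ge0_le1 i : 0 <= g (vec1 i p) <= 1.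
Proof.
rewrite -mean_dvd_ind -[X in X <= _ <= _](mean1 0) -[X in _ <= _ <= X](mean1 1).
have di := @depends_on_dvd_ind i p.
by apply/andP; split; apply: (mean_le admp) => // a; rewrite /dvd_ind; case: (_ %| _)%N.
Qed.

End local.

Section fixed_weights.
Variable tau : 'I_n -> R.

Definition local_term p (a : Omega) : R :=
  \sum_i tau i * (dvd_ind i p a - g (vec1 i p)).

Lemma depends_on_local_term p : depends_on m [:: p] (local_term p).
Proof.
move=> a b ab; apply: eq_bigr => i _; congr (_ * (_ - _)).
exact: depends_on_dvd_ind ab.
Qed.

Definition local_variance p : R :=
  \sum_i \sum_j tau i * tau j * (g (vec2 i j p) - g (vec1 i p) * g (vec1 j p)).

Lemma mean_centered_mul i j p : admissible A [:: p] ->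
  mean (fun a => (dvd_ind i p a - g (vec1 i p)) * (dvd_ind j p a - g (vec1 j p)))
  = g (vec2 i j p) - g (vec1 i p) * g (vec1 j p).
Proof.
move=> admp; have [di dj] := (@depends_on_dvd_ind i p, @depends_on_dvd_ind j p).
set x := g (vec1 i p); set y := g (vec1 j p).
rewrite (_ : (fun a => _) = fun a => (dvd_ind i p a * dvd_ind j p a - y * dvd_ind i p a)
   - (x * dvd_ind j p a - x * y)); last by apply/funext => a; ring.
have dZ c (u : Omega -> R) : depends_on m [:: p] u -> depends_on m [:: p] (fun a => c * u a).
  exact: (depends_on1 (fun z => c * z)).
have dij := depends_on2 (fun x y => x * y) di dj.
rewrite (meanB height_finite h_ge0 g_lim admp); first last.
- exact: (depends_on1 (fun z => x * z - x * y)).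
- exact: (depends_on2 (fun u v => u * v - y * u)).
rewrite !(meanB height_finite h_ge0 g_lim admp)//; try exact: dZ.
rewrite !(mean_scale _ admp)// mean1 mean_dvd_ind_mul// !mean_dvd_ind//.
by rewrite -/x -/y; ring.
Qed.

Lemma local_terms_local_term s : admissible A s ->
  local_terms h m local_term (\sum_i `|tau i|) s.
Proof.
move=> adm p ps.
have admp : admissible A [:: p] by move=> q; rewrite inE => /eqP ->; exact: adm.
split; first exact: depends_on_local_term.
  rewrite /local_term (mean_sum admp); last first.
    move=> i _; apply: (depends_on1 (fun z => tau i * (z - g (vec1 i p)))).
    exact: depends_on_dvd_ind.
  rewrite big1// => i _; rewrite (mean_scale _ admp); last first.
    by apply: (depends_on1 (fun z => z - g (vec1 i p))); exact: depends_on_dvd_ind.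
  rewrite (meanB height_finite h_ge0 g_lim admp)//; last exact: depends_on_dvd_ind.
  by rewrite mean1 mean_dvd_ind// subrr mulr0.
move=> a; apply: le_trans (ler_norm_sum _ _ _) _; apply: ler_sum => i _.
rewrite normrM ler_piMr// ler_norml; have := g_vec1_ge0_le1 admp i.
by rewrite /dvd_ind; case: (_ %| _)%N => /=; lra.
Qed.

Lemma total_variance_local_term s : admissible A s ->
  total_variance h local_term s = \sum_(p <- s) local_variance p.
Proof.
move=> adm; rewrite /total_variance big_seq [RHS]big_seq; apply: eq_bigr => p ps.
have admp : admissible A [:: p] by move=> q; rewrite inE => /eqP ->; exact: adm.
pose x i a := dvd_ind i p a - g (vec1 i p).
have dx i : depends_on m [:: p] (x i).
  by apply: (depends_on1 (fun z => z - g (vec1 i p))); exact: depends_on_dvd_ind.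
have dxx i j : depends_on m [:: p] (fun a => x i a * x j a).
  exact: (depends_on2 (fun u v => u * v)).
rewrite (_ : (fun a => _) = fun a => \sum_i \sum_j tau i * tau j * (x i a * x j a)); last first.
  apply/funext => a; rewrite expr2 /local_term mulr_suml; apply: eq_bigr => i _.
  by rewrite mulr_sumr; apply: eq_bigr => j _; rewrite mulrACA.
rewrite (mean_sum admp) => [|i _ a b ab]; last first.
  by apply: eq_bigr => j _; rewrite (dxx i j a b ab).
apply: eq_bigr => i _; rewrite (mean_sum admp) => [|j _ a b ab]; last first.
  by rewrite (dxx i j a b ab).
by apply: eq_bigr => j _; rewrite (mean_scale _ admp)// mean_centered_mul.
Qed.

Definition total_shift s : R := \sum_(p <- s) \sum_i tau i * g (vec1 i p).

(** Powers of the uncentred sum expand into divisibility indicators; the centring is a constant,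
    restored later by the binomial formula. *)
Lemma total_local_termE s a :
  total local_term s a = weighted_sum m (fun x : 'I_(size s) * 'I_n => tau x.2) a - total_shift s.
Proof.
rewrite /total /total_shift -[weighted_sum _ _ a](pair_big xpredT xpredT
  (fun (k : 'I_(size s)) i => tau i * (nth 0%N s k %| m a i)%N%:R))/=.
rewrite -(big_mkord xpredT (fun k => \sum_i tau i * (nth 0%N s k %| m a i)%N%:R)).
rewrite -(big_nth 0%N xpredT (fun p => \sum_i tau i * (p %| m a i)%N%:R)) -sumrB.
apply: eq_bigr => p _; rewrite -sumrB; apply: eq_bigr => i _.
by rewrite mulrBr.
Qed.

Definition level_sum (X B : R) : R :=
  \sum_(d \in [set d : {ffun 'I_n -> nat} |
      [/\ pos_vec d, (\max_i d i)%:R <= X & rough A d]])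
    (\prod_i (mobius (d i))%:~R ^+ 2) * `|remainder h m g d B|.

Definition moment_gap s B k : R :=
  `|avg h B (fun a => total local_term s a ^+ k) - mean (fun a => total local_term s a ^+ k)|.

(** The binomial formula around the shift, with [i ^ i <= k ^ i] for the moment of order [i <= k],
    resums to a single [k]-th power. *)
Lemma moment_gap_le s B k (X y : R) : uniq s -> admissible A s ->
  (0 < height_count h B)%N ->
  1 <= y -> (forall p, p \in s -> p%:R <= y) -> y ^+ k <= X ->
  moment_gap s B k <= (`|total_shift s| + k%:R * \sum_i `|tau i|) ^+ k
     * (level_sum X B / (height_count h B)%:R).
Proof.
move=> us adm N0 y1 sy yX.
set G := total_shift s; set W := \sum_i `|tau i|.
pose w := weighted_sum m (fun x : 'I_(size s) * 'I_n => tau x.2).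
have W0 : 0 <= W by exact: sumr_ge0.
have tW (x : 'I_(size s) * 'I_n) : `|tau x.2| <= W.
  by rewrite /W (bigD1 x.2)//= lerDl sumr_ge0.
have tE : total local_term s = (fun a => w a - G).
  by apply/funext => a; rewrite total_local_termE.
have dw : depends_on m s w.
  have := depends_on_total (local_terms_local_term adm); rewrite tE => dt.
  rewrite (_ : w = fun a => (w a - G) + G); last by apply/funext => a; rewrite subrK.
  exact: (depends_on1 (fun x => x + G)).
pose c (i : 'I_k.+1) : R := (- G) ^+ (k - i) *+ 'C(k, i).
have expE a : total local_term s a ^+ k = \sum_(i < k.+1) c i * w a ^+ i.
  rewrite tE addrC exprDn; apply: eq_bigr => i _; by rewrite /c mulrnAl.
have dwi (i : 'I_k.+1) : depends_on m s (fun a => w a ^+ i).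
  exact: (depends_on1 (fun x => x ^+ i)).
rewrite /moment_gap (_ : (fun a => total local_term s a ^+ k) =
  fun a => \sum_(i < k.+1) c i * w a ^+ i); last first.
  by apply/funext => a; exact: expE.
rewrite avg_sum (mean_sum adm); last first.
  by move=> i _; apply: (depends_on1 (fun x => c i * x ^+ i)).
rewrite -sumrB; set kW := k%:R * W; rewrite [in leRHS]exprDn mulr_suml.
apply: le_trans (ler_norm_sum _ _ _) _.
apply: ler_sum => i _; rewrite avgZ (mean_scale _ adm)// -mulrBr normrM.
rewrite /c normrMn normrX normrN !mulrnAl ler_wMn2r// -mulrA ler_wpM2l ?exprn_ge0//.
have ik : (i <= k)%N by rewrite -ltnS.
apply: le_trans (weighted_sum_moment height_finite h_ge0 g_lim adm us W0 tW i N0) _.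
have yi : y ^+ i <= X by apply: le_trans yX; rewrite ler_weXn2l.
have lv := sum_remainder_le h m g adm us B y1 sy yi.
apply: ler_pM.
- by rewrite mulr_ge0// exprn_ge0.
- by rewrite divr_ge0// sumr_ge0.
- by rewrite /kW exprMn mulrC ler_wpM2r ?exprn_ge0// natrX lerXn2r ?nnegrE ?ler_nat.
- by rewrite ler_wpM2r ?invr_ge0.
Qed.

(** The Taylor polynomial has even length [2 K], so its remainder is bounded by an even power,
    without absolute value, whose average is again comparable with its mean. That mean is estimated
    at [lam = 2]; it enters once under [avg] and once under [mean], which doubles the constant 2 to
    4. *)
Lemma cos_gap_le s B theta K : uniq s -> admissible A s -> (0 < height_count h B)%N ->
  2 * \sum_i `|tau i| <= 3^-1 ->
  `|avg h B (fun a => cos (total local_term s a + theta))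
    - mean (fun a => cos (total local_term s a + theta))|
  <= \sum_(k < K.*2.+1) moment_gap s B k
     + 4 * expR (4 * \sum_(p <- s) local_variance p) / 2 ^+ K.*2.
Proof.
move=> us adm N0 W6; set S := total local_term s.
have ls := local_terms_local_term adm.
have dS : depends_on m s S := depends_on_total ls.
pose c (j : 'I_K.*2) : R := cos (theta + j%:R * (pi / 2)) / j`!%:R.
pose P a := \sum_(j < K.*2) c j * S a ^+ j.
have PE a : P a = cos_taylor K.*2 theta (S a).
  by apply: eq_bigr => j _; rewrite /c -mulrA [_^-1 * _]mulrC.
pose e a := (K.*2`!%:R)^-1 * S a ^+ K.*2.
have ce a : `|cos (S a + theta) - P a| <= e a.
  rewrite PE; apply: le_trans (cos_taylor_bound _ _ _) _.
  by rewrite -normrX ger0_norm ?exprn_even_ge0 ?odd_double// /e mulrC.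
have dP : depends_on m s P.
  by move=> a b ab; apply: eq_bigr => j _; rewrite (dS _ _ ab).
have dc : depends_on m s (fun a => cos (S a + theta)).
  exact: (depends_on1 (fun x => cos (x + theta))).
have dSK k : depends_on m s (fun a => S a ^+ k) by exact: (depends_on1 (fun x => x ^+ k)).
have de : depends_on m s e by exact: (depends_on1 (fun x => (K.*2`!%:R)^-1 * x ^+ K.*2)).
have avgB u v : avg h B (fun a => u a - v a) = avg h B u - avg h B v.
  by rewrite avgD avgN.
have h1 : `|avg h B (fun a => cos (S a + theta)) - avg h B P| <= avg h B e.
  by rewrite -avgB; exact: norm_avg_le.
have h2 : `|mean (fun a => cos (S a + theta)) - mean P| <= mean e.
  rewrite -(meanB height_finite h_ge0 g_lim adm dc dP); apply: (norm_mean adm) => //.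
  exact: (depends_on2 (fun x y => x - y)).
have h3 : `|avg h B P - mean P| <= \sum_(k < K.*2) moment_gap s B k.
  rewrite /P avg_sum (mean_sum adm); last first.
    by move=> j _ a b ab; rewrite (dS _ _ ab).
  rewrite -sumrB; apply: le_trans (ler_norm_sum _ _ _) _; apply: ler_sum => j _.
  rewrite avgZ (mean_scale _ adm)// -mulrBr normrM ler_piMl//.
  rewrite /c normrM -[leRHS]mulr1 ler_pM ?normr_ge0//; first exact: cos_max.
  rewrite ger0_norm ?invr_ge0// invf_le1 ?ltr0n ?fact_gt0//.
  by rewrite ler1n fact_gt0.
have fi : 0 <= ((K.*2`!%:R)^-1 : R) <= 1.
  rewrite invr_ge0 ler0n invf_le1 ?ltr0n ?fact_gt0//.
  by rewrite ler1n fact_gt0.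
have h4 : avg h B e <= mean e + moment_gap s B K.*2.
  rewrite /e avgZ (mean_scale _ adm)// -lerBlDl -mulrBr.
  apply: le_trans (_ : (K.*2`!%:R)^-1 * moment_gap s B K.*2 <= _).
    by case/andP: fi => fi _; rewrite ler_wpM2l// ler_norm.
  by case/andP: fi => _ fi; rewrite ler_piMl// normr_ge0.
have h5 : mean e <= 2 * expR (4 * \sum_(p <- s) local_variance p) / 2 ^+ K.*2.
  have := model_moment height_finite h_ge0 g_lim g_mul K us adm ls (ltr0n R 2) W6.
  rewrite (total_variance_local_term adm) (_ : 2%:R ^+ 2 = 4); last by ring.
  by rewrite /e (mean_scale _ adm)// mulrC.
rewrite big_ord_recr/=.
set E := expR _ in h5 *; set p2 := 2 ^+ K.*2 in h5 *.
have -> : 4 * E / p2 = 2 * (2 * E / p2) by ring.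
move: h1 h2 h3 h4 h5.
set x := avg h B _; set x' := avg h B P; set y := mean _; set y' := mean P.
move=> h1 h2 h3 h4 h5.
have : `|x - y| <= `|x - x'| + `|x' - y'| + `|y - y'|.
  rewrite (_ : x - y = (x - x') + (x' - y') - (y - y')); last by ring.
  by apply: le_trans (ler_normB _ _) _; rewrite lerD2r ler_normD.
lra.
Qed.

End fixed_weights.
End linear_statistics.

(** * Passage to the limit for linear statistics *)

Lemma cvg_sumr {R : realType} {T : Type} (F : set_system T) {FF : Filter F}
    (I : Type) (r : seq I) (f : I -> T -> R) (l : I -> R) :
  (forall i, f i x @[x --> F] --> l i) ->
  \sum_(i <- r) f i x @[x --> F] --> \sum_(i <- r) l i.
Proof. by move=> fl; apply: cvg_big => [|i _]; [exact: add_continuous|exact: fl]. Qed.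

Section limit.
Context {R : realType} {n : nat} {Omega : pointedType}.
Variables (A : R) (h : Omega -> R) (m : Omega -> {ffun 'I_n -> nat}).
Variable g : {ffun 'I_n -> nat} -> R.
Hypothesis height_finite : forall B : R, 0 <= B -> finite_set [set a | h a <= B].
Hypothesis h_ge0 : forall a, 0 <= h a.
Hypothesis g_lim : forall d, pos_vec d -> rough A d ->
    (div_count h m d B)%:R / (height_count h B)%:R @[B --> +oo] --> g d.
Hypothesis g_mul : forall a b, pos_vec a -> pos_vec b -> rough A a -> rough A b ->
    coprime (\prod_i a i) (\prod_i b i) -> g (vec_mul a b) = g a * g b.

Local Notation mean := (mean h).

Variables (s : R -> seq nat) (tau : R -> 'I_n -> R) (X y : R -> R) (Q : R).
Local Notation S B := (total (local_term m g (tau B)) (s B)).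
Local Notation V B := (\sum_(p <- s B) local_variance g (tau B) p).
Local Notation delta B := (\sum_i `|tau B i|).
Hypothesis us : forall B, uniq (s B).
Hypothesis adm : forall B, admissible A (s B).
Hypothesis y1 : \forall B \near +oo, 1 <= y B.
Hypothesis sy : \forall B \near +oo, forall p, p \in s B -> p%:R <= y B.
Hypothesis yX : forall k, \forall B \near +oo, y B ^+ k <= X B.
Hypothesis level0 : forall k, (1 + `|total_shift g (tau B) (s B)|) ^+ k *
    (level_sum A h m g (X B) B / (height_count h B)%:R) @[B --> +oo] --> (0 : R).
Hypothesis delta0 : delta B @[B --> +oo] --> (0 : R).
Hypothesis VQ : V B @[B --> +oo] --> Q.

Lemma delta_small (e : R) : 0 < e -> \forall B \near +oo, delta B < e.
Proof. exact: cvgr_lt. Qed.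

Lemma level_sum_ge0 B : 0 <= level_sum A h m g (X B) B / (height_count h B)%:R.
Proof.
rewrite divr_ge0// /level_sum; apply: fsumr_ge0 => d _.
by rewrite mulr_ge0// prodr_ge0// => i _; rewrite sqr_ge0.
Qed.

Lemma cvg_moment_gap k : moment_gap h m g (tau B) (s B) B k @[B --> +oo] --> (0 : R).
Proof.
(* Once [delta B < 1], the base [|shift| + k * delta B] is at most [(k + 1) * (1 + |shift|)]. *)
have c0 : (k.+1%:R ^+ k * ((1 + `|total_shift g (tau B) (s B)|) ^+ k *
    (level_sum A h m g (X B) B / (height_count h B)%:R))) @[B --> +oo] --> (0 : R).
  by rewrite -[X in _ --> X](mulr0 (k.+1%:R ^+ k)); apply: cvgM; [exact: cvg_cst|exact: level0].
apply: (squeeze_cvgr _ (@cvg_cst _ (0 : R) _ _ _) c0).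
have N0 := near_height_count height_finite h_ge0.
near=> B; apply/andP; split; first exact: normr_ge0.
have N0B : (0 < height_count h B)%N by near: B.
have y1B : 1 <= y B by near: B.
have syB : forall p, p \in s B -> p%:R <= y B by near: B.
have yXB : y B ^+ k <= X B by near: B; exact: yX.
have d1 : delta B < 1 by near: B; exact: delta_small.
apply: le_trans (moment_gap_le height_finite h_ge0 g_lim (tau B) (us B) (@adm B) N0B y1B syB yXB) _.
rewrite mulrA ler_wpM2r ?level_sum_ge0//.
have d0 : 0 <= delta B by exact: sumr_ge0.
rewrite -exprMn lerXn2r ?nnegrE ?mulr_ge0 ?addr_ge0 ?mulr_ge0//.
have k0 : 0 <= k%:R :> R by [].
have G0 := normr_ge0 (total_shift g (tau B) (s B)).
rewrite -natr1; set G := `|_| in G0 *; have := mulr_ge0 k0 G0.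
have : k%:R * delta B <= k%:R by rewrite ler_piMr// ltW.
nra.
Unshelve. all: by end_near. Qed.

Lemma cvg_avg_cos theta :
  avg h B (fun a => cos (S B a + theta)) @[B --> +oo] --> expR (- (Q / 2)) * cos theta.
Proof.
apply/cvgrPdist_lt => e e0.
(* The total error for a fixed degree [2 K]. As [B] grows only its second term survives, and the
   limit of that term tends to 0 with [K]; hence [K] is chosen before [B]. *)
pose r K (B : R) := \sum_(k < K.*2.+1) moment_gap h m g (tau B) (s B) B k
  + 4 * expR (4 * V B) / 2 ^+ K.*2 + 3 * delta B * V B
  + `|expR (- (V B / 2)) - expR (- (Q / 2))|.
have rl K : r K B @[B --> +oo] --> (4 * expR (4 * Q) / 2 ^+ K.*2 : R).
  rewrite [X in _ --> X](_ : _ = 0 + 4 * expR (4 * Q) / 2 ^+ K.*2 + 3 * 0 * Q + 0); last by ring.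
  apply: cvgD; [apply: cvgD; [apply: cvgD|]|].
  - rewrite [X in _ --> X](_ : _ = \sum_(k < K.*2.+1) 0); last by rewrite big1.
    by apply: cvg_sumr => k; exact: cvg_moment_gap.
  - apply: cvgM; [apply: cvgM|]; [exact: cvg_cst| |exact: cvg_cst].
    apply: (@continuous_cvg _ _ _ _ _ _ (@expR R)); first exact: continuous_expR.
    by apply: cvgM; [exact: cvg_cst|exact: VQ].
  - by apply: cvgM; [apply: cvgM; [exact: cvg_cst|exact: delta0]|exact: VQ].
  - rewrite [X in _ --> X](_ : _ = `|expR (- (Q / 2)) - expR (- (Q / 2))|); last first.
      by rewrite subrr normr0.
    apply: cvg_norm; apply: cvgB; last exact: cvg_cst.
    apply: (@continuous_cvg _ _ _ _ _ _ (@expR R)); first exact: continuous_expR.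
    by apply: cvgN; apply: cvgM; [exact: VQ|exact: cvg_cst].
have [K Ke] : exists K, 4 * expR (4 * Q) / 2 ^+ K.*2 < e.
  set c := 4 * expR (4 * Q).
  exists (Num.truncn (c / e)).+1; rewrite ltr_pdivrMr ?exprn_gt0// [e * _]mulrC -ltr_pdivrMr//.
  apply: lt_le_trans (truncnS_gt _) _; rewrite -natrX ler_nat.
  by apply: leq_trans (ltnW (ltn_expl _ (ltnSn 1))) _; rewrite leq_exp2l// -addnn leq_addr.
have N0 := near_height_count height_finite h_ge0.
near=> B.
have N0B : (0 < height_count h B)%N by near: B.
(* The value [6^-1] yields the condition [2 * delta B <= 3^-1] for exponential moments at
   [lam = 2]. *)
have d6 : delta B < 6^-1 by near: B; apply: delta_small.
have d0 : 0 <= delta B by exact: sumr_ge0.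
have rB : r K B < e by near: B; apply: (cvgr_lt _ (rl K)).
apply: le_lt_trans rB; rewrite /r.
have d3 : 2 * delta B <= 3^-1 by lra.
have d01 : 0 <= delta B <= 1 by lra.
have := cos_gap_le height_finite h_ge0 g_lim g_mul theta K (us B) (@adm B) N0B d3.
have := model_cos height_finite h_ge0 g_lim g_mul d01 theta (us B) (@adm B)
  (local_terms_local_term height_finite h_ge0 g_lim (tau B) (@adm B)).
rewrite (total_variance_local_term height_finite h_ge0 g_lim (tau B) (@adm B)).
set x := avg _ _ _; set x' := mean _; set E := expR (- (V B / 2)); set E' := expR (- (Q / 2)).
move=> h2 h1.
have h3 : `|(E - E') * cos theta| <= `|E - E'| by rewrite normrM ler_piMr// cos_max.
have : `|E' * cos theta - x| <= `|x - x'| + `|x' - E * cos theta| + `|(E - E') * cos theta|.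
  rewrite [leLHS]distrC (_ : x - E' * cos theta =
    (x - x') + (x' - E * cos theta) + (E - E') * cos theta); last by ring.
  by apply: le_trans (ler_normD _ _) _; rewrite lerD2r ler_normD.
lra.
Unshelve. all: by end_near. Qed.

(** Prepares tightness: the moment bound for [K = 1] and [lam = 2] controls the mean, and the moment
    gap of order 2 tends to 0. *)
Lemma avg_sqr_bounded : exists C, \forall B \near +oo, avg h B (fun a => S B a ^+ 2) <= C.
Proof.
exists (2 + expR (4 * (Q + 1))).
have N0 := near_height_count height_finite h_ge0.
near=> B.
have d6 : delta B < 6^-1 by near: B; apply: delta_small.
have d3 : 2 * delta B <= 3^-1 by lra.
have V1 : V B < Q + 1 by near: B; apply: (cvgr_lt _ VQ); rewrite ltrDl.
have m1 : moment_gap h m g (tau B) (s B) B 2 < 1.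
  by near: B; apply: (cvgr_lt _ (cvg_moment_gap 2)).
have := model_moment height_finite h_ge0 g_lim g_mul 1 (us B) (@adm B)
  (local_terms_local_term height_finite h_ge0 g_lim (tau B) (@adm B)) (ltr0n R 2) d3.
rewrite (total_variance_local_term height_finite h_ge0 g_lim (tau B) (@adm B)).
move: m1; rewrite /moment_gap ltr_norml => /andP[_].
set x := avg _ _ _; set x' := mean _.
have E : expR (2%:R ^+ 2 * V B) <= expR (4 * (Q + 1)).
  by rewrite ler_expR (_ : 2%:R ^+ 2 = 4 :> R); [lra|ring].
rewrite (_ : 1.*2 = 2)// (_ : 2`! = 2)//; set e1 := expR _ in E *; set e2 := expR _ in E *.
move=> h1; rewrite ler_pdivrMr// => h2.
have : 2 * e1 / 2%:R ^+ 2 * 2%:R = e1 by field.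
lra.
Unshelve. all: by end_near. Qed.

End limit.
(** * Choice of the parameters *)

Section diverging.
Context {R : realType} {T : Type} (D : set_system T) {FD : Filter D}.
Implicit Types u v : T -> R.

Lemma cvgry_ge u M : u x @[x --> D] --> +oo -> \forall x \near D, M <= u x.
Proof. by move/cvgryPge/(_ M). Qed.

Lemma cvgry_gt u M : u x @[x --> D] --> +oo -> \forall x \near D, M < u x.
Proof. by move/cvgryPgt/(_ M). Qed.

Lemma cvgry_le u v : u x @[x --> D] --> +oo -> (\forall x \near D, u x <= v x) ->
  v x @[x --> D] --> +oo.
Proof.
move=> uy uv; apply/cvgryPge => M; have uM := cvgry_ge M uy.
by apply: filterS2 uM uv => x; exact: le_trans.
Qed.

Lemma cvgry_ln u : u x @[x --> D] --> +oo -> ln (u x) @[x --> D] --> +oo.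
Proof.
move=> uy; apply/cvgryPge => M; have := cvgry_ge (expR M) uy; apply: filterS => x ux.
by rewrite -(expRK M) ler_ln ?posrE ?expR_gt0// (lt_le_trans _ ux)// expR_gt0.
Qed.

Lemma cvgry_sqrt u : u x @[x --> D] --> +oo -> Num.sqrt (u x) @[x --> D] --> +oo.
Proof.
move=> uy; apply/cvgryPge => M; have := cvgry_ge (M ^+ 2) uy; apply: filterS => x ux.
apply: le_trans (ler_norm M) _; rewrite -sqrtr_sqr ler_wsqrtr//.
Qed.

Lemma cvgr0_inv u : u x @[x --> D] --> +oo -> (u x)^-1 @[x --> D] --> (0 : R).
Proof.
move=> uy; apply/cvgrPdist_lt => e e0; have := cvgry_gt e^-1 uy; apply: filterS => x ux.
have u0 : 0 < u x by apply: lt_trans ux; rewrite invr_gt0.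
by rewrite sub0r normrN gtr0_norm ?invr_gt0// invf_plt.
Qed.

Lemma cvgr0_le u v : u x @[x --> D] --> (0 : R) -> (\forall x \near D, `|v x| <= u x) ->
  v x @[x --> D] --> (0 : R).
Proof.
move=> u0 vu; apply/cvgrPdist_lt => e e0; have : \forall x \near D, u x < e by exact: (cvgr_lt _ u0).
by apply: filterS2 vu => x vx ux; rewrite sub0r normrN (le_lt_trans vx).
Qed.

End diverging.

Section scales.
Context {R : realType} (F : R -> R).
Hypothesis Fy : F B @[B --> +oo] --> +oo.
Implicit Types B : R.

Definition loglog B : R := ln (ln (F B)).
Definition logloglog B : R := ln (loglog B).

(* Only the primes up to [cutoff B] are sieved: an integer up to [F B] has at most
   [1 / cutoff_exponent B] larger prime factors, which is [o (sqrt (loglog B))],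
   while every fixed power of [cutoff B] stays below the level of distribution. *)
Definition cutoff_exponent B : R := Num.sqrt (logloglog B) / Num.sqrt (loglog B).
Definition cutoff B : R := F B `^ cutoff_exponent B.

Local Notation L := loglog.
Local Notation l := logloglog.
Local Notation eta := cutoff_exponent.

Lemma cvg_loglog : L B @[B --> +oo] --> +oo.
Proof. by do 2 apply: cvgry_ln. Qed.

Lemma cvg_logloglog : l B @[B --> +oo] --> +oo.
Proof. by apply: cvgry_ln; exact: cvg_loglog. Qed.

Lemma near_scales : \forall B \near +oo, [/\ 1 < F B, 1 <= ln (F B), 1 <= L B & 1 <= l B].
Proof.
near=> B; split; near: B; [exact: cvgry_gt| | |]; apply: cvgry_ge;
  [exact: cvgry_ln|exact: cvg_loglog|exact: cvg_logloglog].
Unshelve. all: by end_near. Qed.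

Lemma expR_half_logloglog B : 0 < L B -> Num.sqrt (L B) = expR (l B / 2).
Proof.
move=> L0; rewrite -[in LHS](lnK (x := L B))// {1}[ln _]splitr expRD -expr2.
by rewrite sqrtr_sqr gtr0_norm// expR_gt0.
Qed.

Lemma cvg_logloglog_div_sqrt : l B / Num.sqrt (L B) @[B --> +oo] --> (0 : R).
Proof.
(* The constant comes from [exp (l / 2) >= (l / 2) ^ 2 / 2 = l ^ 2 / 8]. *)
apply: (@cvgr0_le _ _ _ _ (fun B => 8 * (l B)^-1)).
  rewrite -[X in _ --> X](mulr0 8); apply: cvgM; first exact: cvg_cst.
  by apply: cvgr0_inv; exact: cvg_logloglog.
apply: filterS near_scales => B [_ _ L1 l1].
have l0 : 0 < l B by apply: lt_le_trans l1.
have L0 : 0 < L B by apply: lt_le_trans L1.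
rewrite ger0_norm ?divr_ge0 ?sqrtr_ge0 ?(ltW l0)// expR_half_logloglog//.
rewrite ler_pdivrMr ?expR_gt0// mulrAC ler_pdivlMr// mulrC -ler_pdivrMl//.
have := exp_fact_le_expR 2 (divr_ge0 (ltW l0) (ler0n R 2)).
by apply: le_trans; rewrite (_ : 2`! = 2)//; lra.
Qed.

Lemma near_cutoff_exponent : \forall B \near +oo,
  (Num.sqrt (L B))^-1 <= eta B <= 1.
Proof.
have l1 : \forall B \near +oo, l B / Num.sqrt (L B) < 1.
  exact: (cvgr_lt _ cvg_logloglog_div_sqrt).
apply: filterS2 near_scales l1 => B [_ _ L1 l1] lL.
have s0 : 0 < Num.sqrt (L B) by rewrite sqrtr_gt0; lra.
have s1 : 1 <= Num.sqrt (l B) by rewrite -sqrtr1 ler_wsqrtr.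
rewrite /eta; apply/andP; split.
  by rewrite ler_pdivlMr// mulVf// gt_eqF.
apply: le_trans (ltW lL); rewrite ler_wpM2r ?invr_ge0 ?sqrtr_ge0//.
rewrite -[leRHS](@sqr_sqrtr _ (l B)); last by lra.
by rewrite expr2 ler_peMl ?sqrtr_ge0.
Qed.

(** Here [ln (ln z) = L + ln eta] with [1 / sqrt L <= eta <= 1], so passing from [F(B)] to [z] moves
    the Mertens sums by [O(log L)], which is [o(sqrt L)]. *)
Lemma near_loglog_cutoff : \forall B \near +oo,
  [/\ 0 < ln (cutoff B) , 0 < eta B & `|ln (ln (cutoff B)) - L B| <= l B].
Proof.
apply: filterS2 near_scales near_cutoff_exponent => B [F1 lF L1 l1] /andP[e0 e1].
have L0 : 0 < L B by apply: lt_le_trans L1.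
have s0 : 0 < (Num.sqrt (L B))^-1 by rewrite invr_gt0 sqrtr_gt0.
have eta0 : 0 < eta B by apply: lt_le_trans e0.
have lF0 : 0 < ln (F B) by apply: lt_le_trans lF.
have lc : ln (cutoff B) = eta B * ln (F B) by rewrite /cutoff ln_powR.
rewrite lc; split=> //; first exact: mulr_gt0.
rewrite lnM ?posrE// -/(L B) addrK.
have : ln (eta B) <= 0 by rewrite -ln1 ler_ln ?posrE.
move=> h; rewrite ler0_norm// -lerNl.
have : ln (Num.sqrt (L B))^-1 <= ln (eta B) by rewrite ler_ln ?posrE.
apply: le_trans; rewrite lnV ?posrE ?sqrtr_gt0// expR_half_logloglog// expRK.
by lra.
Qed.

(** Taking logarithms twice only decreases, so [z >= ln (ln z) >= L - l >= L / 2]. *)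
Lemma cvg_cutoff : cutoff B @[B --> +oo] --> +oo.
Proof.
apply: (@cvgry_le _ _ _ _ (fun B => L B / 2)).
  apply: gt0_cvgMly; last exact: cvg_loglog.
  by rewrite invr_gt0.
have h : \forall B \near +oo, l B / Num.sqrt (L B) < 2^-1.
  by apply: (cvgr_lt _ cvg_logloglog_div_sqrt); rewrite invr_gt0.
near=> B.
have [F1 lF L1 l1] : [/\ 1 < F B, 1 <= ln (F B), 1 <= L B & 1 <= l B].
  by near: B; exact: near_scales.
have [c0 e0] : [/\ 0 < ln (cutoff B) , 0 < eta B & `|ln (ln (cutoff B)) - L B| <= l B].
  by near: B; exact: near_loglog_cutoff.
rewrite ler_norml => /andP[h1 _].
have : l B / Num.sqrt (L B) < 2^-1 by near: B.
have L0 : 0 < L B by apply: lt_le_trans L1.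
rewrite ltr_pdivrMr ?sqrtr_gt0// => h2.
have sL : Num.sqrt (L B) <= L B.
  rewrite -[leRHS](@sqr_sqrtr _ (L B)) ?(ltW L0)// expr2 ler_peMl ?sqrtr_ge0//.
  by rewrite -sqrtr1 ler_wsqrtr.
have le x : 0 < x -> ln x <= x :> R.
  by move=> x0; rewrite -[leRHS](lnK (x := x))//; apply: le_trans (expR_ge1Dx _); rewrite lerDr.
have z0 : 0 < cutoff B by rewrite /cutoff powR_gt0; lra.
have := le _ c0; have := le _ z0; lra.
Unshelve. all: by end_near. Qed.

(** The exponents satisfy [k * eta <= l / sqrt L] as soon as [k <= sqrt l]. *)
Lemma cutoff_level k : \forall B \near +oo,
  cutoff B ^+ k <= F B `^ (l B / Num.sqrt (L B)).
Proof.
have lk : \forall B \near +oo, k%:R <= Num.sqrt (l B).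
  by apply: cvgry_ge; apply: cvgry_sqrt; exact: cvg_logloglog.
apply: filterS2 near_scales lk => B [F1 lF L1 l1] lk.
rewrite /cutoff -powR_mulrn ?powR_ge0// -powRrM ler_powR ?(ltW F1)//.
rewrite /eta mulrAC ler_wpM2r ?invr_ge0 ?sqrtr_ge0//.
rewrite -[leRHS](@sqr_sqrtr _ (l B)); last by lra.
by rewrite expr2 ler_wpM2l ?sqrtr_ge0.
Qed.

Lemma cvg_inv_cutoff_exponent : (eta B)^-1 / Num.sqrt (L B) @[B --> +oo] --> (0 : R).
Proof.
apply: (cvgr0_le (cvgr0_inv (cvgry_sqrt cvg_logloglog))).
apply: filterS near_scales => B [F1 lF L1 l1].
have L0 : 0 < L B by apply: lt_le_trans L1.
have l0 : 0 < l B by apply: lt_le_trans l1.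
have s0 : 0 < Num.sqrt (L B) by rewrite sqrtr_gt0.
have t0 : 0 < Num.sqrt (l B) by rewrite sqrtr_gt0.
rewrite ger0_norm; last by rewrite !mulr_ge0 ?invr_ge0 ?sqrtr_ge0// mulr_ge0 ?invr_ge0 ?sqrtr_ge0.
by rewrite invf_div mulrAC divff ?mul1r ?gt_eqF.
Qed.

End scales.

(** * Sums over primes and the growth of [F] *)

Section prime_sums.
Context {R : realType}.
Implicit Types (x y : R) (f : nat -> R).

Lemma primes_le_sum_nat x f :
  primes_le_sum x f = \sum_(0 <= p < (Num.truncn x).+1 | prime p) f p.
Proof. by rewrite /primes_le_sum big_mkord. Qed.

Lemma primes_le_sum_split x y f : x <= y -> primes_le_sum y f =
  primes_le_sum x f + \sum_((Num.truncn x).+1 <= p < (Num.truncn y).+1 | prime p) f p.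
Proof.
move=> xy; rewrite !primes_le_sum_nat -big_cat_nat//.
by rewrite ltnS le_truncn.
Qed.

Lemma truncnS_le_gt x p : ((Num.truncn x).+1 <= p)%N -> x < p%:R.
Proof. by move=> xp; apply: lt_le_trans (truncnS_gt x) _; rewrite ler_nat. Qed.

Definition prime_list (A x : R) : seq nat :=
  [seq p <- iota 0 (Num.truncn x).+1 | prime p && (A < p%:R)].

Lemma prime_list_uniq A x : uniq (prime_list A x).
Proof. by rewrite filter_uniq// iota_uniq. Qed.

Lemma mem_prime_list A x p : 0 <= x ->
  (p \in prime_list A x) = [&& prime p, A < p%:R & p%:R <= x].
Proof.
move=> x0; rewrite mem_filter mem_iota add0n ltnS leq0n/= -andbA; congr [&& _, _ & _].
by rewrite truncn_ge_nat.
Qed.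

Lemma prime_list_admissible A x : admissible A (prime_list A x).
Proof. by move=> p; rewrite mem_filter => /andP[/andP[]]. Qed.

Lemma sum_prime_list A x f : (forall p, prime p -> p%:R <= A -> f p = 0) ->
  \sum_(p <- prime_list A x) f p = primes_le_sum x f.
Proof.
move=> f0; rewrite primes_le_sum_nat /index_iota subn0 big_filter.
rewrite [RHS](bigID (fun p => A < p%:R))/= [X in _ + X]big1 ?addr0// => p /andP[pp].
by rewrite -leNgt; exact: f0.
Qed.

End prime_sums.

Section densities.
Context {R : realType} {n : nat} {Omega : pointedType}.
Variables (A : R) (h : Omega -> R) (m : Omega -> {ffun 'I_n -> nat}).
Variable g : {ffun 'I_n -> nat} -> R.
Hypothesis height_finite : forall B : R, 0 <= B -> finite_set [set a | h a <= B].
Hypothesis h_ge0 : forall a, 0 <= h a.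
Hypothesis g_lim : forall d, pos_vec d -> rough A d ->
    (div_count h m d B)%:R / (height_count h B)%:R @[B --> +oo] --> g d.
Hypothesis g_ext : forall d, pos_vec d -> ~ rough A d -> g d = 0.

Lemma g_vec2_eq0 i j p : prime p -> p%:R <= A -> g (vec2 i j p) = 0.
Proof.
move=> pp pA; apply: g_ext; first by case: (supported_vec2 i j pp).
move=> /(_ p pp); rewrite ltNge pA (bigD1 i)//= ffunE eqxx dvdn_mulr//.
by move=> /(_ isT).
Qed.

Lemma g_vec1_eq0 i p : prime p -> p%:R <= A -> g (vec1 i p) = 0.
Proof. by move=> pp pA; rewrite -vec2_diag g_vec2_eq0. Qed.

Lemma g_vec1_itv i p : prime p -> 0 <= g (vec1 i p) <= 1.
Proof.
move=> pp; have [pA|Ap] := leP p%:R A; first by rewrite g_vec1_eq0// lexx ler01.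
by apply: (g_vec1_ge0_le1 height_finite h_ge0 g_lim) => q; rewrite inE => /eqP ->.
Qed.

Local Notation S i x := (primes_le_sum x (fun p => g (vec1 i p))).

Variables c c' : 'I_n -> R.
Hypothesis c_gt0 : forall i, 0 < c i.
Hypothesis g_sq_tail : forall i, exists C : R, \forall T \near +oo%R,
    (\sum_(0 <= p <oo | prime p && (T < p%:R)%R) (g (vec1 i p) ^+ 2)%:E
       <= (C / ln T)%:E)%E.
Hypothesis g_mertens : forall i, exists C : R, \forall T \near +oo%R,
    `|primes_le_sum T (fun p => g (vec1 i p)) - (c i * ln (ln T) + c' i)|
      <= C / ln T.

Lemma mertens_bounded i : exists C, \forall T \near +oo,
  `|S i T - c i * ln (ln T)| <= C.
Proof.
have [C HC] := g_mertens i; exists (`|C| + `|c' i|).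
have ln1 : \forall T \near +oo, 1 <= ln (T : R).
  by apply: cvgry_ge; apply: cvgry_ln; exact: cvg_id.
apply: filterS2 HC ln1 => T HT T1.
rewrite (_ : _ - _ = (S i T - (c i * ln (ln T) + c' i)) + c' i); last by ring.
apply: le_trans (ler_normD _ _) _; rewrite lerD2r; apply: le_trans HT _.
apply: le_trans (ler_norm _) _; rewrite normrM ler_piMr//.
by rewrite normfV ger0_norm ?invf_le1//; lra.
Qed.

(** The tail bound at a single [T0] suffices, as the primes up to [T0] contribute a fixed sum. *)
Lemma sum_sqr_bounded i : exists C, \forall T \near +oo,
  primes_le_sum T (fun p => g (vec1 i p) ^+ 2) <= C.
Proof.
have [C HC] := g_sq_tail i.
have [T0 HT0] : exists T0 : R, (\sum_(0 <= p <oo | prime p && (T0 < p%:R)%R)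
    (g (vec1 i p) ^+ 2)%:E <= (C / ln T0)%:E)%E.
  by near (+oo : set_system R) => T0; exists T0; near: T0.
exists (primes_le_sum T0 (fun p => g (vec1 i p) ^+ 2) + C / ln T0).
near=> T; have T0T : T0 <= T by near: T; exact: nbhs_pinfty_ge (num_real _).
rewrite (primes_le_sum_split _ T0T) lerD2l -lee_fin -sumEFin.
apply: le_trans HT0.
apply: le_trans (nneseries_lim_ge (Num.truncn T).+1 _); last by move=> p _ _; rewrite lee_fin sqr_ge0.
rewrite [leRHS](@big_cat_nat _ _ _ (Num.truncn T0).+1)//=; last by rewrite ltnS le_truncn.
rewrite [X in (X <= _)%E](_ : _ = \sum_((Num.truncn T0).+1 <= p < (Num.truncn T).+1
    | prime p && (T0 < p%:R)%R) (g (vec1 i p) ^+ 2)%:E)%E.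
  by rewrite leeDr// sume_ge0// => p _; rewrite lee_fin sqr_ge0.
rewrite [LHS]big_nat_cond [RHS]big_nat_cond; apply: eq_bigl => p.
case: (boolP ((Num.truncn T0).+1 <= p)%N) => //= pT.
by rewrite (truncnS_le_gt pT) andbT.
Unshelve. all: by end_near. Qed.

(** Otherwise [S i T] would stay below [S i M], against its growth like [c i * ln (ln T)]. *)
Lemma exists_prime_g_gt0 i (M : R) : exists p, [/\ prime p, M < p%:R & 0 < g (vec1 i p)].
Proof.
apply: contrapT => no.
have [C HC] := mertens_bounded i.
have ll : ln (ln T) @[T --> (+oo : set_system R)] --> +oo.
  by do 2 apply: cvgry_ln; exact: cvg_id.
have big : \forall T \near +oo, (C + S i M) / c i < ln (ln (T : R)) by exact: cvgry_gt.
near (+oo : set_system R) => T.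
have MT : M <= T by near: T; exact: nbhs_pinfty_ge (num_real _).
have h1 : `|S i T - c i * ln (ln T)| <= C by near: T.
have h2 : (C + S i M) / c i < ln (ln T) by near: T.
have : S i T <= S i M.
  rewrite (primes_le_sum_split _ MT) gerDl big_nat_cond; apply: sumr_le0 => p /andP[/andP[Mp _] pp].
  by rewrite leNgt; apply/negP => gp; apply: no; exists p; split=> //; exact: truncnS_le_gt.
move: h1 h2; rewrite ler_norml ltr_pdivrMr// => /andP[h1 _]; rewrite mulrC.
by lra.
Unshelve. all: by end_near. Qed.

Variable F : R -> R.
Hypothesis m_le_F : (set_card [set a | h a <= B /\ (\max_i m a i)%:R <= F B])%:R
              / (height_count h B)%:R @[B --> +oo] --> (1 : R).

Definition small B (a : Omega) : bool := (\max_i m a i)%:R <= F B.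

Lemma cvg_avg_small : avg h B (fun a => (small B a)%:R) @[B --> +oo] --> (1 : R).
Proof.
apply: cvg_trans m_le_F; apply: near_eq_cvg; apply: nearW => B.
by rewrite -(@set_card_avg R Omega h height_finite h_ge0 B [set a | (\max_i m a i)%:R <= F B]).
Qed.

Hypothesis n_gt0 : (0 < n)%N.
Hypothesis m_pos : forall a, pos_vec (m a).

(** If [F B <= M], an element counted by [small] has positive entries below the prime [p > M], so
    [p] does not divide them. Yet [p] divides [m a i0] with positive density, while almost all
    elements are small. *)
Lemma cvg_F : F B @[B --> +oo] --> +oo.
Proof.
apply/cvgryPgt => M; pose i0 : 'I_n := Ordinal n_gt0.
have [p [pp Mp gp]] := exists_prime_g_gt0 i0 (Num.max M A).
have /andP[Mp1 Ap] : (M < p%:R) && (A < p%:R) by rewrite -gt_max.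
have admp : admissible A [:: p] by move=> q; rewrite inE => /eqP ->.
have h1 := cvg_mean height_finite h_ge0 g_lim admp (@depends_on_dvd_ind R n Omega m i0 p).
rewrite (mean_dvd_ind height_finite h_ge0 g_lim admp) in h1.
have h2 : \forall B \near +oo, g (vec1 i0 p) / 2 < avg h B (dvd_ind m i0 p).
  by apply: (cvgr_gt _ h1); rewrite ltr_pdivrMr// ltr_pMr// ltr1n.
have h3 : \forall B \near +oo, 1 - g (vec1 i0 p) / 2 < avg h B (fun a => (small B a)%:R).
  by apply: (cvgr_gt _ cvg_avg_small); rewrite ltrBlDr ltrDl divr_gt0.
have N0 := near_height_count height_finite h_ge0.
near=> B; rewrite ltNge; apply/negP => FM.
have N0B : (0 < height_count h B)%N by near: B.
have h2B : g (vec1 i0 p) / 2 < avg h B (dvd_ind m i0 p) by near: B.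
have h3B : 1 - g (vec1 i0 p) / 2 < avg h B (fun a => (small B a)%:R) by near: B.
have : avg h B (fun a => (small B a)%:R + dvd_ind m i0 p a) <= avg h B (fun=> 1).
  apply: ler_avg => a; rewrite /dvd_ind -natrD (ler_nat R _ 1).
  rewrite /small; case: leP => //= mF; last by case: (_ %| _)%N.
  rewrite gtnNdvd//; first by have := m_pos a i0; case: (m a i0).
  rewrite -(ltr_nat R); apply: le_lt_trans Mp1; apply: le_trans FM; apply: le_trans mF.
  by rewrite ler_nat; exact: leq_bigmax.
by rewrite avgD avg_cst//; lra.
Unshelve. all: by end_near. Qed.

End densities.

(** * Asymptotics of the weights, variances and remainders *)

Section parameters.
Context {R : realType} {n : nat} {Omega : pointedType}.
Variables (A : R) (h : Omega -> R) (m : Omega -> {ffun 'I_n -> nat}).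
Variable g : {ffun 'I_n -> nat} -> R.
Hypothesis height_finite : forall B : R, 0 <= B -> finite_set [set a | h a <= B].
Hypothesis h_ge0 : forall a, 0 <= h a.
Hypothesis g_lim : forall d, pos_vec d -> rough A d ->
    (div_count h m d B)%:R / (height_count h B)%:R @[B --> +oo] --> g d.
Hypothesis g_mul : forall a b, pos_vec a -> pos_vec b -> rough A a -> rough A b ->
    coprime (\prod_i a i) (\prod_i b i) -> g (vec_mul a b) = g a * g b.
Hypothesis g_ext : forall d, pos_vec d -> ~ rough A d -> g d = 0.
Variables c c' : 'I_n -> R.
Hypothesis c_gt0 : forall i, 0 < c i.
Hypothesis g_sq_tail : forall i, exists C : R, \forall T \near +oo%R,
    (\sum_(0 <= p <oo | prime p && (T < p%:R)%R) (g (vec1 i p) ^+ 2)%:E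
       <= (C / ln T)%:E)%E.
Hypothesis g_mertens : forall i, exists C : R, \forall T \near +oo%R,
    `|primes_le_sum T (fun p => g (vec1 i p)) - (c i * ln (ln T) + c' i)|
      <= C / ln T.
Variable F : R -> R.
Hypothesis Fy : F B @[B --> +oo] --> +oo.
Variable sigma : 'M[R]_n.
Hypothesis sigma_lim : forall i j,
    primes_le_sum T (fun p => g (vec2 i j p))
      / (Num.sqrt (primes_le_sum T (fun p => g (vec1 i p)))
         * Num.sqrt (primes_le_sum T (fun p => g (vec1 j p))))
      @[T --> +oo] --> sigma i j.

Local Notation L := (loglog F).
Local Notation l := (logloglog F).
Local Notation z := (cutoff F).
Local Notation S i x := (primes_le_sum x (fun p => g (vec1 i p))).

Definition sieve_primes B : seq nat := prime_list A (z B).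

Definition weight (t : 'I_n -> R) B i : R := t i / Num.sqrt (c i * L B).

Lemma near_loglog_gt0 : \forall B \near +oo, 0 < L B.
Proof. by apply: cvgry_gt; exact: cvg_loglog. Qed.

(** The difference is [O(1) + c i * l], and [l = o(sqrt L)]. This precision, beyond the ratio of the
    two, is what permits a change of centring. *)
Lemma cvg_S_sub i : (S i (z B) - c i * L B) / Num.sqrt (L B) @[B --> +oo] --> (0 : R).
Proof.
have [C HC] := mertens_bounded g_mertens i.
have HCz : \forall B \near +oo, `|S i (z B) - c i * ln (ln (z B))| <= C.
  exact: (cvg_cutoff Fy) HC.
apply: (@cvgr0_le _ _ _ _ (fun B => `|C| * (Num.sqrt (L B))^-1 + c i * (l B / Num.sqrt (L B)))).
  rewrite [X in _ --> X](_ : _ = `|C| * 0 + c i * 0); last by ring.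
  apply: cvgD; apply: cvgM; try exact: cvg_cst; last exact: cvg_logloglog_div_sqrt.
  by apply: cvgr0_inv; apply: cvgry_sqrt; exact: cvg_loglog.
near=> B.
have HB : `|S i (z B) - c i * ln (ln (z B))| <= C by near: B.
have [_ _ lz] : [/\ 0 < ln (z B) , 0 < cutoff_exponent F B & `|ln (ln (z B)) - L B| <= l B].
  by near: B; exact: near_loglog_cutoff.
have s0 : 0 <= (Num.sqrt (L B))^-1 by rewrite invr_ge0 sqrtr_ge0.
rewrite normrM (ger0_norm s0) mulrA -mulrDl ler_wpM2r//.
rewrite (_ : _ - _ = (S i (z B) - c i * ln (ln (z B))) + c i * (ln (ln (z B)) - L B)); last by ring.
apply: le_trans (ler_normD _ _) _; apply: lerD; first exact: le_trans HB (ler_norm _).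
by rewrite normrM gtr0_norm// ler_wpM2l// ltW.
Unshelve. all: by end_near. Qed.

Lemma cvg_S_ratio i : S i (z B) / L B @[B --> +oo] --> c i.
Proof.
have h0 : ((S i (z B) - c i * L B) / Num.sqrt (L B)) * (Num.sqrt (L B))^-1 + c i
    @[B --> +oo] --> c i.
  rewrite -[X in _ --> X]add0r -[X in X + _](mulr0 0).
  apply: cvgD; last exact: cvg_cst.
  apply: cvgM; first exact: cvg_S_sub.
  by apply: cvgr0_inv; apply: cvgry_sqrt; exact: cvg_loglog.
apply: cvg_trans h0; apply: near_eq_cvg.
apply: filterS near_loglog_gt0 => B L0.
rewrite -mulrA -invfM -expr2 sqr_sqrtr ?(ltW L0)// mulrBl mulfK ?gt_eqF// subrK//.
Qed.

Lemma cvg_weight t i : weight t B i @[B --> +oo] --> (0 : R).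
Proof.
rewrite -(mulr0 (t i)); apply: cvgM; first exact: cvg_cst.
apply: cvgr0_inv; apply: cvgry_sqrt; apply: gt0_cvgMry => //; exact: cvg_loglog.
Qed.

Lemma weight_mul t B i j : 0 < L B ->
  weight t B i * weight t B j = t i * t j / (Num.sqrt (c i) * Num.sqrt (c j)) / L B.
Proof.
move=> L0; rewrite /weight !sqrtrM ?(ltW (c_gt0 _))//.
have s0 : Num.sqrt (L B) != 0 by rewrite gt_eqF// sqrtr_gt0.
have [ci cj] : Num.sqrt (c i) != 0 /\ Num.sqrt (c j) != 0.
  by rewrite !gt_eqF ?sqrtr_gt0.
rewrite -[X in _ = _ / X](@sqr_sqrtr _ (L B)) ?(ltW L0)//.
by field; rewrite ci cj s0.
Qed.

Lemma cvg_pair_sum i j : primes_le_sum (z B) (fun p => g (vec2 i j p)) / L B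
  @[B --> +oo] --> sigma i j * (Num.sqrt (c i) * Num.sqrt (c j)).
Proof.
have sq k : Num.sqrt (S k (z B) / L B) @[B --> +oo] --> Num.sqrt (c k).
  apply: (@continuous_cvg _ _ _ _ _ _ (@Num.sqrt R)); first exact: sqrt_continuous.
  exact: cvg_S_ratio.
have Sk k : \forall B \near +oo, 0 < S k (z B) / L B.
  by apply: (cvgr_gt (c k)); first exact: cvg_S_ratio.
(* The limit defining [sigma] is taken along [T = z B], and its normalization is converted to [L] by
   [S k (z B) / L B --> c k]. *)
have h0 : (primes_le_sum (z B) (fun p => g (vec2 i j p)) / (Num.sqrt (S i (z B)) * Num.sqrt (S j (z B))))
    * (Num.sqrt (S i (z B) / L B) * Num.sqrt (S j (z B) / L B)) @[B --> +oo]
    --> sigma i j * (Num.sqrt (c i) * Num.sqrt (c j)).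
  by apply: cvgM; [exact: (cvg_comp _ _ (cvg_cutoff Fy) (@sigma_lim i j))|exact: cvgM].
apply: cvg_trans h0; apply: near_eq_cvg; near=> B => /=.
have L0 : 0 < L B by near: B; exact: near_loglog_gt0.
have Si : 0 < S i (z B) / L B by near: B; exact: Sk.
have Sj : 0 < S j (z B) / L B by near: B; exact: Sk.
rewrite pmulr_lgt0 ?invr_gt0// in Si; rewrite pmulr_lgt0 ?invr_gt0// in Sj.
rewrite !sqrtrM ?ltW// sqrtrV ?ltW//.
rewrite -[X in _ = _ / X](@sqr_sqrtr _ (L B)) ?(ltW L0)//.
have s0 : Num.sqrt (L B) != 0 by rewrite gt_eqF// sqrtr_gt0.
have si : Num.sqrt (S i (z B)) != 0 by rewrite gt_eqF// sqrtr_gt0.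
have sj : Num.sqrt (S j (z B)) != 0 by rewrite gt_eqF// sqrtr_gt0.
by field; rewrite s0 si sj.
Unshelve. all: by end_near. Qed.

(** By [x * y <= x ^ 2 + y ^ 2] the sums are bounded, since the squares of the densities are
    summable; the products of means therefore vanish from the limiting variance. *)
Lemma cvg_product_sum i j : primes_le_sum (z B) (fun p => g (vec1 i p) * g (vec1 j p)) / L B
  @[B --> +oo] --> (0 : R).
Proof.
have [Ci HCi] := sum_sqr_bounded g_sq_tail i.
have [Cj HCj] := sum_sqr_bounded g_sq_tail j.
have Hi : \forall B \near +oo, primes_le_sum (z B) (fun p => g (vec1 i p) ^+ 2) <= Ci.
  exact: (cvg_cutoff Fy) HCi.
have Hj : \forall B \near +oo, primes_le_sum (z B) (fun p => g (vec1 j p) ^+ 2) <= Cj.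
  exact: (cvg_cutoff Fy) HCj.
apply: (@cvgr0_le _ _ _ _ (fun B => (Ci + Cj) * (L B)^-1)).
  rewrite -(mulr0 (Ci + Cj)); apply: cvgM; first exact: cvg_cst.
  by apply: cvgr0_inv; exact: cvg_loglog.
near=> B.
have L0 : 0 < L B by near: B; exact: near_loglog_gt0.
have HiB : primes_le_sum (z B) (fun p => g (vec1 i p) ^+ 2) <= Ci by near: B.
have HjB : primes_le_sum (z B) (fun p => g (vec1 j p) ^+ 2) <= Cj by near: B.
have g0 k p : prime p -> 0 <= g (vec1 k p).
  by move=> pp; case/andP: (g_vec1_itv height_finite h_ge0 g_lim g_ext k pp).
rewrite ger0_norm; last first.
  rewrite divr_ge0//; last exact: ltW.
  by apply: sumr_ge0 => p pp; rewrite mulr_ge0 ?g0.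
rewrite ler_wpM2r ?invr_ge0 ?(ltW L0)//; apply: le_trans (lerD HiB HjB).
rewrite /primes_le_sum -big_split/=; apply: ler_sum => p pp.
have := g0 i _ pp; have := g0 j _ pp; set x := g _; set y := g _ => x0 y0.
have := sqr_ge0 (x - y); rewrite sqrrB; have := mulr_ge0 x0 y0; rewrite mulr2n; nra.
Unshelve. all: by end_near. Qed.

Definition quadratic_form (t : 'I_n -> R) : R := \sum_i \sum_j t i * t j * sigma i j.

Lemma cvg_variance t : \sum_(p <- sieve_primes B) local_variance g (weight t B) p
  @[B --> +oo] --> quadratic_form t.
Proof.
have h0 : \sum_i \sum_j t i * t j / (Num.sqrt (c i) * Num.sqrt (c j)) *
    (primes_le_sum (z B) (fun p => g (vec2 i j p)) / L B
     - primes_le_sum (z B) (fun p => g (vec1 i p) * g (vec1 j p)) / L B)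
    @[B --> +oo] --> quadratic_form t.
  apply: cvg_sumr => i; apply: cvg_sumr => j.
  have cij : Num.sqrt (c i) * Num.sqrt (c j) != 0.
    by rewrite mulf_neq0// gt_eqF ?sqrtr_gt0.
  rewrite [X in _ --> X](_ : _ = t i * t j / (Num.sqrt (c i) * Num.sqrt (c j)) *
    (sigma i j * (Num.sqrt (c i) * Num.sqrt (c j)) - 0)); last first.
    by rewrite subr0 mulrACA [X in _ = _ * X]mulrC mulrA mulfK// -!mulrA.
  apply: cvgM; first exact: cvg_cst.
  by apply: cvgB; [exact: cvg_pair_sum|exact: cvg_product_sum].
apply: cvg_trans h0; apply: near_eq_cvg.
apply: filterS near_loglog_gt0 => B L0.
rewrite /local_variance [RHS]exchange_big/=; apply: eq_bigr => i _.
rewrite [RHS]exchange_big/=; apply: eq_bigr => j _.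
rewrite -mulr_sumr weight_mul// sumrB.
rewrite !sum_prime_list => [|p pp pA|p pp pA]; last 2 first.
- by rewrite (g_vec1_eq0 g_ext)// mul0r.
- exact: (g_vec2_eq0 g_ext).
by rewrite -mulrBl [RHS]mulrAC -[RHS]mulrA.
Qed.

Lemma total_shiftE t B : total_shift g (weight t B) (sieve_primes B) =
  \sum_i weight t B i * S i (z B).
Proof.
rewrite /total_shift exchange_big/=; apply: eq_bigr => i _.
by rewrite -mulr_sumr sum_prime_list// => p pp pA; rewrite (g_vec1_eq0 g_ext).
Qed.

(** A crude bound is enough, since any power of [L] can be absorbed: the weights tend to 0 and the
    Mertens sums are of order [L]. *)
Lemma near_total_shift t : \forall B \near +oo,
  `|total_shift g (weight t B) (sieve_primes B)| <= L B.
Proof.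
have h0 : \sum_i weight t B i * (S i (z B) / L B) @[B --> +oo] --> (0 : R).
  rewrite [X in _ --> X](_ : _ = \sum_i 0 * c i); last by rewrite big1// => i _; rewrite mul0r.
  by apply: cvg_sumr => i; apply: cvgM; [exact: cvg_weight|exact: cvg_S_ratio].
have h1 : \forall B \near +oo, `|\sum_i weight t B i * (S i (z B) / L B)| < 1.
  by apply: (cvgr_lt _ (cvg_norm h0)); rewrite normr0.
apply: filterS2 near_loglog_gt0 h1 => B L0.
rewrite (_ : \sum_i _ = total_shift g (weight t B) (sieve_primes B) / L B); last first.
  by rewrite total_shiftE mulr_suml; apply: eq_bigr => i _; rewrite mulrA.
by rewrite normrM normfV (gtr0_norm L0) ltr_pdivrMr// mul1r => /ltW.
Qed.

Hypothesis level_of_distribution : let eps B := ln (ln (ln (F B))) / Num.sqrt (ln (ln (F B))) in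
    forall gamma : R, 0 < gamma -> exists C : R, \forall B \near +oo%R,
      \sum_(d \in [set d | [/\ pos_vec d, (\max_i d i)%:R <= F B `^ eps B
                            & rough A d]])
         (\prod_i (mobius (d i))%:~R ^+ 2) * `|remainder h m g d B|
      <= C * ((height_count h B)%:R / ln (ln (F B)) `^ gamma).

Definition level B : R := F B `^ (l B / Num.sqrt (L B)).

Lemma cvg_level t k : (1 + `|total_shift g (weight t B) (sieve_primes B)|) ^+ k *
    (level_sum A h m g (level B) B / (height_count h B)%:R) @[B --> +oo] --> (0 : R).
Proof.
(* The exponent [k + 1] beats the factor [(2 L) ^ k] coming from the shift by one power of [L]. *)
have [C HC] := level_of_distribution (ltr0Sn R k).
have N0 := near_height_count height_finite h_ge0.
apply: (@cvgr0_le _ _ _ _ (fun B => 2 ^+ k * `|C| * (L B)^-1)).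
  rewrite -[X in _ --> X](mulr0 (2 ^+ k * `|C|)); apply: cvgM; first exact: cvg_cst.
  by apply: cvgr0_inv; exact: cvg_loglog.
near=> B.
have [_ _ L1 _] : [/\ 1 < F B, 1 <= ln (F B), 1 <= L B & 1 <= l B] by near: B; exact: near_scales.
have L0 : 0 < L B by apply: lt_le_trans L1.
have N0B : 0 < (height_count h B)%:R :> R by rewrite ltr0n; near: B.
have GL : `|total_shift g (weight t B) (sieve_primes B)| <= L B.
  by near: B; exact: near_total_shift.
have lv : level_sum A h m g (level B) B <= C * ((height_count h B)%:R / L B `^ k.+1%:R).
  by near: B; exact: HC.
have lv0 := level_sum_ge0 A h m g level B.
rewrite ger0_norm; last by rewrite mulr_ge0// exprn_ge0// addr_ge0.
apply: (@le_trans _ _ ((2 * L B) ^+ k * (`|C| / L B ^+ k.+1))).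
  have G0 := normr_ge0 (total_shift g (weight t B) (sieve_primes B)).
  apply: ler_pM => //.
    rewrite lerXn2r ?nnegrE ?addr_ge0 ?mulr_ge0 ?(ltW L0)//.
    by move: GL L1; lra.
  rewrite ler_pdivrMr//; apply: le_trans lv _; rewrite powR_mulrn ?(ltW L0)//.
  rewrite mulrAC -mulrA ler_wpM2r ?ler_norm//.
  by rewrite mulr_ge0 ?invr_ge0 ?exprn_ge0 ?(ltW L0).
rewrite (_ : _ * (_ / _) = 2 ^+ k * `|C| / L B)//.
by rewrite exprMn exprS; field; rewrite expf_neq0 gt_eqF.
Unshelve. all: by end_near. Qed.

Let us B : uniq (sieve_primes B). Proof. exact: prime_list_uniq. Qed.

Let adm B : admissible A (sieve_primes B). Proof. exact: prime_list_admissible. Qed.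

Let z1 : \forall B \near +oo, 1 <= z B. Proof. by apply: cvgry_ge; exact: cvg_cutoff. Qed.

Let sz : \forall B \near +oo, forall p, p \in sieve_primes B -> p%:R <= z B.
Proof.
apply: filterS z1 => B zB p; rewrite mem_prime_list; last exact: le_trans zB.
by case/and3P.
Qed.

Let delta0 t : \sum_i `|weight t B i| @[B --> +oo] --> (0 : R).
Proof.
rewrite [X in _ --> X](_ : _ = \sum_(i < n) 0); last by rewrite big1.
by apply: cvg_sumr => i; rewrite -(normr0 R); apply: cvg_norm; exact: cvg_weight.
Qed.

Lemma cvg_avg_cos_sieve t theta :
  avg h B (fun a => cos (total (local_term m g (weight t B)) (sieve_primes B) a + theta))
    @[B --> +oo] --> expR (- (quadratic_form t / 2)) * cos theta.
Proof.
exact: (cvg_avg_cos height_finite h_ge0 g_lim g_mul us (@adm) z1 sz (cutoff_level Fy)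
  (@cvg_level t) (@delta0 t) (@cvg_variance t)).
Qed.

Lemma avg_sqr_sieve_bounded t : exists C, \forall B \near +oo,
  avg h B (fun a => total (local_term m g (weight t B)) (sieve_primes B) a ^+ 2) <= C.
Proof.
exact: (avg_sqr_bounded height_finite h_ge0 g_lim g_mul us (@adm) z1 sz (cutoff_level Fy)
  (@cvg_level t) (@delta0 t) (@cvg_variance t)).
Qed.

(** It is the limit of the variances of the linear statistics, which are nonnegative. *)
Lemma quadratic_form_ge0 t : 0 <= quadratic_form t.
Proof.
apply: (ler_cvg_to (@cvg_cst _ (0 : R) _ _ _) (@cvg_variance t)).
have d1 : \forall B \near +oo, \sum_i `|weight t B i| < 1 by exact: (cvgr_lt _ (@delta0 t)).
apply: filterS d1 => B d1.
have d01 : 0 <= \sum_i `|weight t B i| <= 1 by rewrite (ltW d1) andbT sumr_ge0.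
have := total_variance_ge0 height_finite h_ge0 g_lim d01 (@adm B)
  (local_terms_local_term height_finite h_ge0 g_lim (weight t B) (@adm B)).
by rewrite (total_variance_local_term height_finite h_ge0 g_lim _ (@adm B)).
Qed.

Lemma sigma_sym i j : sigma i j = sigma j i.
Proof.
apply: cvg_unique (@sigma_lim i j) _ => //.
apply: cvg_trans (@sigma_lim j i); apply: near_eq_cvg; apply: nearW => T.
rewrite mulrC [Num.sqrt _ * _]mulrC mulrC; congr (_ / _); apply: eq_bigr => p _.
by congr g; apply/ffunP => k; rewrite !ffunE orbC.
Qed.

End parameters.
(** * Large primes and normalization *)

Section large_primes.
Context {R : realType}.

(* The primes outside [(A, z]]: at most [|A| + 1] of them are small, and the [r]
   large ones satisfy [z ^ r <= k]. *)
Lemma omega_sub_le (A z x : R) k : 1 < z -> (0 < k)%N -> (k%:R : R) <= x ->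
  0 <= (omega k)%:R - \sum_(p <- prime_list A z) ((p %| k)%N%:R : R)
    <= `|A| + 1 + ln x / ln z.
Proof.
move=> z1 k0 kx; have z0 : 0 < z by apply: lt_trans z1.
have lz : 0 < ln z by rewrite ln_gt0.
have x0 : 0 < x by apply: lt_le_trans kx; rewrite ltr0n.
pose inl p := p \in prime_list A z.
have memE p : inl p = [&& prime p, A < p%:R & p%:R <= z] by apply: mem_prime_list; exact: ltW.
have -> : \sum_(p <- prime_list A z) (p %| k)%N%:R = (count inl (primes k))%:R :> R.
  have -> : \sum_(p <- prime_list A z) (p %| k)%N%:R = (count (dvdn^~ k) (prime_list A z))%:R :> R.
    by rewrite -sum1_count natr_sum [RHS]big_mkcond/=; apply: eq_bigr => p _; case: (p %| k)%N.
  congr _%:R; rewrite -!size_filter; apply/perm_size/uniq_perm.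
  - exact/filter_uniq/prime_list_uniq.
  - exact/filter_uniq/primes_uniq.
  - move=> p; rewrite [LHS]mem_filter [RHS]mem_filter mem_primes k0 -/(inl p) memE.
    by case: (prime p); rewrite ?andbF//= andbC.
rewrite /omega -(count_predC inl) natrD addrAC subrr add0r ler0n/=.
pose big p := z < p%:R; pose sm p := p%:R <= A.
apply: (@le_trans _ _ ((count sm (primes k))%:R + (count big (primes k))%:R)).
  rewrite -natrD ler_nat -count_predUI; apply: leq_trans (leq_addr _ _).
  rewrite -!size_filter; apply: uniq_leq_size; first exact/filter_uniq/primes_uniq.
  move=> p; rewrite !mem_filter => /andP[/= np pk].
  rewrite pk andbT; move: np; rewrite memE.
  by move: pk; rewrite mem_primes => /andP[-> _]; rewrite /= negb_and -leNgt -ltNge.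
apply: lerD.
  apply: (@le_trans _ _ (Num.truncn `|A|).+1%:R); last first.
    by rewrite -natr1 lerD2r truncn_le.
  rewrite ler_nat -size_filter -[leqRHS](size_iota 0); apply: uniq_leq_size.
    exact/filter_uniq/primes_uniq.
  move=> p; rewrite mem_filter mem_iota => /andP[pA _]; rewrite leq0n add0n ltnS.
  by rewrite truncn_ge_nat// (le_trans pA)// ler_norm.
rewrite ler_pdivlMr// mulr_natl -lnXn// ler_ln ?posrE ?exprn_gt0//.
apply: le_trans kx; apply: (@le_trans _ _ (\prod_(p <- primes k | big p) p)%:R).
  rewrite natr_prod -big_filter -size_filter.
  rewrite -[X in z ^+ X]count_predT -iter_mulr_1 -big_const_seq.
  rewrite big_seq [leRHS]big_seq; apply: ler_prod => p.
  by rewrite mem_filter => /andP[/ltW zp _]; rewrite zp ltW.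
rewrite ler_nat; apply: dvdn_leq => //.
rewrite (dvdn_prod_coprime (p := id)) ?primes_uniq//.
  by apply/allP => p; rewrite mem_primes => /and3P[_ _ pk]; rewrite pk implybT.
move=> p q; rewrite !mem_primes => /and3P[pp _ _] /and3P[qq _ _] _ _ pq.
by rewrite prime_coprime// dvdn_prime2.
Qed.

End large_primes.

(** * Replacing a random vector by a nearby one *)

Section transfer.
Context {R : realType} {n : nat} {Omega : pointedType}.
Variable h : Omega -> R.
Hypothesis height_finite : forall B : R, 0 <= B -> finite_set [set a | h a <= B].
Hypothesis h_ge0 : forall a, 0 <= h a.
Variables (X Y : R -> Omega -> 'rV[R]_n) (good : R -> Omega -> bool) (r : R -> R).
Hypothesis good1 : avg h B (fun a => (good B a)%:R) @[B --> +oo] --> (1 : R).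
Hypothesis r_ge0 : forall B, 0 <= r B.
Hypothesis r0 : r B @[B --> +oo] --> (0 : R).
Hypothesis XY : \forall B \near +oo, forall a, good B a -> `|X B a - Y B a| <= r B.

Lemma cvg_avg_bad : avg h B (fun a => (~~ good B a)%:R) @[B --> +oo] --> (0 : R).
Proof.
have h0 : 1 - avg h B (fun a => (good B a)%:R) @[B --> +oo] --> (0 : R).
  by rewrite -[X in _ --> X](subrr 1); apply: cvgB; [exact: cvg_cst|exact: good1].
apply: cvg_trans h0; apply: near_eq_cvg.
apply: filterS (near_height_count height_finite h_ge0) => B N0.
rewrite -[X in X - _](avg_cst 1 N0) -avgN -avgD.
by congr avg; apply/funext => a; case: (good B a); rewrite /= ?subrr ?subr0.
Qed.

(** On good elements the cosine changes by a Lipschitz estimate; the bad ones, of vanishing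
    proportion, cost at most 2 each. *)
Lemma transfer_cos t theta (l : R) :
  avg h B (fun a => cos (dot t (Y B a) + theta)) @[B --> +oo] --> l ->
  avg h B (fun a => cos (dot t (X B a) + theta)) @[B --> +oo] --> l.
Proof.
move=> Yl; pose W := \sum_i `|t ord0 i|.
have W0 : 0 <= W by exact: sumr_ge0.
have dif : avg h B (fun a => cos (dot t (X B a) + theta)) -
    avg h B (fun a => cos (dot t (Y B a) + theta)) @[B --> +oo] --> (0 : R).
  apply: (@cvgr0_le _ _ _ _ (fun B => W * r B + 2 * avg h B (fun a => (~~ good B a)%:R))).
    rewrite [X in _ --> X](_ : _ = W * 0 + 2 * 0); last by ring.
    by apply: cvgD; apply: cvgM; try exact: cvg_cst; [exact: r0|exact: cvg_avg_bad].
  apply: filterS2 (near_height_count height_finite h_ge0) XY => B N0 XYB.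
  rewrite -avgN -avgD.
  apply: (@le_trans _ _ (avg h B (fun a => W * r B + 2 * (~~ good B a)%:R))); last first.
    by rewrite avgD avg_cst// avgZ.
  apply: norm_avg_le => a; case: (boolP (good B a)) => /= ga; last first.
    apply: le_trans (ler_normB _ _) _; rewrite mulr1.
    have h1 := cos_max (dot t (X B a) + theta); have h2 := cos_max (dot t (Y B a) + theta).
    have := mulr_ge0 W0 (r_ge0 B); lra.
  rewrite mulr0 addr0; apply: le_trans (cos_lipschitz _ _) _.
  rewrite opprD addrACA subrr addr0 -sumrB; apply: le_trans (ler_norm_sum _ _ _) _.
  rewrite /W mulr_suml; apply: ler_sum => i _; rewrite -mulrBr normrM ler_wpM2l//.
  apply: le_trans (XYB a ga); have := coord_le_norm (X B a - Y B a) i.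
  by rewrite !mxE.
rewrite -[X in _ --> X]add0r.
apply: cvg_trans (cvgD dif Yl); apply: near_eq_cvg; apply: nearW => B /=.
by rewrite !fctE subrK.
Qed.

(** A Markov bound: on good elements the norm of [X] is at most [1 + \sum_i (1 + Y_i ^ 2)], and the
    second moments of [Y] are bounded. *)
Lemma transfer_tight :
  (forall i, exists C : R, \forall B \near +oo, avg h B (fun a => Y B a ord0 i ^+ 2) <= C) ->
  tight +oo (fun B f => avg h B (fun a => f (X B a))).
Proof.
move=> Yi; have [C HC] := choice Yi; pose D := \sum_i (1 + `|C i|).
have D0 : 0 <= D by apply: sumr_ge0 => i _; rewrite addr_ge0.
(* Since [(1 + D) / M = e / 3], the good elements contribute at most a third of [e], and the bad
   ones less than another third. *)
move=> e e0; pose M := 3 * (1 + D) / e.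
have M0 : 0 < M by rewrite divr_gt0// mulr_gt0//; lra.
exists M => //.
have bad : \forall B \near +oo, avg h B (fun a => (~~ good B a)%:R) < e / 3.
  by apply: (cvgr_lt _ cvg_avg_bad); rewrite divr_gt0.
have r1 : \forall B \near +oo, r B < 1 by exact: (cvgr_lt _ r0).
have HCB : \forall B \near +oo, forall i, avg h B (fun a => Y B a ord0 i ^+ 2) <= C i.
  by apply: filter_forall => i; exact: HC.
have N0 := near_height_count height_finite h_ge0.
near=> B.
have N0B : (0 < height_count h B)%N by near: B.
have r1B : r B < 1 by near: B.
have badB : avg h B (fun a => (~~ good B a)%:R) < e / 3 by near: B.
have HB : forall i, avg h B (fun a => Y B a ord0 i ^+ 2) <= C i by near: B.
have XYB : forall a, good B a -> `|X B a - Y B a| <= r B by near: B.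
apply: (@le_trans _ _ (avg h B (fun a => (~~ good B a)%:R +
    (M^-1 + M^-1 * \sum_i (1 + Y B a ord0 i ^+ 2))))).
  apply: ler_avg => a; rewrite /truncated_norm.
  have s0 : 0 <= \sum_i (1 + Y B a ord0 i ^+ 2).
    by apply: sumr_ge0 => i _; rewrite addr_ge0 ?sqr_ge0.
  have Mi : 0 <= M^-1 by rewrite invr_ge0 ltW.
  case: (boolP (good B a)) => /= ga; last by rewrite ge_min lerDl addr_ge0 ?mulr_ge0.
  rewrite add0r ge_min -[X in _ + X](mulrC) -[X in X + _]mul1r -mulrDl ler_wpM2r ?orbT//.
  rewrite -[X B a](subrK (Y B a)); apply: le_trans (ler_normD _ _) _.
  apply: lerD; first by apply: le_trans (XYB a ga) (ltW r1B).
  apply: norm_rV_le => // i; rewrite (bigD1 i)//=.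
  set y := Y B a ord0 i; apply: (@le_trans _ _ (1 + y ^+ 2)); last first.
    by rewrite lerDl sumr_ge0// => j _; rewrite addr_ge0 ?sqr_ge0.
  by rewrite -(real_normK (num_real y)); have := sqr_ge0 (`|y| - 1); nra.
rewrite avgD avgD avg_cst// avgZ avg_sum.
have : \sum_i avg h B (fun a => 1 + Y B a ord0 i ^+ 2) <= D.
  apply: ler_sum => i _; rewrite avgD avg_cst// lerD2l.
  exact: le_trans (HB i) (ler_norm _).
set s := \sum_i _ => sD.
have : M^-1 + M^-1 * s <= e / 3.
  rewrite -[X in X + _]mulr1 -mulrDr /M invf_div mulrAC ler_pdivrMr; last by lra.
  rewrite [leRHS](_ : _ = e * (1 + D)); last by field.
  by rewrite ler_wpM2l ?(ltW e0)// lerD2l.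
lra.
Unshelve. all: by end_near. Qed.

End transfer.

(** * From the number of prime divisors to sieved sums *)

Section normalized_counts.
Context {R : realType} {n : nat} {Omega : pointedType}.
Variables (A : R) (m : Omega -> {ffun 'I_n -> nat}).
Hypothesis m_pos : forall a, pos_vec (m a).
Variable g : {ffun 'I_n -> nat} -> R.
Hypothesis g_ext : forall d, pos_vec d -> ~ rough A d -> g d = 0.
Variables c c' : 'I_n -> R.
Hypothesis c_gt0 : forall i, 0 < c i.
Hypothesis g_mertens : forall i, exists C : R, \forall T \near +oo%R,
    `|primes_le_sum T (fun p => g (vec1 i p)) - (c i * ln (ln T) + c' i)|
      <= C / ln T.
Variable F : R -> R.
Hypothesis Fy : F B @[B --> +oo] --> +oo.

Local Notation L := (loglog F).
Local Notation z := (cutoff F).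
Local Notation S i x := (primes_le_sum x (fun p => g (vec1 i p))).

Definition normalized_omega B a : 'rV[R]_n :=
  \row_i (((omega (m a i))%:R - c i * L B) / Num.sqrt (c i * L B)).

Definition normalized_sieve B a : 'rV[R]_n :=
  \row_i ((\sum_(p <- sieve_primes A F B) (dvd_ind m i p a - g (vec1 i p)))
    / Num.sqrt (c i * L B)).

Lemma dot_normalized_sieve t B a : dot t (normalized_sieve B a) =
  total (local_term m g (weight c F (fun i => t ord0 i) B)) (sieve_primes A F B) a.
Proof.
rewrite /total exchange_big/=; apply: eq_bigr => i _.
by rewrite mxE mulr_suml mulr_sumr; apply: eq_bigr => p _; rewrite /weight; ring.
Qed.

(** Three errors per coordinate: the primes up to [A], the primes beyond [z], and the change of
    centring from [c i * L] to the sum of the densities. *)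
Definition truncation_error B : R :=
  \sum_i (`|A| + 1 + (cutoff_exponent F B)^-1 + `|S i (z B) - c i * L B|)
    / Num.sqrt (c i * L B).

Lemma truncation_error_term_ge0 B i :
  0 <= (`|A| + 1 + (cutoff_exponent F B)^-1 + `|S i (z B) - c i * L B|)
    / Num.sqrt (c i * L B).
Proof. by rewrite !(addr_ge0, divr_ge0, mulr_ge0, invr_ge0, sqrtr_ge0). Qed.

Lemma truncation_error_ge0 B : 0 <= truncation_error B.
Proof. by apply: sumr_ge0 => i _; exact: truncation_error_term_ge0. Qed.

Lemma cvg_truncation_error : truncation_error B @[B --> +oo] --> (0 : R).
Proof.
rewrite [X in _ --> X](_ : _ = \sum_(i < n) 0); last by rewrite big1.
apply: cvg_sumr => i.
have h0 : (Num.sqrt (c i))^-1 * ((`|A| + 1) * (Num.sqrt (L B))^-1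
    + (cutoff_exponent F B)^-1 / Num.sqrt (L B)
    + `|(S i (z B) - c i * L B) / Num.sqrt (L B)|) @[B --> +oo] --> (0 : R).
  rewrite [X in _ --> X](_ : _ = (Num.sqrt (c i))^-1 * ((`|A| + 1) * 0 + 0 + `|0 : R|)); last first.
    by rewrite normr0; ring.
  apply: cvgM; first exact: cvg_cst.
  apply: cvgD; last by apply: cvg_norm; exact: cvg_S_sub c_gt0 g_mertens _ Fy i.
  apply: cvgD; last exact: cvg_inv_cutoff_exponent.
  apply: cvgM; first exact: cvg_cst.
  by apply: cvgr0_inv; apply: cvgry_sqrt; exact: cvg_loglog.
apply: cvg_trans h0; apply: near_eq_cvg; apply: nearW => B.
set e := (cutoff_exponent F B)^-1; rewrite sqrtrM ?(ltW (c_gt0 i))// invfM normrM.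
by rewrite (ger0_norm (x := (Num.sqrt (L B))^-1)) ?invr_ge0 ?sqrtr_ge0//; ring.
Qed.

Lemma normalized_sieve_approx : \forall B \near +oo, forall a, small m F B a ->
  `|normalized_omega B a - normalized_sieve B a| <= truncation_error B.
Proof.
near=> B => a sa.
have [F1 lF _ _] : [/\ 1 < F B, 1 <= ln (F B), 1 <= L B & 1 <= logloglog F B].
  by near: B; exact: near_scales.
have z1 : 1 < z B by near: B; apply: cvgry_gt; exact: cvg_cutoff.
have lF0 : ln (F B) != 0 by rewrite gt_eqF// (lt_le_trans ltr01).
apply: norm_rV_le => [|i]; first exact: truncation_error_ge0.
apply: (@le_trans _ _ ((`|A| + 1 + (cutoff_exponent F B)^-1 + `|S i (z B) - c i * L B|)
    / Num.sqrt (c i * L B))); last first.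
  rewrite /truncation_error (bigD1 i)//= lerDl; apply: sumr_ge0 => j _.
  exact: truncation_error_term_ge0.
rewrite !mxE -mulrBl normrM (ger0_norm (x := _^-1)) ?invr_ge0 ?sqrtr_ge0//.
rewrite ler_wpM2r ?invr_ge0 ?sqrtr_ge0//.
have mF : (m a i)%:R <= F B.
  by apply: le_trans sa; rewrite ler_nat; exact: leq_bigmax.
have := omega_sub_le A z1 (m_pos a i) mF.
(* The number of large primes [ln (F B) / ln z] is the inverse of the cutoff exponent. *)
rewrite {2}/cutoff ln_powR invfM mulrCA divff// mulr1.
rewrite sumrB (@sum_prime_list R A (z B) (fun p => g (vec1 i p))); last first.
  by move=> p pp pA; rewrite (g_vec1_eq0 g_ext).
rewrite /dvd_ind /sieve_primes; set x := \sum_(p <- _) _; set w := (omega _)%:R.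
set s := S i _; set e := _^-1 => /andP[w0 w1].
rewrite (_ : _ - _ - _ = (w - x) + (s - c i * L B)); last by ring.
by apply: le_trans (ler_normD _ _) _; rewrite lerD2r ger0_norm.
Unshelve. all: by end_near. Qed.

End normalized_counts.

Lemma mean_functional_avg {R : realType} {n : nat} {Omega : pointedType}
    (h : Omega -> R) (X : Omega -> 'rV[R]_n) B : (0 < height_count h B)%N ->
  mean_functional (fun f => avg h B (fun a => f (X a))).
Proof.
move=> N0; split=> [f g _ _|a f _|f g _ _ fg|]; first exact: avgD.
- exact: avgZ.
- by apply: ler_avg => a.
- exact: avg_cst.
Qed.

Theorem theorem2p1 (R : realType) (n : nat) (n_gt0 : (0 < n)%N)
  (Omega : pointedType) (Omega_infinite : infinite_set [set: Omega])
  (A : R) (h : Omega -> R) (h_ge0 : forall a, 0 <= h a)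
  (m : Omega -> {ffun 'I_n -> nat}) (m_pos : forall a, pos_vec (m a))
  (F : R -> R)
  (height_finite : forall B : R, 0 <= B -> finite_set [set a | h a <= B])
  (g : {ffun 'I_n -> nat} -> R)
  (g_lim : forall d, pos_vec d -> rough A d ->
    (div_count h m d B)%:R / (height_count h B)%:R @[B --> +oo] --> g d)
  (g_mul : forall a b, pos_vec a -> pos_vec b -> rough A a -> rough A b ->
    coprime (\prod_i a i) (\prod_i b i) -> g (vec_mul a b) = g a * g b)
  (g_ext : forall d, pos_vec d -> ~ rough A d -> g d = 0)
  (c c' : 'I_n -> R) (c_gt0 : forall i, 0 < c i)
  (g_sq_tail : forall i, exists C : R, \forall T \near +oo%R,
    (\sum_(0 <= p <oo | prime p && (T < p%:R)%R) (g (vec1 i p) ^+ 2)%:E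
       <= (C / ln T)%:E)%E)
  (g_mertens : forall i, exists C : R, \forall T \near +oo%R,
    `|primes_le_sum T (fun p => g (vec1 i p)) - (c i * ln (ln T) + c' i)|
      <= C / ln T)
  (m_le_F : (set_card [set a | h a <= B /\ (\max_i m a i)%:R <= F B])%:R
              / (height_count h B)%:R @[B --> +oo] --> (1 : R))
  (level_of_distribution : let eps B := ln (ln (ln (F B))) / Num.sqrt (ln (ln (F B))) in
    forall gamma : R, 0 < gamma -> exists C : R, \forall B \near +oo%R,
      \sum_(d \in [set d | [/\ pos_vec d, (\max_i d i)%:R <= F B `^ eps B
                            & rough A d]])
         (\prod_i (mobius (d i))%:~R ^+ 2) * `|remainder h m g d B|
      <= C * ((height_count h B)%:R / ln (ln (F B)) `^ gamma))
  (sigma : 'M[R]_n)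
  (sigma_lim : forall i j,
    primes_le_sum T (fun p => g (vec2 i j p))
      / (Num.sqrt (primes_le_sum T (fun p => g (vec1 i p)))
         * Num.sqrt (primes_le_sum T (fun p => g (vec1 j p))))
      @[T --> +oo] --> sigma i j) :
  let K (B : R) (a : Omega) : 'rV[R]_n :=
    \row_i (((omega (m a i))%:R - c i * ln (ln (F B)))
              / Num.sqrt (c i * ln (ln (F B)))) in
  exists nu : probability (borel_rV R n) R,
    central_normal nu sigma /\
    cvg_in_distribution +oo (prob_height h) K nu.
Proof.
move=> K.
have Fy := cvg_F height_finite h_ge0 g_lim c_gt0 g_mertens m_le_F n_gt0 m_pos.
pose q (t : 'rV[R]_n) : 'I_n -> R := fun i => t ord0 i.
have QE t : (t *m sigma *m t^T) ord0 ord0 = quadratic_form sigma (q t).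
  rewrite quad_sumE; apply: eq_bigr => i _; apply: eq_bigr => j _; exact: mulrAC.
have sigmaT : sigma^T = sigma.
  by apply/matrixP => i j; rewrite mxE; exact: sigma_sym sigma_lim j i.
have sigma0 (t : 'rV[R]_n) : 0 <= (t *m sigma *m t^T) ord0 ord0.
  rewrite QE; exact: (quadratic_form_ge0 height_finite h_ge0 g_lim g_ext c_gt0
    g_sq_tail g_mertens Fy sigma_lim).
have [nu [nuN nu_cos]] := gaussian_exists sigmaT sigma0.
exists nu; split=> // f fc fM.
have bf : bounded_continuous f by split.
have mid : measurable_fun [set: borel_rV R n] (id : borel_rV R n -> borel_rV R n).
  exact: measurable_id.
have nuE u : bounded_continuous u -> (\int[nu]_x (u x)%:E = (prob_mean nu id u)%:E)%E.
  by move=> bu; rewrite -(prob_meanE nu mid bu).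
have good1 := cvg_avg_small height_finite h_ge0 m_le_F.
have er0 := truncation_error_ge0 A g c F.
have er := cvg_truncation_error A c_gt0 g_mertens Fy.
have close := normalized_sieve_approx m_pos g_ext c Fy.
have N0 := near_height_count height_finite h_ge0.
have Kf : avg h B (fun a => f (K B a)) @[B --> +oo] --> prob_mean nu id f.
  apply: (@cvg_mean_trig R n R +oo _ (fun B f => avg h B (fun a => f (K B a)))) => //.
  - by apply: filterS N0 => B; exact: mean_functional_avg.
  - exact: mean_functional_prob.
  - move=> u theta.
    have -> : prob_mean nu id (fun x => cos (dot u x + theta)) =
        expR (- (quadratic_form sigma (q u) / 2)) * cos theta.
      apply: EFin_inj; rewrite -nuE; last exact/bounded_continuous_trigpoly/trigpoly_cos.
      by rewrite nu_cos QE.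
    apply: (transfer_cos height_finite h_ge0 good1 er0 er close).
    under eq_fun do under eq_fun do rewrite dot_normalized_sieve.
    exact: (cvg_avg_cos_sieve height_finite h_ge0 g_lim g_mul g_ext c_gt0
      g_sq_tail g_mertens Fy sigma_lim level_of_distribution).
  - apply: (transfer_tight height_finite h_ge0 good1 er close) => i.
    (* Tightness needs only second moments of single coordinates, which are linear statistics along
       basis vectors. *)
    have [C HC] := avg_sqr_sieve_bounded height_finite h_ge0 g_lim g_mul g_ext c_gt0
      g_sq_tail g_mertens Fy sigma_lim level_of_distribution (q (delta_mx ord0 i)).
    exists C; apply: filterS HC => B.
    under eq_fun do rewrite -dot_normalized_sieve dot_delta.
    by [].
  - exact: tight_prob.
have -> : ('E_nu[f] = (prob_mean nu id f)%:E)%E by rewrite unlock nuE.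
have Kf' : (avg h B (fun a => f (K B a)))%:E @[B --> +oo] --> (prob_mean nu id f)%:E.
  by apply: cvg_EFin; [exact: nearW|exact: Kf].
(* Expectations under [prob_height] are the averages once some element has height at most [B], hence
   eventually. *)
apply: cvg_trans Kf'; apply: near_eq_cvg; apply: filterS N0 => B NB.
by rewrite expectation_prob_height.
Qed.
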